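(* Let the advection velocity $\mathbf{a}\in\mathbb{R}^d\setminus\{\mathbf{0}\}$ and the kinematic viscosity $\nu>0$ be constant. Consider discretizations (mesh $\mathcal{M}$, spaces $\mathcal{V}^h,\mathcal{Q}^h,\mathcal{Q}'$, parameters $\tau_{\text{C}},\tau_{\text{M}}$ as in the context) with global mesh size $h=\max_eh_e$, $h_e$ being the diameter of $\Omega^e$, for which the mesh is quasi-uniform, i.e. $\max_eh_e/\min_eh_e\le C_{\text{qu}}$, and the following assumptions hold, where the constants $C_{\text{qu}},C_{\text{inv}},C_{\text{interp}}>0$, the function $\phi$ and the integers $k_v\ge1$, $k_q\ge0$ do not depend on the mesh. (i) For each element $\Omega^e\in\mathcal{M}$ and all $\mathbf{v}^h\in\mathcal{V}^h$, $$\left(\nabla\cdot(2\nu\nabla^s\mathbf{v}^h),\nabla\cdot(2\nu\nabla^s\mathbf{v}^h)\right)_{\Omega^e}\le\frac{C_{\text{inv}}}{h_e^2}\left(\nu\nabla^s\mathbf{v}^h,\nu\nabla^s\mathbf{v}^h\right)_{\Omega^e}.$$ (ii) For each element $\Omega^e\in\mathcal{M}$, $\tau_{\text{M}}\le\dfrac{h_e^2}{C_{\text{inv}}\nu}$ on $\Omega^e$. (iii) $\nabla\cdot\mathcal{V}^h\subseteq\mathcal{Q}^h$. (iv) There exist interpolation operators $\mathcal{I}_v:\mathring{\mathcal{V}}\to\mathring{\mathcal{V}}^h$ and $\mathcal{I}_q:\mathcal{Q}\to\tilde{\mathcal{Q}}$ such that for every $\mathbf{v}\in\mathring{\mathcal{V}}\cap(H^{k_v+1}(\Omega))^d$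 and integer $0\le l\le k_v+1$, $$\sum_{e=1}^{n_{el}}|\mathbf{v}-\mathcal{I}_v\mathbf{v}|^2_{(H^l(\Omega^e))^d}\le C_{\text{interp}}h^{2(k_v+1-l)}|\mathbf{v}|^2_{(H^{k_v+1}(\Omega))^d},$$ and for every $q\in\mathcal{Q}\cap H^{k_q+1}(\Omega)$ and integer $0\le l\le k_q+1$, $$\sum_{e=1}^{n_{el}}|q-\mathcal{I}_qq|^2_{H^l(\Omega^e)}\le C_{\text{interp}}h^{2(k_q+1-l)}|q|^2_{H^{k_q+1}(\Omega)}.$$ (v) For each element $\Omega^e\in\mathcal{M}$, $\tau_{\text{M}}=\dfrac{h_e}{2|\mathbf{a}|}\phi(\gamma_e)$ on $\Omega^e$, where $\gamma_e=\dfrac{|\mathbf{a}|h_e}{2\nu}$ is the element Péclet number and $\phi:(0,\infty)\to(0,\infty)$ is a monotone function with $\phi(\gamma)\le\min\{1,4\gamma/C_{\text{inv}}\}$. Then there is a dimensionless constant $C_{\text{bound}}$, independent of $h$ (and of $\mathbf{a}$, $\nu$, $\mathbf{u}$, $p$), such that, if the exact solution $(\mathbf{u},p)\in\mathcal{V}\times\mathcal{Q}$ of the Oseen problem lies in $(H^{k_v+1}(\Omega))^d\times H^{k_q+1}(\Omega)$ and $(\mathbf{u}^h,\tilde p)\in\mathring{\mathcal{V}}^h\times\tilde{\mathcal{Q}}$ is the solution of the reduced discrete formulation, then $$|||(\mathbf{u}-\mathbf{u}^h,p-\tilde p)|||^2\le C_{\text{bound}}\left(\max\{|\mathbf{a}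|h,\nu\}\,h^{2k_v}|\mathbf{u}|^2_{(H^{k_v+1}(\Omega))^d}+\max\{|\mathbf{a}|h,\nu\}^{-1}h^{2k_q+2}|p|^2_{H^{k_q+1}(\Omega)}\right).$$
   Context: Let $\Omega\subset\mathbb{R}^d$ be a bounded domain with $d\in\{2,3\}$, $\mathbf{f}\in(L^2(\Omega))^d$, $\mathcal{V}=(H^1_0(\Omega))^d$, $\mathcal{Q}=L^2_0(\Omega)$ (mean-zero $L^2$ functions), $\mathring{\mathcal{V}}=\{\mathbf{v}\in\mathcal{V}:\nabla\cdot\mathbf{v}=0\}$. $(\cdot,\cdot)$ is the $L^2(\Omega)$ inner product, $(\cdot,\cdot)_{\Omega^e}$ the $L^2(\Omega^e)$ inner product, $\nabla^s$ the symmetrized gradient, $|\cdot|_{H^l}$ the $H^l$ semi-norm (the $L^2$ norm for $l=0$), and $c(\mathbf{a},\mathbf{v}_1,\mathbf{v}_2)=\int_\Omega(\mathbf{a}\cdot\nabla\mathbf{v}_1)\cdot\mathbf{v}_2\,d\Omega$, $k(\mathbf{v}_1,\mathbf{v}_2)=\int_\Omega2\nu\nabla^s\mathbf{v}_1:\nabla^s\mathbf{v}_2\,d\Omega$, $b(\mathbf{v},q)=\int_\Omega(\nabla\cdot\mathbf{v})q\,d\Omega$. Oseen problem: find $(\mathbf{u},p)\in\mathcal{V}\times\mathcal{Q}$ with $c(\mathbf{a},\mathbf{u},\mathbf{v})+k(\mathbf{u},\mathbf{v})-b(\mathbf{v},p)+b(\mathbf{u},q)=(\mathbf{f},\mathbf{v})$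 for all $(\mathbf{v},q)\in\mathcal{V}\times\mathcal{Q}$. Discrete spaces: $\mathcal{V}^h\subset\mathcal{V}$ and $\mathcal{Q}^h\subset\mathcal{Q}\cap H^1(\Omega)$ are finite-dimensional, form an inf-sup stable pair, and are (mapped) piecewise-polynomial or piecewise-rational with respect to a mesh $\mathcal{M}$ of elements $\Omega^e$, $e=1,\dots,n_{el}$, with $\Omega=\text{int}(\cup_e\overline{\Omega^e})$. $\mathcal{Q}'\subset H^1(\Omega)$ is a finite-dimensional space with $\mathcal{Q}^h\subseteq\mathcal{Q}'$, and $\tilde{\mathcal{Q}}=\mathcal{Q}^h+\mathcal{Q}'=\mathcal{Q}'$. $\mathring{\mathcal{V}}^h=\{\mathbf{v}^h\in\mathcal{V}^h:b(\mathbf{v}^h,q^h)=0\ \text{for all }q^h\in\mathcal{Q}^h\}$. $\tau_{\text{C}}\ge0$ and $\tau_{\text{M}}>0$ are stabilization parameters. Convention: inner products involving $\nabla\cdot(2\nu\nabla^s\mathbf{v})$ for functions that are only elementwise $H^2$ are understood as sums of the $L^2$ inner products over element interiors. Reduced discrete formulation: find $(\mathbf{u}^h,\tilde p)\in\mathring{\mathcal{V}}^h\times\tilde{\mathcal{Q}}$ such that for all $(\mathbf{v}^h,\tilde q)\in\mathring{\mathcal{V}}^h\times\tilde{\mathcal{Q}}$, $A_{\text{red}}((\mathbf{u}^h,\tilde p),(\mathbf{v}^h,\tilde q))=(\mathbf{f},\mathbf{v}^h)+(\mathbf{f},\tau_{\text{M}}(\mathbf{a}\cdot\nabla\mathbf{v}^h+\nabla\tilde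 q))$, where \begin{align*} A_{\text{red}}((\mathbf{w},r),(\mathbf{v},q))={}&c(\mathbf{a},\mathbf{w},\mathbf{v})+k(\mathbf{w},\mathbf{v})+(\tau_{\text{C}}\nabla\cdot\mathbf{w},\nabla\cdot\mathbf{v})\\ &+\left(\mathbf{a}\cdot\nabla\mathbf{w}-\nabla\cdot(2\nu\nabla^s\mathbf{w})+\nabla r,\ \tau_{\text{M}}(\mathbf{a}\cdot\nabla\mathbf{v}+\nabla q)\right). \end{align*} Norm: $|||(\mathbf{v},q)|||^2=k(\mathbf{v},\mathbf{v})+(\mathbf{a}\cdot\nabla\mathbf{v}+\nabla q,\tau_{\text{M}}(\mathbf{a}\cdot\nabla\mathbf{v}+\nabla q))$. The constant $C_{\text{bound}}$ may depend on $d,k_v,k_q,C_{\text{inv}},C_{\text{interp}},C_{\text{qu}}$ and $\phi$. *)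

(* Defs.v *)
From HB Require Import structures.
From mathcomp Require Import all_boot all_order all_algebra.
From mathcomp Require Import all_classical all_reals all_analysis.

Set Implicit Arguments.
Unset Strict Implicit.
Unset Printing Implicit Defensive.
Import Order.TTheory GRing.Theory Num.Theory.
Import numFieldNormedType.Exports.

Local Open Scope classical_set_scope.
Local Open Scope ring_scope.

Definition rV_display : measure_display.
Proof. exact: default_measure_display. Qed.

Section rV_measurable.
Context (R : realType) (n : nat).

(* The sigma-algebra generated by the coordinates, i.e. the Borel one. *)
Let coord (i : 'I_n) (x : 'rV[R]_n) : measurableTypeR R := x 0 i.

Let rV_set0 : g_sigma_preimage coord set0.
Proof. exact: sigma_algebra0. Qed.

Let rV_setC A : g_sigma_preimage coord A -> g_sigma_preimage coord (~` A).
Proof. exact: sigma_algebraC. Qed.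

Let rV_bigcup (F : (set _)^nat) : (forall i, g_sigma_preimage coord (F i)) ->
  g_sigma_preimage coord (\bigcup_i (F i)).
Proof. exact: sigma_algebra_bigcup. Qed.

HB.instance Definition _ := @isMeasurable.Build rV_display
  'rV[R]_n (g_sigma_preimage coord) rV_set0 rV_setC rV_bigcup.

Lemma measurable_coord (i : 'I_n) :
  measurable_fun [set: 'rV[R]_n] (fun x => x 0 i : measurableTypeR R).
Proof.
move=> _ Y mY; rewrite setTI; apply: sub_sigma_algebra => /=.
rewrite -bigcup_seq/=; exists i => /=; first by rewrite mem_index_enum.
by exists Y => //; rewrite setTI.
Qed.

Lemma measurable_fun_coordP d (T : measurableType d) (f : T -> 'rV[R]_n) :
  (forall i, measurable_fun [set: T] (fun x => f x 0 i : measurableTypeR R)) ->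
  measurable_fun [set: T] f.
Proof.
move=> mf _ A; rewrite setTI; suff: g_sigma_preimage coord `<=`
  [set B | measurable (f @^-1` B)] by apply.
apply: smallest_sub => /=.
  split => /=.
  - by rewrite preimage_set0.
  - by move=> B mB; rewrite setTD -preimage_setC; exact: measurableC.
  - by move=> F mF; rewrite preimage_bigcup; exact: bigcup_measurable.
rewrite -bigcup_seq => B [i _ [C mC <-]] /=.
by rewrite setTI; have := mf i measurableT C mC; rewrite setTI.
Qed.

End rV_measurable.

Section rV_lebesgue_measure.
Context (R : realType).

Definition cons_rV n (p : measurableTypeR R * 'rV[R]_n) : 'rV[R]_n.+1 :=
  \row_i if unlift ord0 i is Some j then p.2 0 j else p.1.

Definition behead_rV n (v : 'rV[R]_n.+1) : measurableTypeR R * 'rV[R]_n :=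
  (v 0 0, \row_i v 0 (lift ord0 i)).

Lemma cons_rVK n : cancel (@cons_rV n) (@behead_rV n).
Proof.
move=> [a v]; rewrite /behead_rV mxE unlift_none; congr pair.
by apply/rowP => i; rewrite !mxE liftK.
Qed.

Lemma behead_rVK n : cancel (@behead_rV n) (@cons_rV n).
Proof.
by move=> v; apply/rowP => i; rewrite !mxE; case: unliftP => [j|] -> //=; rewrite mxE.
Qed.

Lemma measurable_cons_rV n : measurable_fun [set: _] (@cons_rV n).
Proof.
apply: measurable_fun_coordP => i; case: (unliftP ord0 i) => [j|] ->.
  under eq_fun do rewrite mxE liftK.
  exact: (measurableT_comp (measurable_coord j) measurable_snd).
under eq_fun do rewrite mxE unlift_none.
exact: measurable_fst.
Qed.

Lemma measurable_behead_rV n : measurable_fun [set: _] (@behead_rV n).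
Proof.
apply: measurable_fun_pair => /=; first exact: measurable_coord.
apply: measurable_fun_coordP => i; under eq_fun do rewrite mxE.
exact: measurable_coord.
Qed.

Section cons_measure.
Context n (mu : {sigma_finite_measure set 'rV[R]_n -> \bar R}).

Let nu : set 'rV[R]_n.+1 -> \bar R :=
  pushforward (@lebesgue_measure R \x mu)%E (@cons_rV n).

Let nu0 : nu set0 = 0%E.
Proof. by rewrite /nu /pushforward preimage_set0 measure0. Qed.

Let nu_ge0 A : (0 <= nu A)%E.
Proof. by rewrite /nu /pushforward; exact: measure_ge0. Qed.

Let mpre A : measurable A -> measurable (@cons_rV n @^-1` A).
Proof. by move=> mA; rewrite -[X in measurable X]setTI; exact: measurable_cons_rV. Qed.

Let nu_sigma_additive : semi_sigma_additive nu.
Proof.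
move=> F mF tF mUF; rewrite /nu /pushforward preimage_bigcup.
apply: measure_semi_sigma_additive.
- by move=> i; exact: mpre.
- apply/trivIsetP => /= i j _ _ ij; rewrite -preimage_setI.
  by move/trivIsetP : tF => /(_ _ _ _ _ ij) ->//; rewrite preimage_set0.
- by rewrite -preimage_bigcup; exact: mpre.
Qed.

HB.instance Definition _ :=
  isMeasure.Build _ _ _ nu nu0 nu_ge0 nu_sigma_additive.

Let nu_sigma_finite : sigma_finite setT nu.
Proof.
have /sigma_finiteP[F [TF ndF Foo]] := sigma_finiteT (@lebesgue_measure R).
have /sigma_finiteP[G [TG ndG Goo]] := sigma_finiteT mu.
exists (fun k => @behead_rV n @^-1` (F k `*` G k)).
  rewrite -preimage_bigcup (_ : \bigcup_k _ = setT) ?preimage_setT//.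
  rewrite -setXTT TF TG predeqE => -[x y]; split.
    by move=> [k _ []/= ? ?]; split; exists k.
  move=> [/= [k _ Fkx] [l _ Gly]]; exists (maxn k l) => //; split.
  - by move: x Fkx; exact/subsetPset/ndF/leq_maxl.
  - by move: y Gly; exact/subsetPset/ndG/leq_maxr.
move=> k; have [mF Fk] := Foo k; have [mG Gk] := Goo k; split.
  by rewrite -[X in measurable X]setTI; apply: measurable_behead_rV => //;
    exact: measurableX.
rewrite /nu /pushforward -comp_preimage (_ : _ \o _ = id); last first.
  by apply/funext => p /=; rewrite cons_rVK.
by rewrite preimage_id product_measure1E// lte_mul_pinfty// ge0_fin_numE.
Qed.

HB.instance Definition _ :=
  Measure_isSigmaFinite.Build _ _ _ nu nu_sigma_finite.

Definition cons_measure : {sigma_finite_measure set 'rV[R]_n.+1 -> \bar R} := nu.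

End cons_measure.

Fixpoint lebesgue_rV n : {sigma_finite_measure set 'rV[R]_n -> \bar R} :=
  match n with
  | 0 => @dirac _ 'rV[R]_0 0 R
  | n'.+1 => cons_measure (lebesgue_rV n')
  end.

End rV_lebesgue_measure.

Lemma lebesgue_rVS (R : realType) n (A : set 'rV[R]_n.+1) :
  lebesgue_rV R n.+1 A =
  pushforward (@lebesgue_measure R \x lebesgue_rV R n)%E (@cons_rV R n) A.
Proof. by []. Qed.

Lemma lebesgue_rV_box (R : realType) n (B : 'I_n -> set R) :
  (forall i, measurable (B i)) ->
  lebesgue_rV R n [set x | forall i, B i (x 0 i)] =
  (\prod_(i < n) lebesgue_measure (B i))%E.
Proof.
elim: n B => [|n IHn] B mB.
  by rewrite big_ord0 /= diracE mem_set// => -[].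
rewrite big_ord_recl -(IHn (fun i => B (lift ord0 i)))//.
have mBl : measurable [set x : 'rV[R]_n | forall i, B (lift ord0 i) (x 0 i)].
  rewrite [X in measurable X](_ : _ = \bigcap_(i in [set` index_enum 'I_n])
    ((fun x : 'rV[R]_n => x 0 i : measurableTypeR R) @^-1` B (lift ord0 i))).
    rewrite bigcap_seq; apply: bigsetI_measurable => i _.
    by have := measurable_coord i measurableT (mB (lift ord0 i)); rewrite setTI.
  apply/seteqP; split=> [x Bx i _|x Bx i]; first exact: Bx.
  by apply: (Bx i); rewrite /= mem_index_enum.
rewrite -product_measure1E//; last exact: mB.
apply: (etrans (lebesgue_rVS _)); rewrite /pushforward.
congr (_ _); apply/seteqP; split=> -[a v] /=.
  move=> Bav; split; first by have := Bav ord0; rewrite mxE unlift_none.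
  by move=> i; have := Bav (lift ord0 i); rewrite mxE liftK.
by move=> [Ba Bv] i; rewrite mxE; case: unliftP => [j|] ->.
Qed.

(* The library norm on row vectors is the sup norm. *)
Definition enorm (R : realType) d (x : 'rV[R]_d) : R :=
  Num.sqrt (\sum_i x 0 i ^+ 2).

Definition diam (R : realType) d (A : set 'rV[R]_d) : R :=
  sup [set enorm (xy.1 - xy.2) | xy in A `*` A].

Section calculus.
Context {R : realType} {d : nat}.
Local Notation pt := 'rV[R]_d.
Local Notation mu := (lebesgue_rV R d).
Implicit Types (U D : set pt) (f u w phi : pt -> R) (v : pt -> pt).

Definition partial (i : 'I_d) f : pt -> R := 'D_(delta_mx 0 i) f.

Definition smooth_on U f := forall (s : seq 'I_d) x, U x ->
  {for x, continuous (foldr partial f s)} /\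
  forall i, derivable (foldr partial f s) x (delta_mx 0 i).

(* Multi-indices are functions 'I_d -> nat. *)
Definition mpartial (a : 'I_d -> nat) f : pt -> R :=
  foldr (fun i => iter (a i) (partial i)) f (enum 'I_d).

Definition mlen (a : 'I_d -> nat) : nat := (\sum_i a i)%N.

Definition midx1 (i : 'I_d) : 'I_d -> nat := fun j => (j == i : nat).

Definition test_fun D phi := smooth_on setT phi /\
  exists2 K, compact K /\ K `<=` D & forall x, ~ K x -> phi x = 0.

(* Elements of L^2(D) are represented by functions on the whole space, of which
   only the restriction to D (and only up to null sets) is relevant. *)
Definition L2 D : set (pt -> R) := [set f | f \_ D \in Lfun mu 2%:E].

Definition ipr D f u : R := \int[mu]_(x in D) (f x * u x).

Definition is_wderiv D (a : 'I_d -> nat) u w := L2 D w /\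
  forall phi, test_fun D phi ->
    ipr D u (mpartial a phi) = (-1) ^+ mlen a * ipr D w phi.

(* The weak derivative, a chosen representative (unique up to null sets), and 0
   when there is no square-integrable one. *)
Definition wderiv D (a : 'I_d -> nat) u : pt -> R :=
  xget (fun=> 0) [set w | is_wderiv D a u w].

Definition wpartial D (i : 'I_d) u : pt -> R := wderiv D (midx1 i) u.

Definition Hk k D : set (pt -> R) := [set u | L2 D u /\
  forall a, (mlen a <= k)%N -> exists w, is_wderiv D a u w].

(* The square of the H^k(D) semi-norm, a sum over the multi-indices of length
   k. *)
Definition hsemi2 k D u : R :=
  \sum_(a : {ffun 'I_d -> 'I_k.+1} | mlen (fun i => a i : nat) == k)
    ipr D (wderiv D (fun i => a i : nat) u) (wderiv D (fun i => a i : nat) u).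

Definition H10 D : set (pt -> R) := [set u | Hk 1 D u /\
  forall eps, 0 < eps -> exists2 phi, test_fun D phi &
    hsemi2 0 D (u - phi) + hsemi2 1 D (u - phi) < eps].

Definition coordf v (i : 'I_d) : pt -> R := fun x => v x 0 i.

Definition L2v D : set (pt -> pt) := [set v | forall i, L2 D (coordf v i)].
Definition Hkv k D : set (pt -> pt) := [set v | forall i, Hk k D (coordf v i)].
Definition H10v D : set (pt -> pt) := [set v | forall i, H10 D (coordf v i)].
Definition hsemi2v k D v : R := \sum_i hsemi2 k D (coordf v i).

Definition dotv (x y : pt) : R := \sum_i x 0 i * y 0 i.
Definition ddot (A B : 'M[R]_d) : R := \sum_i \sum_j A i j * B i j.

Definition iprv D v v' : R := \int[mu]_(x in D) dotv (v x) (v' x).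
Definition iprm D (A B : pt -> 'M[R]_d) : R :=
  \int[mu]_(x in D) ddot (A x) (B x).

Definition grad D u : pt -> pt := fun x => \row_i wpartial D i u x.
Definition divergence D v : pt -> R := fun x =>
  \sum_i wpartial D i (coordf v i) x.
Definition sgrad D v : pt -> 'M[R]_d := fun x =>
  \matrix_(i, j) (2^-1 *
    (wpartial D j (coordf v i) x + wpartial D i (coordf v j) x)).
Definition mdivergence D (A : pt -> 'M[R]_d) : pt -> pt := fun x =>
  \row_i \sum_j wpartial D j (fun y => A y i j) x.
(* (a . nabla) v for a constant vector a. *)
Definition advect D (a : pt) v : pt -> pt := fun x =>
  \row_i \sum_j a 0 j * wpartial D j (coordf v i) x.
(* nabla . (2 nu nabla^s v) *)
Definition visc_div D (nu : R) v : pt -> pt :=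
  mdivergence D (fun x => (2 * nu) *: sgrad D v x).

End calculus.

Section spaces.
Context {R : realType} {d : nat}.
Local Notation pt := 'rV[R]_d.
Local Notation mu := (lebesgue_rV R d).
Implicit Types (D Om K U : set pt) (v w : pt -> pt) (q r : pt -> R).

Definition is_domain Om :=
  [/\ open Om, connected Om, Om !=set0 & bounded_set Om].

(* L^2 functions of zero mean. *)
Definition L20 Om : set (pt -> R) :=
  [set q | L2 Om q /\ \int[mu]_(x in Om) q x = 0].

(* Divergence-free fields of H^1_0. *)
Definition H10div0 Om : set (pt -> pt) :=
  [set v | H10v Om v /\ divergence Om v = (fun=> 0) %[ae mu in Om]].

(* Dimension is meant modulo equality almost everywhere on D. *)
Definition fdim_subspace (W : lmodType R) D (S : set (pt -> W)) :=
  [/\ S (fun=> 0),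
      forall g1 g2, S g1 -> S g2 -> S (fun x => g1 x + g2 x),
      forall (c : R) g, S g -> S (fun x => c *: g x) &
      exists n (b : 'I_n -> pt -> W), (forall i, S (b i)) /\
        forall g, S g -> exists c : 'I_n -> R,
          g = (fun x => \sum_i c i *: b i x) %[ae mu in D]].

Definition is_mesh Om nel (E : 'I_nel -> set pt) :=
  [/\ forall e, open (E e) /\ E e !=set0,
      trivIset setT E,
      forall e, mu.-negligible (closure (E e) `\` E e) &
      Om = interior (\bigcup_e closure (E e))].

Definition polynomial_fun r := exists N (c : {ffun 'I_d -> 'I_N} -> R),
  forall x, r x = \sum_a c a * \prod_i x 0 i ^+ a i.

Definition rational_on K r := exists p q,
  [/\ polynomial_fun p, polynomial_fun q &
      forall x, K x -> q x != 0 /\ r x = p x / q x].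

Definition diffeo K U (F G : pt -> pt) :=
  [/\ forall x, K x -> U (F x) /\ G (F x) = x,
      forall y, U y -> K (G y) /\ F (G y) = y,
      forall i, smooth_on K (coordf F i) &
      forall i, smooth_on U (coordf G i)].

(* On each element, the functions are push-forwards of rational functions (in
   particular, of polynomials) by a smooth parametrization F : K -> E e with
   inverse G. The smooth factors J and j account for the Piola transforms;
   composition with F corresponds to J = 1 and j = 1, and physical polynomials
   or rational functions to K = E e and F = id in addition. *)
Definition mapped_piecewise_rational nel (E : 'I_nel -> set pt)
    (Vh : set (pt -> pt)) (Qh : set (pt -> R)) :=
  forall e, exists K (F G : pt -> pt) (J : pt -> 'M[R]_d) (j : pt -> R),
  [/\ open K /\ diffeo K (E e) F G,
      forall i k, smooth_on K (fun x => J x i k),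
      smooth_on K j,
      forall x, K x -> J x \in unitmx /\ j x != 0 &
      (forall v, Vh v -> exists r : pt -> pt,
         (forall i, rational_on K (coordf r i)) /\
         v = (fun y => r (G y) *m J (G y)) %[ae mu in E e]) /\
      (forall q, Qh q -> exists r : pt -> R,
         rational_on K r /\
         q = (fun y => r (G y) * j (G y)) %[ae mu in E e])].

Definition bform Om v q : R := ipr Om (divergence Om v) q.

Definition h1norm Om v : R := Num.sqrt (hsemi2v 0 Om v + hsemi2v 1 Om v).

Definition inf_sup_stable Om (Vh : set (pt -> pt)) (Qh : set (pt -> R)) :=
  exists2 beta : R, 0 < beta & forall q, Qh q ->
    beta * Num.sqrt (ipr Om q q) <=
    sup [set bform Om v q / h1norm Om v |
         v in [set v | Vh v /\ 0 < h1norm Om v]].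

Definition discrete_spaces Om nel (E : 'I_nel -> set pt)
    (Vh : set (pt -> pt)) (Qh Q' : set (pt -> R)) :=
  [/\ [/\ fdim_subspace Om Vh, fdim_subspace Om (W := R^o) Qh &
          fdim_subspace Om (W := R^o) Q'],
      [/\ Vh `<=` H10v Om, Qh `<=` L20 Om `&` Hk 1 Om, Q' `<=` Hk 1 Om &
          Qh `<=` Q'],
      inf_sup_stable Om Vh Qh,
      mapped_piecewise_rational E Vh Qh &
      (* so that the second derivatives of discrete velocities are square
         integrable over element interiors *)
      forall v, Vh v -> forall e, Hkv 2 (E e) v].

Definition Qtilde (Qh Q' : set (pt -> R)) : set (pt -> R) :=
  [set q | exists q1 q2, [/\ Qh q1, Q' q2 & q = (fun x => q1 x + q2 x)]].

Definition Vh0 Om (Vh : set (pt -> pt)) (Qh : set (pt -> R)) :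
    set (pt -> pt) :=
  [set v | Vh v /\ forall q, Qh q -> bform Om v q = 0].

Definition mesh_size nel (E : 'I_nel -> set pt) : R :=
  \big[Num.max/0]_e diam (E e).

Definition min_size nel (E : 'I_nel -> set pt) : R :=
  \big[Num.min/mesh_size E]_e diam (E e).

End spaces.

Section oseen.
Context {R : realType} {d : nat}.
Local Notation pt := 'rV[R]_d.
Local Notation mu := (lebesgue_rV R d).
Variables (Om : set pt) (a : pt) (nu : R) (f : pt -> pt).
Implicit Types (v w : pt -> pt) (q r : pt -> R).

Definition cform v w : R := iprv Om (advect Om a v) w.

Definition kform v w : R :=
  \int[mu]_(x in Om) (2 * nu * ddot (sgrad Om v x) (sgrad Om w x)).

Definition oseen_solution v q :=
  [/\ H10v Om v, L20 Om q &
   forall w r, H10v Om w -> L20 Om r ->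
     cform v w + kform v w - bform Om w q + bform Om v r = iprv Om f w].

(* a . nabla v + nabla q *)
Definition advgrad v q : pt -> pt := fun x => advect Om a v x + grad Om q x.

Variables (nel : nat) (E : 'I_nel -> set pt) (tauC tauM : pt -> R).

Definition stab_test v q : pt -> pt := fun x => tauM x *: advgrad v q x.

Definition A_red w r v q : R :=
  cform w v + kform w v
  + ipr Om (fun x => tauC x * divergence Om w x) (divergence Om v)
  + \sum_e iprv (E e)
      (fun x => advect Om a w x - visc_div (E e) nu w x + grad Om r x)
      (stab_test v q).

Definition reduced_solution (Vh : set (pt -> pt)) (Qh Q' : set (pt -> R))
    w r :=
  [/\ Vh0 Om Vh Qh w, Qtilde Qh Q' r &
   forall v q, Vh0 Om Vh Qh v -> Qtilde Qh Q' q ->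
     A_red w r v q = iprv Om f v + iprv Om f (stab_test v q)].

(* The square of the norm ||| (v, q) |||. *)
Definition tnorm2 v q : R :=
  kform v v + iprv Om (advgrad v q) (stab_test v q).

End oseen.

(* Main.v *)
From HB Require Import structures.
Require Import Defs.
From mathcomp Require Import all_boot all_order all_algebra.
From mathcomp Require Import all_classical all_reals all_analysis.
From mathcomp Require Import measurable_realfun.
From mathcomp Require Import ring lra.

Set Implicit Arguments.
Unset Strict Implicit.
Unset Printing Implicit Defensive.
Import Order.TTheory GRing.Theory Num.Theory.
Import numFieldNormedType.Exports.

Local Open Scope classical_set_scope.
Local Open Scope ring_scope.

(* Let eta = u - I_v u, xi = u_h - I_v u, and likewise etap, xip for the pressures, so
   that the error is (eta - xi, etap - xip).  Since div V_h is contained in Q_h, the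
   discrete fields of Vh0 are exactly divergence free; hence the grad-div term and the
   pressure disappear from the momentum equation tested with xi, and testing the exact
   and the discrete problem with (xi, xip) gives B((eta, etap), (xi, xip)) =
   B((xi, xip), (xi, xip)).  As c(a, xi, xi) = 0, the inverse inequality and
   tau <= h_e^2 / (C_inv nu) make B coercive for the triple norm, and Young's inequality
   bounds everything by interpolation errors, except for the term c(a, eta, xi) =
   - (eta, a . grad xi).  If |a| h <= nu, Korn's identity absorbs it in k(xi, xi).
   Otherwise eta is orthogonal to grad xip (it is divergence free), so a . grad xi may be
   replaced by a . grad xi + grad xip, which the triple norm controls with weight tau, and
   tau >= c h / |a| there: phi is necessarily nondecreasing (a nonincreasing positive phi
   would contradict phi(g) <= 4 g / C_inv near 0) and the element Peclet numbers are
   bounded below by quasi-uniformity. *)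

(** * Lebesgue measure on row vectors and integration by parts *)

(** Derivatives are representatives picked by [xget], so even the linearity of [wpartial] holds only
    almost everywhere and rests on uniqueness of weak derivatives, that is, on the fundamental lemma
    of the calculus of variations. The sigma-algebra and the measure on row vectors come from
    coordinates and products, so that lemma is reached through boxes: they cover open sets
    countably, bump functions approximate their indicators, and they determine measures. [H10] is a
    closure of test functions, so integration by parts and the symmetry behind Korn's identity are
    exact for test functions and extended by Cauchy-Schwarz.

    The exact problem is weak while the stabilization tests a residual, so comparing the two
    problems requires the strong equation almost everywhere; this uses that [u] is in H^2 (from
    [1 <= kv]) and [p] in H^1. The bounds on tau are given on element interiors only, hence they
    hold almost everywhere in the domain; weighted products are handled by putting the square root
    of tau on both factors. *)

Section boxes.
Context {R : realType} {d : nat}.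
Local Notation pt := 'rV[R]_d.
Local Notation mu := (lebesgue_rV R d).

Definition obox (a b : 'I_d -> R) : set pt :=
  [set x | forall i, a i < x 0 i < b i].
Definition cbox (a b : 'I_d -> R) : set pt :=
  [set x | forall i, a i <= x 0 i <= b i].

Lemma measurable_box (B : 'I_d -> set R) :
  (forall i, measurable (B i)) ->
  measurable [set x : pt | forall i, B i (x 0 i)].
Proof.
move=> mB; rewrite [X in measurable X](_ : _ = \bigcap_(i in [set` index_enum 'I_d])
    ((fun x : pt => x 0 i : measurableTypeR R) @^-1` B i)).
  rewrite bigcap_seq; apply: bigsetI_measurable => i _.
  by have := measurable_coord i measurableT (mB i); rewrite setTI.
apply/seteqP; split=> [x Bx i _|x Bx i]; first exact: Bx.
by apply: (Bx i); rewrite /= mem_index_enum.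
Qed.

Lemma oboxE a b :
  obox a b = [set x | forall i, `]a i, b i[%classic (x 0 i)].
Proof. by apply/seteqP; split=> x /= h i; have := h i; rewrite in_itv. Qed.

Lemma cboxE a b :
  cbox a b = [set x | forall i, `[a i, b i]%classic (x 0 i)].
Proof. by apply/seteqP; split=> x /= h i; have := h i; rewrite in_itv. Qed.

Lemma measurable_obox a b : measurable (obox a b).
Proof. by rewrite oboxE; apply: (@measurable_box (fun i => `]a i, b i[%classic)) => i; exact: measurable_itv. Qed.

Lemma measurable_cbox a b : measurable (cbox a b).
Proof. by rewrite cboxE; apply: (@measurable_box (fun i => `[a i, b i]%classic)) => i; exact: measurable_itv. Qed.

Lemma compact_cbox a b : compact (cbox a b).
Proof.
rewrite cboxE; have := @rV_compact R d (fun i => `[a i, b i]%classic).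
by apply => i; exact: segment_compact.
Qed.

Lemma cbox_finite a b : (mu (cbox a b) < +oo)%E.
Proof.
rewrite cboxE (@lebesgue_rV_box R d (fun i => `[a i, b i]%classic)); last first.
  by move=> i; exact: measurable_itv.
rewrite ltey_eq; apply/orP; left.
elim/big_ind : _ => //= [x y xoo yoo|i _]; first exact: fin_numM.
by rewrite lebesgue_measure_itv/=; case: ifPn.
Qed.

(** Boxes with rational corners are countable. The closed boxes are kept inside [D] because they
    will be the compact sets that carry the bump functions. *)
Lemma open_bigcup_obox (D : set pt) : (0 < d)%N -> open D ->
  exists a b : nat -> 'I_d -> R, D = \bigcup_k obox (a k) (b k) /\
    forall k, cbox (a k) (b k) `<=` D.
Proof.
move=> d0 oD.
pose C := {ffun 'I_d -> rat * rat}.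
pose ca (c : C) i : R := ratr (c i).1.
pose cb (c : C) i : R := ratr (c i).2.
(* Codes that denote no closed box inside [D] get the corners 1 and 0; that box is empty because
   [0 < d] provides a coordinate. *)
pose a k i := if (unpickle k : option C) is Some c then
  (if `[< cbox (ca c) (cb c) `<=` D >] then ca c i else 1) else 1.
pose b k i := if (unpickle k : option C) is Some c then
  (if `[< cbox (ca c) (cb c) `<=` D >] then cb c i else 0) else 0.
have e0 (x : pt) : cbox (fun=> 1) (fun=> 0) x -> False.
  by move=> /(_ (Ordinal d0)); lra.
have abD k : cbox (a k) (b k) `<=` D.
  rewrite /a /b; case: (unpickle k : option C) => [c|]; last by move=> x /e0.
  by case: asboolP => [//|_]; move=> x /e0.
exists a, b; split => //; apply/seteqP; split; last first.
  move=> x [k _ xk]; apply: (abD k) => i; have /andP[h1 h2] := xk i.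
  by rewrite !ltW.
move=> x Dx; have /nbhs_ballP[e /= e_gt0 xeD] : nbhs x D by exact: open_nbhs_nbhs.
have h i : exists q : rat * rat, x 0 i - e < ratr q.1 < x 0 i /\
    x 0 i < ratr q.2 < x 0 i + e.
  have [q1 q1P] : exists q, ratr q \in `](x 0 i - e), (x 0 i)[.
    by apply: rat_in_itvoo; rewrite ltrBlDr ltrDl.
  have [q2 q2P] : exists q, ratr q \in `](x 0 i), (x 0 i + e)[.
    by apply: rat_in_itvoo; rewrite ltrDl.
  by exists (q1, q2); move: q1P q2P; rewrite !in_itv.
have [c cP] := fin_all_exists h.
have goodc : cbox (ca (finfun c)) (cb (finfun c)) `<=` D.
  move=> y yc; apply: xeD; split=> // i j; rewrite ord1/= /ball/=.
  have := yc j; rewrite /ca/cb ffunE; have := cP j => -[].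
  rewrite ltr_norml; set u := ratr _; set v := ratr _; lra.
exists (pickle (finfun c : C)) => // i; rewrite /a /b pickleK.
case: asboolP => // _; rewrite /ca /cb ffunE; have [] := cP i.
by move=> /andP[_ ->] /andP[-> _].
Qed.

(** The sigma-algebra is generated by the coordinates, not by the open sets, so the countable
    covering by boxes is what makes this true. In dimension 0 the space is a single point. *)
Lemma open_measurable_rV (D : set pt) : open D -> measurable D.
Proof.
case: (posnP d) => [d0|d0] oD.
  have [->|/set0P[x Dx]] := eqVneq D set0; first exact: measurable0.
  rewrite (_ : D = setT); first exact: measurableT.
  apply/seteqP; split=> // y _; rewrite (_ : y = x)//; apply/rowP => i.
  by exfalso; case: i; rewrite d0.
have [a [b [-> _]]] := open_bigcup_obox d0 oD.
by apply: bigcup_measurable => k _; exact: measurable_obox.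
Qed.

Lemma closed_measurable_rV (D : set pt) : closed D -> measurable D.
Proof.
by move=> cD; rewrite -(setCK D); apply: measurableC;
  apply: open_measurable_rV; exact: closed_openC.
Qed.

Lemma continuous_measurable_rV (f : pt -> R) : continuous f ->
  measurable_fun setT f.
Proof.
move=> cf; apply: (measurability _ (RGenOInfty.measurableE R)) => //.
move=> _ [_ [x ->] <-]; rewrite setTI; apply: open_measurable_rV.
by move/continuousP : cf; apply; exact: interval_open.
Qed.

Lemma bounded_sub_cbox (D : set pt) : bounded_set D ->
  exists2 L : R, 0 < L & D `<=` cbox (fun=> - L) (fun=> L).
Proof.
move=> [M [_ MD]]; exists (`|M| + 1); first by rewrite ltr_wpDl.
move=> x Dx i; have := MD (`|M| + 1).
rewrite (le_lt_trans (ler_norm M)) ?ltrDl// => /(_ isT x Dx)/=.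
move=> h; rewrite -ler_norml; apply: le_trans h.
by rewrite [leRHS]mx_normrE; apply/bigmax_geP; right; exists (0, i).
Qed.

Lemma bounded_finite (D : set pt) : measurable D -> bounded_set D ->
  (mu D < +oo)%E.
Proof.
move=> mD /bounded_sub_cbox[L _ DL].
apply: le_lt_trans (cbox_finite (fun=> - L) (fun=> L)).
by apply: le_measure => //; rewrite inE//; exact: measurable_cbox.
Qed.

End boxes.

(** * Uniqueness of measures on boxes and translation invariance *)

Section box_uniqueness.
Context {R : realType} {d : nat}.
Local Notation pt := 'rV[R]_d.
Local Notation mu := (lebesgue_rV R d).

Definition oboxes : set (set pt) := [set A | exists a b, A = obox a b].

Lemma oboxI a b a' b' : obox a b `&` obox a' b' =
  obox (fun i => Num.max (a i) (a' i)) (fun i => Num.min (b i) (b' i)) :> set pt.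
Proof.
apply/seteqP; split=> x /=; rewrite /obox/=.
  by move=> [h1 h2] i; rewrite gt_max lt_min; case/andP: (h1 i) => -> ->;
    case/andP: (h2 i) => -> ->.
by move=> h; split=> i; have := h i; rewrite gt_max lt_min =>
  /andP[/andP[h1 h2] /andP[h3 h4]]; apply/andP.
Qed.

Lemma setI_oboxes : setI_closed oboxes.
Proof.
move=> _ _ [a [b ->]] [a' [b' ->]]; rewrite oboxI; do 2 eexists; reflexivity.
Qed.

Lemma rV_exhaust (x : pt) : exists n, forall m, (n <= m)%N -> forall i, - m%:R < x 0 i < m%:R.
Proof.
exists (Num.bound `|x|).+1 => m nm i; rewrite -ltr_norml.
apply: (@le_lt_trans _ _ `|x|).
  by rewrite [leRHS]mx_normrE; apply/bigmax_geP; right; exists (0, i).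
apply: lt_le_trans (_ : (Num.bound `|x|).+1%:R <= _); last by rewrite ler_nat.
apply: (lt_trans (archi_boundP _)) => //; by rewrite ltr_nat.
Qed.

(** A coordinate half-space is the increasing union of boxes that are long in all other directions.
    With [setI_oboxes], the open boxes form a generating pi-system. *)
Lemma measurable_oboxes : @measurable _ pt = <<s oboxes >>.
Proof.
apply/seteqP; split; last first.
  apply: smallest_sub; first exact: sigma_algebra_measurable.
  by move=> _ [a [b ->]]; exact: measurable_obox.
apply: smallest_sub; first exact: smallest_sigma_algebra.
rewrite -bigcup_seq => A [i _ hA].
suff h : measurable_fun (setT : set (g_sigma_algebraType oboxes))
    (fun x : pt => x 0 i : measurableTypeR R).
  by case: hA => B mB <-; exact: h.
apply: (measurability _ (RGenOInfty.measurableE R)) => //.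
move=> _ [_ [x ->] <-]; rewrite setTI.
rewrite (_ : _ @^-1` _ = \bigcup_n obox
  (fun j => if j == i then x else - n%:R) (fun j => n%:R)).
  apply: (@bigcup_measurable _ (g_sigma_algebraType oboxes)) => n _.
  by apply: sub_sigma_algebra; do 2 eexists; reflexivity.
apply/seteqP; split=> y /=; rewrite in_itv/= andbT.
  move=> xy; have [n hn] := rV_exhaust y; exists n => // j.
  by have /andP[h1 ->] := hn _ (leqnn n) j; case: eqP => [->|_]; rewrite ?xy ?h1.
by move=> [n _ /(_ i)]; rewrite eqxx => /andP[].
Qed.

(** Uniqueness of measures on a pi-system, with the cubes of half-side n as exhaustion. It serves
    twice: for translation invariance and, applied to the positive and negative parts of a function,
    for the fundamental lemma. *)
Lemma rV_measure_unique (m1 m2 : {measure set pt -> \bar R}) :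
  (forall a b, m1 (obox a b) = m2 (obox a b)) ->
  (forall a b, (m1 (obox a b) < +oo)%E) ->
  forall A, measurable A -> m1 A = m2 A.
Proof.
move=> h foo A mA.
apply: (measure_unique oboxes (fun n => obox (fun=> - n%:R) (fun=> n%:R))) => //.
- exact: measurable_oboxes.
- exact: setI_oboxes.
- by move=> n; do 2 eexists; reflexivity.
- apply/seteqP; split=> // x _; have [n hn] := rV_exhaust x; exists n => //.
  exact: hn.
- by move=> _ [a [b ->]].
Qed.

Lemma obox_finite a b : (mu (obox a b) < +oo)%E.
Proof.
apply: le_lt_trans (cbox_finite a b); apply: le_measure; rewrite ?inE.
- exact: measurable_obox.
- exact: measurable_cbox.
- by move=> x h i; have /andP[h1 h2] := h i; rewrite !ltW.
Qed.

Lemma measurable_shift_rV (t : pt) : measurable_fun setT (fun x : pt => x + t).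
Proof.
apply: measurable_fun_coordP => i; under eq_fun do rewrite mxE.
by apply: measurable_funD => //; exact: measurable_coord.
Qed.

Let shifted (t : pt) : {measure set pt -> \bar R} :=
  measure_function_pushforward__canonical__measure_function_Measure mu
    (measurable_shift_rV t).

Lemma lebesgue_rV_shift (t : pt) A : measurable A ->
  pushforward mu (fun x : pt => x + t) A = mu A.
Proof.
move=> mA.
have E a b : pushforward mu (fun x : pt => x + t) (obox a b) = mu (obox a b).
  rewrite /pushforward.
  rewrite (_ : _ @^-1` _ = obox (fun i => a i - t 0 i) (fun i => b i - t 0 i)).
    rewrite !oboxE (@lebesgue_rV_box R d (fun i => `]a i, b i[%classic))//.
    rewrite (@lebesgue_rV_box R d (fun i => `](a i - t 0 i), (b i - t 0 i)[%classic))//.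
    apply: eq_bigr => i _; rewrite !lebesgue_measure_itv/= !lte_fin.
    by rewrite ltrD2r; case: ifP => // _; rewrite -!EFinB; congr EFin; lra.
  by apply/seteqP; split=> x h i; move: (h i); rewrite /= !mxE; set u := x 0 i; set v := t 0 i; lra.
apply: (@rV_measure_unique (shifted t) mu) => // a b.
by rewrite [X in (X < _)%E](E a b); exact: obox_finite.
Qed.

Lemma integral_shift_rV (f : pt -> \bar R) (t : pt) :
  mu.-integrable setT f ->
  (\int[mu]_x f ((x : pt) + t)%R = \int[mu]_x f x)%E.
Proof.
move=> fi; have mt := measurable_shift_rV t.
have mf : measurable_fun setT f by case/integrableP : fi.
have Eg (g : pt -> \bar R) : (\int[shifted t]_x g x = \int[mu]_x g x)%E.
  by apply: eq_measure_integral => A mA _; exact: lebesgue_rV_shift.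
have fti : mu.-integrable setT (fun x : pt => f (x + t)).
  apply/integrableP; split; first exact: measurableT_comp.
  have := @ge0_integral_pushforward _ _ _ _ _ _ mt mu setT (fun x => `|f x|%E).
  rewrite preimage_setT => /= <-//; last exact: measurableT_comp.
  by rewrite [X in (X < _)%E]Eg; case/integrableP : fi.
have := @integral_pushforward _ _ _ _ _ _ mt mu setT f mf.
by rewrite preimage_setT => /(_ fti measurableT) /= <-; exact: Eg.
Qed.

End box_uniqueness.

(** * Mean value theorem, Schwarz's theorem and vanishing integrals of derivatives *)

Section partials.
Context {R : realType} {d : nat}.
Local Notation pt := 'rV[R]_d.
Local Notation mu := (lebesgue_rV R d).
Local Notation e_ i := (delta_mx 0 i : pt).
Implicit Types (f g : pt -> R) (i j : 'I_d) (x : pt) (K : set pt).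

Definition csupported K f := compact K /\ forall x, ~ K x -> f x = 0.

Lemma is_derive_line f x i (s : R) : derivable f (x + s *: e_ i) (e_ i) ->
  is_derive s 1 (fun s : R => f (x + s *: e_ i)) (partial i f (x + s *: e_ i)).
Proof.
move=> df.
have E : (fun h : R => h^-1 *: ((f \o shift (x + s *: e_ i)) (h *: e_ i) -
    f (x + s *: e_ i))) =
  (fun h : R => h^-1 *: (((fun s : R => f (x + s *: e_ i)) \o shift s) (h *: 1) -
    f (x + s *: e_ i))).
  apply/funext => h /=; congr (_ *: (f _ - _)).
  by rewrite [h%:A]mulr1 scalerDl addrCA.
apply: DeriveDef; first by rewrite /derivable -E.
by rewrite /partial /derive -E.
Qed.

Lemma MVT_partial f x i (t : R) : 0 < t ->
  (forall y, derivable f y (e_ i)) ->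
  exists2 c, 0 < c < t & f (x + t *: e_ i) - f x =
    partial i f (x + c *: e_ i) * t.
Proof.
move=> t0 df.
have h s := is_derive_line (df (x + s *: e_ i)).
have [|c] := @MVT R (fun s => f (x + s *: e_ i))
  (fun s => partial i f (x + s *: e_ i)) 0 t t0.
  apply: derivable_within_continuous => s _; exact: (@ex_derive _ _ _ _ _ _ _ (h s)).
by rewrite in_itv/= scale0r addr0 subr0 => c0t E; exists c.
Qed.

Lemma compact_closed_rV K : compact K -> closed K.
Proof. by apply: compact_closed; exact: norm_hausdorff. Qed.

Lemma partial_local f g i x : (\near x, f x = g x) -> partial i f x = partial i g x.
Proof. exact: near_eq_derive. Qed.

Lemma near_out K x : compact K -> ~ K x -> \forall y \near x, ~ K y.
Proof.
move=> /compact_closed_rV cK nKx.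
by apply: (open_nbhs_nbhs (A := ~` K)); split => //; exact: closed_openC.
Qed.

Lemma csupported_partial K f i : csupported K f -> csupported K (partial i f).
Proof.
move=> [cK f0]; split => // x nKx.
rewrite (@partial_local _ (cst 0)); first by rewrite /partial derive_cst.
by apply: filterS (near_out cK nKx) => y; exact: f0.
Qed.

Lemma csupported_bounded K f : continuous f -> csupported K f ->
  exists2 M, 0 <= M & forall x, `|f x| <= M.
Proof.
move=> cf [cK f0].
have : compact (f @` K) by apply: continuous_compact => //; exact: continuous_subspaceT.
move=> /compact_bounded[M [_ MP]]; exists (`|M| + 1); first by rewrite addr_ge0.
move=> x; have [Kx|nKx] := pselect (K x); last by rewrite f0// normr0 addr_ge0.
apply: (MP (`|M| + 1)); last by exists x.
by rewrite (le_lt_trans (ler_norm _))// ltrDl.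
Qed.

Lemma csupported_integrable K f : continuous f -> csupported K f ->
  mu.-integrable setT (EFin \o f).
Proof.
move=> cf sf; have [M M0 fM] := csupported_bounded cf sf.
case: sf => cK f0; have mf := continuous_measurable_rV cf.
have mK := closed_measurable_rV (compact_closed_rV cK).
rewrite (_ : EFin \o f = (EFin \o f) \_ K); last first.
  apply/funext => x; rewrite patchE; case: ifPn => // /negP; rewrite inE => nK.
  by rewrite /= f0.
apply: (integrable_mkcond (EFin \o f) mK).1; apply: measurable_bounded_integrable => //.
- by apply: bounded_finite => //; exact: compact_bounded.
- exact: measurable_funTS.
- exists M; split; first exact: num_real.
  by move=> N MN x _; apply: le_trans (fM x) (ltW MN).
Qed.

(** The contradiction that closes Schwarz's theorem: a common value [P = P'] would be closer than
    half of the distance of [A] and [B] to both of them. *)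
Lemma half_dist_neq (A B P P' s : R) : 0 < s -> `|A - P'| < `|A - B| / 2 ->
  `|B - P| < `|A - B| / 2 -> P * (s * s) = P' * (s * s) -> False.
Proof.
move=> s0; have ss : s * s != 0 by rewrite mulf_neq0// gt_eqF.
move=> + h1 /(mulIf ss) e; rewrite -e; move: h1.
have : `|A - B| <= `|A - P| + `|B - P|.
  by rewrite (distrC B) (le_trans _ (ler_normD _ _))// addrA subrK.
by set u := `|A - P|; set v := `|B - P|; set w := `|A - B|; lra.
Qed.

(** The second difference of [f] over a square of side t is t^2 times a value of either mixed
    derivative inside the square, by two applications of the mean value theorem in either order.
    Continuity then forces the two derivatives to agree at the corner. *)
Lemma schwarz f i j x :
  (forall y, derivable f y (e_ i)) -> (forall y, derivable f y (e_ j)) ->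
  (forall y, derivable (partial i f) y (e_ j)) ->
  (forall y, derivable (partial j f) y (e_ i)) ->
  continuous (partial j (partial i f)) -> continuous (partial i (partial j f)) ->
  partial i (partial j f) x = partial j (partial i f) x.
Proof.
move=> di dj dij dji cij cji.
have key k l t : 0 < t -> (forall y, derivable f y (e_ k)) ->
    (forall y, derivable (partial k f) y (e_ l)) ->
    exists2 p, 0 < p.1 < t /\ 0 < p.2 < t &
    f (x + t *: e_ k + t *: e_ l) - f (x + t *: e_ l) - (f (x + t *: e_ k) - f x) =
    partial l (partial k f) (x + p.1 *: e_ k + p.2 *: e_ l) * (t * t).
  move=> t0 dk dkl.
  pose F y := f (y + t *: e_ l) - f y.
  have shiftE y : (fun h : R => h^-1 *:
      (((fun y => f (y + t *: e_ l)) \o shift y) (h *: e_ k) - f (y + t *: e_ l))) =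
      (fun h => h^-1 *: ((f \o shift (y + t *: e_ l)) (h *: e_ k) -
        f (y + t *: e_ l))).
    by apply/funext => h /=; rewrite addrA.
  have dkt y : derivable (fun y => f (y + t *: e_ l)) y (e_ k).
    by rewrite /derivable shiftE; exact: dk.
  have pkt y : partial k (fun y => f (y + t *: e_ l)) y = partial k f (y + t *: e_ l).
    by rewrite /partial /derive shiftE.
  have dF y : derivable F y (e_ k) by exact: (derivableB (dkt y) (dk y)).
  have [c ct] := MVT_partial x t0 dF.
  rewrite {1 2}/F => E.
  have EF : partial k F (x + c *: e_ k) =
      partial k f (x + c *: e_ k + t *: e_ l) - partial k f (x + c *: e_ k).
    by rewrite -pkt; exact: (deriveB (dkt _) (dk _)).
  have [c' ct'] := MVT_partial (x + c *: e_ k) t0 dkl.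
  rewrite -EF => EF'; exists (c, c') => //=.
  by rewrite mulrA -EF' -E; ring.
set A := partial i _ x; set B := partial j _ x.
apply: contrapT => /eqP; rewrite -subr_eq0 -normr_gt0 => AB0.
have AB2 : 0 < `|A - B| / 2 by rewrite divr_gt0.
have /cvgrPdist_lt/(_ _ AB2)/nbhs_ballP[r1 /= r1_gt0 h1] := cji x.
have /cvgrPdist_lt/(_ _ AB2)/nbhs_ballP[r2 /= r2_gt0 h2] := cij x.
(* Two displacements shorter than t along unit directions stay within half of the smaller radius. *)
pose t := Num.min r1 r2 / 4.
have t0 : 0 < t by rewrite divr_gt0// lt_min r1_gt0.
have inball k l (a b : R) : 0 < a < t -> 0 < b < t ->
    `|x - (x + a *: e_ k + b *: e_ l)| < Num.min r1 r2.
  move=> /andP[a0 a_t] /andP[b0 bt].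
  rewrite -addrA opprD addrA subrr add0r normrN (le_lt_trans (ler_normD _ _))//.
  have e1 k' : `|e_ k'| <= 1.
    rewrite [leLHS]mx_normrE; apply/bigmax_leP; split => // -[a' b'] _ /=.
    by rewrite mxE; case: (_ && _); rewrite ?normr1 ?normr0.
  rewrite !normrZ !gtr0_norm//.
  have := e1 k; have := e1 l; rewrite /t in a_t bt.
  have : 0 <= `|e_ k| by []. have : 0 <= `|e_ l| by [].
  set u := `|e_ k|; set v := `|e_ l|; set w := Num.min _ _ in a_t bt *.
  move=> u0 v0 u1 v1; have : a * u <= a by rewrite ler_piMr// ltW.
  have : b * v <= b by rewrite ler_piMr// ltW.
  have : 0 < w by rewrite lt_min r1_gt0.
  lra.
have [[a b] /= [at_ bt] E1] := key i j t t0 di dij.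
have [[a' b'] /= [at_' bt'] E2] := key j i t t0 dj dji.
have := h1 _ ; have := h2 _.
move=> /(_ (x + a *: e_ i + b *: e_ j)) k2 /(_ (x + a' *: e_ j + b' *: e_ i)) k1.
have {}k2 : `|B - partial j (partial i f) (x + a *: e_ i + b *: e_ j)| < `|A - B| / 2.
  by apply: k2; rewrite -ball_normE/=; have := inball i j _ _ at_ bt; rewrite lt_min => /andP[].
have {}k1 : `|A - partial i (partial j f) (x + a' *: e_ j + b' *: e_ i)| < `|A - B| / 2.
  by apply: k1; rewrite -ball_normE/=; have := inball j i _ _ at_' bt'; rewrite lt_min => /andP[].
have E : partial j (partial i f) (x + a *: e_ i + b *: e_ j) * (t * t) =
         partial i (partial j f) (x + a' *: e_ j + b' *: e_ i) * (t * t).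
  refine (etrans (esym E1) (etrans _ E2)).
  have -> : x + t *: e_ j + t *: e_ i = x + t *: e_ i + t *: e_ j by rewrite addrAC.
  set u1 := f _; set u2 := f _; set u3 := f _; set u4 := f _; ring.
exact: (half_dist_neq t0 k1 k2 E).
Qed.

Lemma cvg_inv_dnbhs (l : R) (g : R -> R) :
  g h @[h --> 0^'] --> l -> g (n.+1%:R^-1) @[n --> \oo] --> l.
Proof.
move=> /cvgr_dnbhsP; apply; split; first by move=> n; rewrite invr_eq0.
exact: cvg_harmonic.
Qed.

Lemma translate_continuous (c : pt) : continuous (fun y : pt => y + c).
Proof. by move=> x; exact: (cvgD cvg_id (cvg_cst c)). Qed.

(** Each difference quotient has integral 0 by translation invariance, and the quotients converge to
    the derivative under a common bound. This replaces an iterated integration in the direction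
    i. *)
Lemma integral_partial0 K f i : continuous f -> csupported K f ->
  (forall y, derivable f y (e_ i)) -> continuous (partial i f) ->
  \int[mu]_x partial i f x = 0.
Proof.
move=> cf sf df cdf; have fi := csupported_integrable cf sf.
have sdf := csupported_partial i sf.
have [M M0 dfM] := csupported_bounded cdf sdf.
have [cK f0] := sf.
have [L L0 KL] := bounded_sub_cbox (compact_bounded cK).
(* The quotient at [x] equals a derivative at a point at distance at most 1 from [x], so it vanishes
   off the box enlarged by 1. *)
pose B := cbox (fun=> - (L + 1)) (fun=> L + 1) : set pt.
pose F n (x : pt) := n.+1%:R * (f (x + n.+1%:R^-1 *: e_ i) - f x).
have fsi n : mu.-integrable setT (EFin \o (fun x : pt => f (x + n.+1%:R^-1 *: e_ i))).
  apply: (@csupported_integrable [set x | K (x + n.+1%:R^-1 *: e_ i)]).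
    by move=> x; apply: continuous_comp; [exact: translate_continuous|exact: cf].
  split; last by move=> x; exact: f0.
  rewrite (_ : [set _ | _] = (fun x => x - n.+1%:R^-1 *: e_ i) @` K).
    by apply: continuous_compact => //; apply: continuous_subspaceT; exact: translate_continuous.
  apply/seteqP; split => x /=.
    by move=> Kx; eexists; [exact: Kx|rewrite addrK].
  by move=> [y Ky <-]; rewrite subrK.
have iF n : (\int[mu]_x (F n x)%:E = 0)%E.
  rewrite /F; under eq_integral do rewrite EFinM EFinB.
  rewrite integralZl//; last first.
    by have := integrableB measurableT (fsi n) fi; apply.
  rewrite integralB//; last exact: fsi.
  have /= -> := integral_shift_rV (n.+1%:R^-1 *: e_ i) fi.
  by rewrite subee ?mule0//; exact: integrable_fin_num.
have FB n x : `|F n x| <= M * \1_B x.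
  have n0 : 0 < n.+1%:R^-1 :> R by rewrite invr_gt0.
  have [c /andP[c0 cn] E] := MVT_partial x n0 df.
  rewrite /F E mulrCA mulfV// mulr1 indicE; case: (boolP (x \in B)) => [|/negP]; rewrite ?inE => Bx.
    by rewrite mulr1.
  rewrite mulr0 sdf.2 ?normr0// => /KL h; apply: Bx => k.
  have := h k; rewrite !mxE eqxx/=.
  have c1 : c <= 1 by rewrite (le_trans (ltW cn))// invf_le1 ?ler1n.
  set u := x 0 k; case: (k == i) => /=; rewrite ?mulr1 ?mulr0; lra.
have mB : measurable B by exact: measurable_cbox.
have mF n : measurable_fun setT (fun x => (F n x)%:E).
  apply/measurable_EFinP; apply: measurable_funM => //.
  apply: measurable_funB; last exact: continuous_measurable_rV.
  by have /integrableP[/measurable_EFinP] := fsi n.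
have mdf : measurable_fun setT (EFin \o partial i f).
  by apply/measurable_EFinP; exact: continuous_measurable_rV.
have cvF : {ae mu, forall x, setT x ->
    (fun n => (F n x)%:E) @ \oo --> (EFin \o partial i f) x}.
  apply: aeW => x _ /=; apply: cvg_EFin; first by near=> n.
  have c0 : (fun h : R => h^-1 *: ((f \o shift x) (h *: e_ i) - f x)) h
      @[h --> 0^'] --> partial i f x := df x.
  rewrite (_ : fine \o _ = fun n => (fun h : R => h^-1 *: ((f \o shift x) (h *: e_ i) - f x)) n.+1%:R^-1).
    exact: cvg_inv_dnbhs c0.
  by apply/funext => n; rewrite /F /= invrK [_ *: _ + x]addrC.
have iB : mu.-integrable setT (fun x => (M * \1_B x)%:E).
  rewrite (_ : (fun x => _) = (EFin \o cst M) \_ B); last first.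
    apply/funext => x; rewrite patchE indicE; case: ifPn => _ /=.
      by rewrite mulr1.
    by rewrite mulr0.
  apply: (integrable_mkcond _ mB).1; apply: measurable_bounded_integrable => //.
    exact: cbox_finite.
  by exists `|M|; split; [exact: num_real|move=> N MN y _; exact: ltW].
have FB' : {ae mu, forall x n, setT x -> (`|(F n x)%:E| <= (M * \1_B x)%:E)%E}.
  by apply: aeW => x n _; rewrite lee_fin FB.
have [_ _] := dominated_convergence measurableT mF mdf cvF iB FB'.
rewrite (_ : [sequence _]_n = cst 0%E); last by apply/funext => n; exact: iF.
move=> /(cvg_unique _ (cvg_cst _)) => /(_ _)/esym E.
by rewrite /Rintegral E.
Unshelve. all: by end_near.
Qed.

End partials.

(** * Smooth bump functions *)

Section flat_functions.
Context {R : realType}.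

(** The function y^(-k) exp(-1/y) extended by 0. The powers of 1/y are carried along so that the
    derivative is a combination of members of the family; [k = 0] is the classical flat function. *)
Definition flat (k : nat) (y : R) : R :=
  if 0 < y then y^-1 ^+ k * expR (- y^-1) else 0.

Lemma flat_ge0 k y : 0 <= flat k y.
Proof.
rewrite /flat; case: ifPn => // y0.
by rewrite mulr_ge0 ?expR_ge0// exprn_ge0// invr_ge0 ltW.
Qed.

(** Exhibits [flat k.+1] as the slope function of [flat k] at 0, which is what Caratheodory's
    criterion asks for. *)
Lemma flatS k y : flat k y = flat k.+1 y * y.
Proof.
rewrite /flat; case: ifPn => y0; last by rewrite mul0r.
by rewrite exprSr -!mulrA (mulrC _ y) mulKf// gt_eqF.
Qed.

(** With t = 1/y, the bound exp t >= t^(k+1) / (k+1)! absorbs t^k and leaves one factor y.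
    Continuity at 0 follows by squeezing. *)
Lemma flat_le k y : flat k y <= k.+1`!%:R * `|y|.
Proof.
rewrite /flat; case: ifPn => y0; last by rewrite mulr_ge0.
rewrite (gtr0_norm y0) expRN ler_pdivrMr ?expR_gt0//.
have t0 : 0 <= y^-1 by rewrite invr_ge0 ltW.
have := expR_ge1Dxn k t0; rewrite addrC -lerBrDr => h.
have {h} : y^-1 ^+ k.+1 / k.+1`!%:R <= expR y^-1 by rewrite (le_trans h)// gerBl.
rewrite ler_pdivrMr ?ltr0n ?fact_gt0// exprSr ler_pdivrMr// => h.
by rewrite (le_trans h)// [leRHS]mulrAC [expR _ * _]mulrC.
Qed.

Lemma flat_continuous0 k : {for 0, continuous (flat k)}.
Proof.
rewrite /prop_for /continuous_at.
have -> : flat k 0 = 0 by rewrite /flat ltxx.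
apply: (@squeeze_cvgr _ _ _ _ (fun=> 0) (fun y => k.+1`!%:R * `|y|)).
- by near=> y; rewrite flat_ge0 flat_le.
- exact: cvg_cst.
- rewrite -[X in _ --> X](mulr0 (k.+1`!%:R : R)); apply: cvgMr.
  by rewrite -[X in _ --> X](@normr0 _ R); apply: cvg_norm; exact: cvg_id.
Unshelve. all: by end_near. Qed.

Lemma is_derive_flat k (y : R) :
  is_derive y 1 (flat k) (- (k%:R * flat k.+1 y) + flat k.+2 y).
Proof.
have [y0|y0|->] := ltgtP y 0.
- rewrite {2 3}/flat ltNge (ltW y0)/= mulr0 oppr0 addr0.
  apply: (@near_eq_is_derive _ _ _ (cst 0)).
  near=> z; rewrite /flat ltNge ltW//; near: z; exact: lt_nbhsl.
- rewrite {2 3}/flat y0.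
  apply: (@near_eq_is_derive _ _ _ (fun z : R => z^-1 ^+ k * expR (- z^-1))).
    by near=> z; rewrite /flat ifT//; near: z; exact: lt_nbhsr.
  have yn0 : y != 0 by rewrite gt_eqF.
  have dV : is_derive y 1 (fun z : R => z^-1) (- y^-1 ^+ 2).
    have := @is_deriveV R id y 1 1 yn0 (is_derive_id _ _).
    by rewrite /= scaler1 -exprVn.
  have dN : is_derive y 1 (fun z : R => - z^-1) (y^-1 ^+ 2).
    by have := @is_deriveN _ _ _ _ _ _ _ dV; rewrite opprK.
  have dE : is_derive y 1 (fun z : R => expR (- z^-1)) (expR (- y^-1) * y^-1 ^+ 2).
    exact: (@is_derive1_comp _ expR (fun z => - z^-1) y _ _ (is_derive_expR _) dN).
  have dX : is_derive y 1 (fun z : R => z^-1 ^+ k) (k%:R * (y^-1 ^+ k.-1) * - y^-1 ^+ 2).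
    rewrite (_ : (fun z : R => z^-1 ^+ k) = (fun z : R => z^-1) ^+ k).
      exact: (@is_deriveX _ _ (fun z : R => z^-1) k y 1 _ dV).
    by apply/funext => z; rewrite fctE.
  have := @is_deriveM _ _ _ _ _ _ _ _ dX dE.
  rewrite (_ : (fun z : R => z^-1 ^+ k) * _ =
    (fun z : R => z^-1 ^+ k * expR (- z^-1)))//.
  move=> /is_derive_eq; apply.
  rewrite /GRing.scale /= !exprS; case: k {dX} => [|k] /=; set u := y^-1.
    by rewrite !mul0r expr0 /= ; ring.
  rewrite !exprS; ring.
- rewrite {2 3}/flat ltxx mulr0 oppr0 addr0.
  apply/is_derive1_caratheodory; exists (flat k.+1); split.
  + by move=> z; rewrite {2}/flat ltxx !subr0 -flatS.
  + exact: flat_continuous0.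
  + by rewrite /flat ltxx.
Unshelve. all: by end_near. Qed.

End flat_functions.

Section bump_algebra.
Context {R : realType} {d : nat}.
Local Notation pt := 'rV[R]_d.
Local Notation e_ i := (delta_mx 0 i : pt).

(* A class of smooth functions which is visibly stable under partial
   derivatives and contains bump functions of boxes. *)
Inductive bump_alg : (pt -> R) -> Prop :=
| bump_flat k c m i : bump_alg (fun x => flat k (c * x 0 i + m))
| bump_cst c : bump_alg (fun=> c)
| bump_add f g : bump_alg f -> bump_alg g -> bump_alg (fun x => f x + g x)
| bump_mul f g : bump_alg f -> bump_alg g -> bump_alg (fun x => f x * g x).

Lemma is_derive_of_line (f : pt -> R) (x : pt) (i : 'I_d) (l : R) :
  is_derive (0 : R) 1 (fun s : R => f (x + s *: e_ i)) l -> is_derive x (e_ i) f l.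
Proof.
have E : (fun h : R => h^-1 *: ((f \o shift x) (h *: e_ i) - f x)) =
    (fun h : R => h^-1 *: (((fun s : R => f (x + s *: e_ i)) \o shift 0) (h *: 1) -
    (fun s : R => f (x + s *: e_ i)) 0)).
  apply/funext => h /=; rewrite scale0r !addr0; congr (_ *: (f _ - _)).
  by rewrite [h%:A]mulr1 addrC.
by move=> [h1 h2]; apply: DeriveDef; [rewrite /derivable E|rewrite /derive E].
Qed.

Lemma bump_alg_derive f i : bump_alg f ->
  exists2 g, bump_alg g & forall x, is_derive x (e_ i) f (g x).
Proof.
elim=> {f} [k c m j|c|f g _ [f' bf' df] _ [g' bg' dg]|f g bf [f' bf' df] bg [g' bg' dg]].
- pose del : R := c * (i == j)%:R.
  exists (fun x => del * (- k%:R * flat k.+1 (c * x 0 j + m) + flat k.+2 (c * x 0 j + m))).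
    apply: bump_mul; first exact: bump_cst.
    by apply: bump_add; [apply: bump_mul; [exact: bump_cst|]|]; exact: bump_flat.
  move=> x; apply: is_derive_of_line.
  rewrite (_ : (fun s : R => _) = flat k \o (fun s => s * del + (c * x 0 j + m))).
    set K := c * x 0 j + m.
    have di : is_derive (0 : R) 1 (fun s : R => s * del + K) del.
      rewrite (_ : (fun s : R => _) = (fun s : R => del *: s) + cst K); last first.
        by apply/funext => s; rewrite /= mulrC.
      apply: is_derive_eq; by rewrite addr0 scaler1.
    have := @is_derive1_comp _ (flat k) (fun s : R => s * del + K) 0 _ _ _ di.
    rewrite mul0r add0r mulrC mulNr; apply; exact: is_derive_flat.
  apply/funext => s /=; congr (flat k _); rewrite !mxE eqxx/= /del eq_sym; ring.
- exists (fun=> 0); first exact: bump_cst.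
  by move=> x; exact: is_derive_cst.
- exists (fun x => f' x + g' x); first exact: bump_add.
  by move=> x; exact: is_deriveD.
- exists (fun x => f x * g' x + g x * f' x).
    by apply: bump_add; exact: bump_mul.
  by move=> x; exact: is_deriveM.
Qed.

Lemma coord_rV_continuous (j : 'I_d) : continuous (fun y : pt => y 0 j : R).
Proof. exact: coord_continuous. Qed.

Lemma bump_alg_continuous f : bump_alg f -> continuous f.
Proof.
elim=> {f} [k c m j|c|f g _ cf _ cg|f g _ cf _ cg] x.
- apply: (@continuous_comp _ _ _ (fun x : pt => c * x 0 j + m) (flat k)).
    have h2 : {for x, continuous (fun y : pt => c * y 0 j)}.
      by apply: continuousM; [exact: cst_continuous|exact: coord_rV_continuous].
    by apply: continuousD; [exact: h2|exact: cst_continuous].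
  apply: differentiable_continuous; apply/derivable1_diffP.
  by have [] := is_derive_flat k (c * x 0 j + m).
- exact: cst_continuous.
- exact: (cvgD (cf x) (cg x)).
- exact: (cvgM (cf x) (cg x)).
Qed.

Lemma bump_alg_partial f i : bump_alg f -> bump_alg (partial i f).
Proof.
move=> bf; have [g bg dg] := bump_alg_derive i bf.
by rewrite (_ : partial i f = g)//; apply/funext => x; have [_] := dg x.
Qed.

Lemma bump_alg_smooth f : bump_alg f -> smooth_on setT f.
Proof.
move=> bf s x _.
have bs : bump_alg (foldr partial f s).
  by elim: s => //= i s IH; exact: bump_alg_partial.
split; first exact: bump_alg_continuous.
by move=> i; have [g _ dg] := bump_alg_derive i bs; have [] := dg x.
Qed.

(** As n grows, each factor exp(-1/((n+1)t)) increases to 1 for t > 0, so these bumps tend to the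
    indicator of the open box while vanishing outside it for every n. The arguments are written in
    the affine form of [bump_flat]. *)
Definition bump_seq (a b : 'I_d -> R) (n : nat) (x : pt) : R :=
  \prod_i (flat 0 (n.+1%:R * x 0 i + - (n.+1%:R * a i)) *
           flat 0 (- n.+1%:R * x 0 i + n.+1%:R * b i)).

Lemma bump_alg_bump_seq a b n : bump_alg (bump_seq a b n).
Proof.
rewrite /bump_seq unlock; elim: (index_enum _) => [|i s IH] /=.
  exact: bump_cst.
by apply: bump_mul => //; apply: bump_mul; exact: bump_flat.
Qed.

Lemma bump_seqE a b n x : bump_seq a b n x =
  \prod_i (flat 0 (n.+1%:R * (x 0 i - a i)) * flat 0 (n.+1%:R * (b i - x 0 i))).
Proof. by apply: eq_bigr => i _; congr (flat _ _ * flat _ _); ring. Qed.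

Lemma flat0_le1 (y : R) : flat 0 y <= 1.
Proof.
rewrite /flat; case: ifPn => // y0.
by rewrite expr0 mul1r -expR0 ler_expR oppr_le0 invr_ge0 ltW.
Qed.

Lemma bump_seq_ge0 a b n x : 0 <= bump_seq a b n x.
Proof. by apply: prodr_ge0 => i _; rewrite mulr_ge0 ?flat_ge0. Qed.

Lemma bump_seq_le1 a b n x : bump_seq a b n x <= 1.
Proof.
apply: prodr_ile1 => i _.
by rewrite mulr_ge0 ?flat_ge0//= mulr_ile1 ?flat_ge0 ?flat0_le1.
Qed.

Lemma flat_affineE n (t : R) : flat 0 (n.+1%:R * t) =
  if 0 < t then expR (- (t^-1 * n.+1%:R^-1)) else 0.
Proof.
rewrite /flat pmulr_rgt0//; case: ifPn => // _.
by rewrite expr0 mul1r invfM mulrC.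
Qed.

Lemma bump_seq_out a b n x : ~ obox a b x -> bump_seq a b n x = 0.
Proof.
move=> nx; have [i ni] : exists i, ~ (a i < x 0 i < b i) by exact/existsNP.
rewrite bump_seqE (bigD1 i)//= !flat_affineE.
move: ni; rewrite !subr_gt0; case: ifPn => ai; last by rewrite !mul0r.
by case: ifPn => bi; rewrite ?(mul0r, mulr0).
Qed.

Lemma flat_cvg (t : R) : 0 < t -> (fun n => flat 0 (n.+1%:R * t)) @ \oo --> (1 : R).
Proof.
move=> t0; rewrite (_ : (fun n => _) = fun n => expR (- (t^-1 * n.+1%:R^-1))); last first.
  by apply/funext => n; rewrite flat_affineE t0.
have h : (fun n : nat => - (t^-1 * n.+1%:R^-1) : R) @ \oo --> (0 : R).
  rewrite -[X in _ --> X]oppr0 -[X in _ --> - X](mulr0 t^-1).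
  by apply: cvgN; apply: cvgM; [exact: cvg_cst|exact: cvg_harmonic].
rewrite -[X in _ --> X](@expR0 R).
have := @continuous_expR R 0 => h2.
by have := cvg_comp _ _ h h2.
Qed.

Lemma bump_seq_cvg a b x :
  (fun n => bump_seq a b n x) @ \oo --> (\1_(obox a b) x : R).
Proof.
rewrite indicE; have [xab|nx] := pselect (obox a b x); last first.
  rewrite memNset//; under eq_fun do rewrite bump_seq_out//; exact: cvg_cst.
rewrite mem_set//=; under eq_fun do rewrite bump_seqE.
suff : (fun n => \prod_i (flat 0 (n.+1%:R * (x 0 i - a i)) *
    flat 0 (n.+1%:R * (b i - x 0 i)))) @ \oo --> \prod_(i < d) (1 : R).
  by rewrite big1_eq.
apply: (@cvg_big R _ _ _ xpredT (@mul_continuous R) nat \oo (index_enum 'I_d)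
  (fun i n => flat 0 (n.+1%:R * (x 0 i - a i)) * flat 0 (n.+1%:R * (b i - x 0 i)))
  (fun=> 1)) => i _.
have /andP[ai bi] := xab i.
rewrite -[X in _ --> X](mulr1 1); apply: cvgM.
  by apply: flat_cvg; rewrite subr_gt0.
by apply: flat_cvg; rewrite subr_gt0.
Qed.

Lemma test_fun_bump (D : set pt) a b n : cbox a b `<=` D ->
  test_fun D (bump_seq a b n).
Proof.
move=> abD; split; first exact/bump_alg_smooth/bump_alg_bump_seq.
exists (cbox a b); first by split => //; exact: compact_cbox.
move=> x nx; apply: bump_seq_out => h; apply: nx => i.
by have /andP[h1 h2] := h i; rewrite !ltW.
Qed.

End bump_algebra.

(** * Square integrable functions and the fundamental lemma *)

Section square_integrable.
Context {R : realType} {d : nat}.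
Local Notation pt := 'rV[R]_d.
Local Notation mu := (lebesgue_rV R d).
Variable D : set pt.
Hypothesis mD : measurable D.
Implicit Types f g u w c : pt -> R.

Lemma L2P f : L2 D f <->
  measurable_fun D f /\ mu.-integrable D (EFin \o (fun x => f x ^+ 2)).
Proof.
have E : (fun x => (f \_ D) x ^+ 2) = (fun x => f x ^+ 2) \_ D.
  by apply/funext => x; rewrite !patchE; case: ifPn => // _; rewrite expr0n.
rewrite /L2/=; split=> [h|[mf fi]].
  have := Lfun2_integrable_sqr h; move: h.
  rewrite inE => /andP[]; rewrite inE/= => mf _.
  rewrite E -restrict_EFin => /(integrable_mkcond _ mD).2 ?; split => //.
  exact/(measurable_restrictT _ _).2.
have mfD : measurable_fun setT (f \_ D) by exact/(measurable_restrictT _ _).1.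
rewrite inE; apply/andP; split; rewrite inE//=.
rewrite /finite_norm unlock poweR_lty//.
move: fi => /(integrable_mkcond _ mD).1; rewrite restrict_EFin -E.
move=> /integrableP[_]; congr (_ < _)%E; apply: eq_integral => x _ /=.
by rewrite powR_mulrn// normrX.
Qed.

Lemma L2_measurable f : L2 D f -> measurable_fun D f.
Proof. by move=> /L2P[]. Qed.

Lemma le_integrableR f g : measurable_fun D f -> (forall x, D x -> `|f x| <= g x) ->
  mu.-integrable D (EFin \o g) -> mu.-integrable D (EFin \o f).
Proof.
move=> mf fg; apply: le_integrable => //; first exact/measurable_EFinP.
by move=> x Dx /=; rewrite lee_fin (le_trans (fg x Dx))// ler_norm.
Qed.

Lemma integrableDR f g : mu.-integrable D (EFin \o f) ->
  mu.-integrable D (EFin \o g) -> mu.-integrable D (EFin \o (fun x => f x + g x)).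
Proof. by move=> fi gi; exact: (integrableD mD fi gi). Qed.

Lemma integrableZR (k : R) f : mu.-integrable D (EFin \o f) ->
  mu.-integrable D (EFin \o (fun x => k * f x)).
Proof. by move=> fi; exact: (integrableZl mD k fi). Qed.

Lemma L2M f g : L2 D f -> L2 D g -> mu.-integrable D (EFin \o (fun x => f x * g x)).
Proof.
move=> /L2P[mf fi] /L2P[mg gi].
apply: le_integrableR (integrableDR fi gi); first exact: measurable_funM.
move=> x _; rewrite normrM.
have := sqr_ge0 (`|f x| - `|g x|); rewrite -(real_normK (num_real (f x))).
rewrite -(real_normK (num_real (g x))).
have : 0 <= `|f x| by []. have : 0 <= `|g x| by [].
set a := `|f x|; set b := `|g x| => b0 a0 h.
have : 0 <= a * b by rewrite mulr_ge0.
nra.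
Qed.

Lemma L2D f g : L2 D f -> L2 D g -> L2 D (fun x => f x + g x).
Proof.
move=> /[dup] Lf /L2P[mf fi] /[dup] Lg /L2P[mg gi]; apply/L2P; split.
  exact: measurable_funD.
rewrite (_ : EFin \o _ =
  EFin \o (fun x => (f x ^+ 2 + 2 * (f x * g x)) + g x ^+ 2)); last first.
  by apply/funext => x /=; congr EFin; ring.
by apply: integrableDR => //; apply: integrableDR => //; apply: integrableZR; exact: L2M.
Qed.

Lemma L2Z (k : R) f : L2 D f -> L2 D (fun x => k * f x).
Proof.
move=> /L2P[mf fi]; apply/L2P; split; first exact: measurable_funM.
rewrite (_ : EFin \o _ = EFin \o (fun x => k ^+ 2 * f x ^+ 2)); last first.
  by apply/funext => x /=; rewrite exprMn.
exact: integrableZR.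
Qed.

Lemma L2N f : L2 D f -> L2 D (fun x => - f x).
Proof. by move=> /(L2Z (-1)); under eq_fun do rewrite mulN1r. Qed.

Lemma L2B f g : L2 D f -> L2 D g -> L2 D (fun x => f x - g x).
Proof. by move=> Lf /L2N; exact: L2D. Qed.

Lemma L20f : L2 D (fun=> 0).
Proof.
apply/L2P; split; first exact: measurable_cst.
rewrite (_ : EFin \o _ = cst 0%E); first exact: integrable0.
by apply/funext => x /=; rewrite expr0n.
Qed.

Lemma L2_sum (I : Type) (s : seq I) (F : I -> pt -> R) :
  (forall i, L2 D (F i)) -> L2 D (fun x => \sum_(i <- s) F i x).
Proof.
move=> LF; elim: s => [|i s IH].
  by under eq_fun do rewrite big_nil; exact: L20f.
by under eq_fun do rewrite big_cons; exact: L2D.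
Qed.

(** The bound on [c] is only almost everywhere because [c] will be built from the stabilization
    parameter, which is controlled on element interiors. *)
Lemma L2_mul_bounded c f (M : R) : measurable_fun D c ->
  {ae mu, forall x, D x -> `|c x| <= M} -> L2 D f -> L2 D (fun x => c x * f x).
Proof.
move=> mc cM /L2P[mf fi]; apply/L2P; split; first exact: measurable_funM.
have mcf : measurable_fun D (fun x => (c x * f x) ^+ 2).
  by apply: measurable_funX; exact: measurable_funM.
apply/integrableP; split; first exact/measurable_EFinP.
have := integrableZR (M ^+ 2) fi => /integrableP[h]; apply: le_lt_trans.
apply: ae_ge0_le_integral => //.
- by apply: measurableT_comp => //; exact/measurable_EFinP.
- exact: measurableT_comp.
apply: filterS cM => x h' Dx /=; rewrite lee_fin exprMn !normrM.
rewrite ler_wpM2r//; have := h' Dx => cx.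
by rewrite ler_pM// (le_trans cx)// ler_norm.
Qed.

Lemma iprC f g : ipr D f g = ipr D g f.
Proof. by apply: eq_Rintegral => x _; rewrite mulrC. Qed.

Lemma iprDl f g u : L2 D f -> L2 D g -> L2 D u ->
  ipr D (fun x => f x + g x) u = ipr D f u + ipr D g u.
Proof.
move=> Lf Lg Lu; rewrite /ipr -RintegralD//; try exact: L2M.
by apply: eq_Rintegral => x _; rewrite mulrDl.
Qed.

Lemma iprBl f g u : L2 D f -> L2 D g -> L2 D u ->
  ipr D (fun x => f x - g x) u = ipr D f u - ipr D g u.
Proof.
move=> Lf Lg Lu; rewrite /ipr -RintegralB//; try exact: L2M.
by apply: eq_Rintegral => x _; rewrite mulrBl.
Qed.

Lemma iprZl (k : R) f u : L2 D f -> L2 D u ->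
  ipr D (fun x => k * f x) u = k * ipr D f u.
Proof.
move=> Lf Lu; rewrite /ipr -RintegralZl//; try exact: L2M.
by apply: eq_Rintegral => x _; rewrite mulrA.
Qed.

Lemma ipr0l u : ipr D (fun=> 0) u = 0.
Proof.
rewrite /ipr (@eq_Rintegral _ _ _ mu D (cst 0)); last by move=> x _; rewrite mul0r.
by rewrite /Rintegral integral0.
Qed.

Lemma ipr_ge0 f : 0 <= ipr D f f.
Proof. by apply: Rintegral_ge0 => x _; rewrite -expr2 sqr_ge0. Qed.

Lemma eq_ae_Rintegral f g : measurable_fun D f -> measurable_fun D g ->
  f = g %[ae mu in D] -> \int[mu]_(x in D) f x = \int[mu]_(x in D) g x.
Proof.
move=> mf mg fg; rewrite /Rintegral; congr fine.
apply: ae_eq_integral => //; try exact/measurable_EFinP.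
by apply: filterS fg => x + Dx => /(_ Dx) ->.
Qed.

Lemma ipr_ae f g u w : L2 D f -> L2 D g -> L2 D u -> L2 D w ->
  f = g %[ae mu in D] -> u = w %[ae mu in D] -> ipr D f u = ipr D g w.
Proof.
move=> /L2_measurable mf /L2_measurable mg /L2_measurable mu' /L2_measurable mw fg uw.
apply: eq_ae_Rintegral; try exact: measurable_funM.
by apply: filterS2 fg uw => x + + Dx => /(_ Dx) -> /(_ Dx) ->.
Qed.

Lemma L2_ipr0 f : L2 D f -> ipr D f f = 0 -> f = (fun=> 0) %[ae mu in D].
Proof.
move=> Lf; rewrite /ipr /Rintegral => f0.
have fi := L2M Lf Lf.
have : (\int[mu]_(x in D) `|(f x * f x)%:E| = 0)%E.
  rewrite -[RHS]/(0%:E) -f0 fineK; last exact: integrable_fin_num.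
  by apply: eq_integral => x _; rewrite gee0_abs// lee_fin -expr2 sqr_ge0.
move/ae_eq_integral_abs => /=.
have mf : measurable_fun D (fun x => (f x * f x)%:E) by case/integrableP : fi.
move=> /(_ mD mf); apply: filterS => x + Dx => /(_ Dx) [] /eqP.
by rewrite mulf_eq0 orbb => /eqP.
Qed.

End square_integrable.

Section L2_subset.
Context {R : realType} {d : nat}.
Local Notation pt := 'rV[R]_d.
Local Notation mu := (lebesgue_rV R d).
Implicit Types f g : pt -> R.

Lemma L2S (D D' : set pt) f : measurable D -> measurable D' -> D' `<=` D ->
  L2 D f -> L2 D' f.
Proof.
move=> mD mD' DD /(L2P mD)[mf fi]; apply/(L2P mD'); split.
  exact: measurable_funS mf.
exact: integrableS fi.
Qed.

(** On a set of finite measure, |f| <= 1 + f^2 is an integrable bound. *)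
Lemma L2_integrable (D : set pt) f : measurable D -> (mu D < +oo)%E -> L2 D f ->
  mu.-integrable D (EFin \o f).
Proof.
move=> mD Doo /(L2P mD)[mf fi].
have i1 : mu.-integrable D (EFin \o cst 1).
  by apply: measurable_bounded_integrable => //; exists 1; split => // N N1 x _ /=;
    rewrite normr1 ltW.
apply: (le_integrableR mD mf _ (integrableDR mD i1 fi)) => x _ /=.
have := sqr_ge0 (`|f x| - 1); rewrite -(real_normK (num_real (f x))).
have : 0 <= `|f x| by []. set a := `|f x|; nra.
Qed.

Lemma csupported_L2 (D K : set pt) f : measurable D -> continuous f ->
  csupported K f -> L2 D f.
Proof.
move=> mD cf sf; apply: (@L2S setT) => //.
have cf2 : continuous (fun x => f x ^+ 2).
  by move=> x; have := continuousM (cf x) (cf x).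
apply/(L2P measurableT); split; first exact: continuous_measurable_rV.
apply: (@csupported_integrable _ _ K) => //.
by case: sf => cK f0; split => // x nKx; rewrite f0// expr0n.
Qed.

End L2_subset.

(** * Measures with density and the fundamental lemma *)

Section density.
Context {R : realType} {d : nat}.
Local Notation pt := 'rV[R]_d.
Local Notation mu := (lebesgue_rV R d).
Variable F : pt -> \bar R.
Hypotheses (mF : measurable_fun setT F) (F0 : forall x, (0 <= F x)%E).

(** Turning a nonnegative function into a measure lets the uniqueness theorem on boxes speak about
    functions. *)
Definition density_fun (A : set pt) : \bar R := (\int[mu]_(x in A) F x)%E.

Let density0 : density_fun set0 = 0%E.
Proof. by rewrite /density_fun integral_set0. Qed.

Let density_ge0 A : (0 <= density_fun A)%E.
Proof. exact: integral_ge0. Qed.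

Let density_sigma : semi_sigma_additive density_fun.
Proof. exact: semi_sigma_additive_nng_induced. Qed.

HB.instance Definition _ := isMeasure.Build _ _ _ density_fun
  density0 density_ge0 density_sigma.

Definition density : {measure set pt -> \bar R} := density_fun.

End density.

Section fundamental_lemma.
Context {R : realType} {d : nat}.
Local Notation pt := 'rV[R]_d.
Local Notation mu := (lebesgue_rV R d).
Implicit Types (g : pt -> R) (D : set pt).

(** Pass to the limit in the integrals of [g] against [bump_seq], which vanish by hypothesis; |g|
    dominates since the bumps lie between 0 and 1. *)
Lemma integral_obox0 D g a b : open D -> L2 D g -> cbox a b `<=` D ->
  (forall phi, test_fun D phi -> ipr D g phi = 0) ->
  (\int[mu]_(x in obox a b) (g x)%:E = 0)%E.
Proof.
move=> oD Lg abD g0; have mD := open_measurable_rV oD.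
have mo := measurable_obox a b.
have oc : obox a b `<=` cbox a b.
  by move=> x h i; have /andP[h1 h2] := h i; rewrite !ltW.
have oD' : obox a b `<=` D by move=> x /oc /abD.
have gi : mu.-integrable (obox a b) (EFin \o g).
  by apply: L2_integrable => //; [exact: obox_finite|exact: L2S Lg].
have mg : measurable_fun (obox a b) g by have /integrableP[/measurable_EFinP] := gi.
have mb n : measurable_fun setT (bump_seq a b n).
  by apply: continuous_measurable_rV; exact/bump_alg_continuous/bump_alg_bump_seq.
have z n : (\int[mu]_(x in obox a b) (g x * bump_seq a b n x)%:E = 0)%E.
  have tb := test_fun_bump n abD.
  have Lb : L2 D (bump_seq a b n).
    apply: (@csupported_L2 _ _ _ (cbox a b)) => //.
      exact/bump_alg_continuous/bump_alg_bump_seq.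
    split; first exact: compact_cbox.
    by move=> x nx; apply: bump_seq_out => /oc.
  have gbi := L2M mD Lg Lb.
  rewrite -[RHS]/(0%:E) -(g0 _ tb) /ipr /Rintegral fineK; last first.
    exact: integrable_fin_num.
  rewrite [RHS]integral_mkcond [LHS]integral_mkcond; apply: eq_integral => x _.
  rewrite !patchE; case: ifPn; case: ifPn => //.
    by rewrite notin_setE => nDx; rewrite inE => /oD'.
  by rewrite notin_setE => _ nx; rewrite bump_seq_out// mulr0.
have mgb n : measurable_fun (obox a b) (fun x => (g x * bump_seq a b n x)%:E).
  by apply/measurable_EFinP; apply: measurable_funM => //; exact: measurable_funTS.
have cvgb : {ae mu, forall x, obox a b x ->
    (fun n => (g x * bump_seq a b n x)%:E) @ \oo --> (EFin \o g) x}.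
  apply: aeW => x abx /=; apply: cvg_EFin; first by near=> n.
  have h := @bump_seq_cvg R d a b x; rewrite indicE mem_set//= in h.
  by rewrite -[X in _ --> X]mulr1; apply: cvgM; [exact: cvg_cst|exact: h].
have gbB : {ae mu, forall x n, obox a b x ->
    (`|(g x * bump_seq a b n x)%:E| <= (`|g x|)%:E)%E}.
  apply: aeW => x n _; rewrite lee_fin normrM ler_piMr//.
  by rewrite ger0_norm ?bump_seq_ge0// bump_seq_le1.
have gni : mu.-integrable (obox a b) (fun x => (`|g x|)%:E) by exact: integrable_norm.
have mgE : measurable_fun (obox a b) (EFin \o g) by exact/measurable_EFinP.
have [_ _] := dominated_convergence mo mgb mgE cvgb gni gbB.
rewrite (_ : [sequence _]_n = cst 0%E); last by apply/funext => n; exact: z.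
by move=> /(cvg_unique _ (cvg_cst _)) => /(_ _)/esym E; exact: E.
Unshelve. all: by end_near. Qed.

(** The positive and negative parts of [g], cut off to the box, are densities of two finite measures
    that agree on all boxes, hence everywhere. So [g] has integral 0 over every measurable part of
    the box. *)
Lemma ae_obox0 D g a b : open D -> L2 D g -> cbox a b `<=` D ->
  (forall phi, test_fun D phi -> ipr D g phi = 0) ->
  g = (fun=> 0) %[ae mu in obox a b].
Proof.
move=> oD Lg abD g0; have mD := open_measurable_rV oD.
pose B : set pt := obox a b; have mB : measurable B := measurable_obox a b.
have oc : obox a b `<=` cbox a b.
  by move=> x h i; have /andP[h1 h2] := h i; rewrite !ltW.
have BD : B `<=` D by move=> x /oc /abD.
have gi : mu.-integrable B (EFin \o g).
  by apply: L2_integrable => //; [exact: obox_finite|exact: L2S Lg].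
pose G := (EFin \o g) \_ B.
have Gi : mu.-integrable setT G by exact: (integrable_mkcond _ mB).1.
have mG : measurable_fun setT G by case/integrableP : Gi.
have mp := measurable_funepos mG; have mn := measurable_funeneg mG.
pose m1 := density mp (funepos_ge0 G).
pose m2 := density mn (funeneg_ge0 G).
have m1E A : measurable A -> m1 A = (\int[mu]_(x in A) G^\+ x)%E by [].
have m2E A : measurable A -> m2 A = (\int[mu]_(x in A) G^\- x)%E by [].
have GiA A : measurable A -> mu.-integrable A G.
  by move=> mA; exact: integrableS Gi.
have m12E A : measurable A -> (\int[mu]_(x in A) G x = m1 A - m2 A)%E.
  by move=> mA; rewrite m1E// m2E// integralE.
have m1foo A : measurable A -> m1 A \is a fin_num.
  by move=> mA; rewrite m1E// integrable_fin_num//; exact/integrable_funepos/GiA.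
have m2foo A : measurable A -> m2 A \is a fin_num.
  by move=> mA; rewrite m2E// integrable_fin_num//; exact/integrable_funeneg/GiA.
have h A : measurable A -> m1 A = m2 A.
  apply: rV_measure_unique => a' b'; last first.
    by rewrite ltey_eq m1foo//; exact: measurable_obox.
  have mab := measurable_obox a' b'.
  suff e : (m1 (obox a' b') - m2 (obox a' b') = 0)%E.
    by rewrite -[LHS](subeK _ (m2foo _ mab)) e add0e.
  rewrite -(m12E _ mab) /G -integral_mkcondr.
  (* The integral of the truncated [g] over a second box is the integral of [g] over the
     intersection, which is again a box with closure inside [D]. *)
  rewrite oboxI; apply: (integral_obox0 oD Lg _ g0).
  move=> x hx; apply: abD => i; have := hx i.
  by rewrite ge_max le_min => /andP[/andP[_ ->] /andP[_ ->]].
suff hE : ae_eq mu B (EFin \o g) (cst 0%E).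
  by apply: filterS hE => x + Bx => /(_ Bx) [].
apply: integral_ae_eq => // E EB mE.
rewrite integral0; transitivity (\int[mu]_(x in E) G x)%E.
  apply: eq_integral => x; rewrite inE => Ex.
  by rewrite /G patchE mem_set//; exact: EB.
by rewrite (m12E _ mE) (h _ mE) subee//; exact: m2foo.
Qed.

Lemma fundamental_lemma D g : (0 < d)%N -> open D -> L2 D g ->
  (forall phi, test_fun D phi -> ipr D g phi = 0) ->
  g = (fun=> 0) %[ae mu in D].
Proof.
move=> d0 oD Lg g0; have [a [b [DE abD]]] := open_bigcup_obox d0 oD.
have H : mu.-negligible (\bigcup_k ~` [set x | obox (a k) (b k) x -> g x = 0]).
  by apply: negligible_bigcup => k; exact: (ae_obox0 oD Lg (abD k) g0).
apply: negligibleS H => x /= /not_implyP[Dx gx].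
rewrite DE in Dx; case: Dx => k _ xk; exists k => //= h; exact/gx/h.
Qed.

End fundamental_lemma.

(** * Weak derivatives and Sobolev spaces *)

Section test_functions.
Context {R : realType} {d : nat}.
Local Notation pt := 'rV[R]_d.
Local Notation mu := (lebesgue_rV R d).
Local Notation e_ i := (delta_mx 0 i : pt).
Implicit Types (phi chi u : pt -> R) (D : set pt) (i j : 'I_d) (a : 'I_d -> nat).

Lemma test_funS D D' phi : D `<=` D' -> test_fun D phi -> test_fun D' phi.
Proof.
move=> DD' [s [K [cK KD] h]]; split => //; exists K => //; split => //.
exact: subset_trans DD'.
Qed.

Lemma test_fun_csupported D phi : test_fun D phi -> exists2 K, K `<=` D & csupported K phi.
Proof. by move=> [s [K [cK KD] h]]; exists K. Qed.

Lemma test_fun_continuous D phi : test_fun D phi -> continuous phi.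
Proof. by move=> [s _] x; have [] := s [::] x I. Qed.

Lemma test_fun_derivable D phi i x : test_fun D phi -> derivable phi x (e_ i).
Proof. by move=> [s _]; have [_] := s [::] x I; exact. Qed.

Lemma test_fun_partial D phi i : test_fun D phi -> test_fun D (partial i phi).
Proof.
move=> tphi; have [K KD sK] := test_fun_csupported tphi.
split; last first.
  have [cK p0] := csupported_partial i sK.
  by exists K.
move=> s x _; have [/(_ (rcons s i) x I)] := tphi.
by rewrite foldr_rcons.
Qed.

Lemma test_fun_mpartial D phi a : test_fun D phi -> test_fun D (mpartial a phi).
Proof.
move=> tphi; rewrite /mpartial; elim: (enum _) => //= i s IH.
by elim: (a i) => //= n IHn; exact: test_fun_partial.
Qed.

Lemma test_fun_L2 D D' phi : measurable D' -> test_fun D phi -> L2 D' phi.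
Proof.
move=> mD' tphi; have [K _ sK] := test_fun_csupported tphi.
by apply: csupported_L2 sK => //; exact: test_fun_continuous tphi.
Qed.

Lemma test_fun_out D phi x : test_fun D phi -> ~ D x -> phi x = 0.
Proof. by move=> /test_fun_csupported[K KD [_ h]] nD; apply: h => /KD. Qed.

Lemma test_fun_schwarz D phi i j : test_fun D phi ->
  partial i (partial j phi) = partial j (partial i phi).
Proof.
move=> t; apply/funext => x; apply: schwarz.
- by move=> y; exact: test_fun_derivable t.
- by move=> y; exact: test_fun_derivable t.
- by move=> y; apply: test_fun_derivable (test_fun_partial i t).
- by move=> y; apply: test_fun_derivable (test_fun_partial j t).
- exact: test_fun_continuous (test_fun_partial j (test_fun_partial i t)).
- exact: test_fun_continuous (test_fun_partial i (test_fun_partial j t)).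
Qed.

Lemma mpartial0 phi : mpartial (fun=> 0%N) phi = phi.
Proof. by rewrite /mpartial; elim: (enum _). Qed.

(** [mpartial] differentiates in the fixed order of the coordinates, so an extra derivative in
    direction [j] must be moved outwards past the other ones; Schwarz's theorem allows it. *)
Lemma mpartialS D phi a j : test_fun D phi ->
  mpartial (fun l => (l == j) + a l)%N phi = partial j (mpartial a phi).
Proof.
move=> t; rewrite /mpartial.
pose P s := foldr (fun i => iter (a i) (partial i)) phi s.
suff H s : uniq s -> foldr (fun i => iter ((i == j) + a i) (partial i)) phi s =
    if j \in s then partial j (P s) else P s.
  by rewrite H ?enum_uniq// mem_enum.
have tP s' : test_fun D (P s').
  rewrite /P; elim: s' => //= i s' IH.
  by elim: (a i) => //= n IHn; exact: test_fun_partial.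
elim: s => //= i s IH /andP[nis us]; rewrite (IH us) inE [j == i]eq_sym.
case: eqVneq => [ij|_] /=; first by rewrite -ij (negbTE nis).
case: (j \in s) => //=.
elim: (a i) => //= n ->; rewrite (@test_fun_schwarz D)//.
by elim: n => //= n IHn; exact: test_fun_partial.
Qed.

Lemma mpartial1 D phi i : test_fun D phi -> mpartial (midx1 i) phi = partial i phi.
Proof.
move=> t; rewrite -[in RHS](mpartial0 phi) -(mpartialS _ _ t).
by congr mpartial; apply/funext => l; rewrite addn0.
Qed.

Lemma mlen0 : mlen (fun _ : 'I_d => 0%N) = 0%N.
Proof. by rewrite /mlen big1. Qed.

Lemma mlen1 i : mlen (midx1 i) = 1%N.
Proof. by rewrite /mlen /midx1 (bigD1 i)//= eqxx big1// => j /negbTE ->. Qed.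

Definition midx2 i j : 'I_d -> nat := fun l => ((l == i) + (l == j))%N.

Lemma mlen2 i j : mlen (midx2 i j) = 2%N.
Proof. by rewrite /mlen /midx2 big_split/= -/(mlen (midx1 i)) -/(mlen (midx1 j)) !mlen1. Qed.

Lemma mpartial2 D phi i j : test_fun D phi ->
  mpartial (midx2 i j) phi = partial i (partial j phi).
Proof. by move=> t; rewrite /midx2 (mpartialS _ _ t) -(mpartial1 _ t). Qed.

Lemma ipr_test_sub D D' u phi : D' `<=` D -> test_fun D' phi -> ipr D u phi = ipr D' u phi.
Proof.
move=> DD' t; rewrite /ipr Rintegral_mkcond [RHS]Rintegral_mkcond.
apply: eq_Rintegral => x _; rewrite !patchE.
case: ifPn; case: ifPn => //; last by rewrite inE notin_setE => /DD'.
by rewrite notin_setE => nx _; rewrite (test_fun_out t nx) mulr0.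
Qed.

Lemma integral_test_partial D phi i : test_fun D phi ->
  \int[mu]_(x in D) partial i phi x = 0.
Proof.
move=> t; have [K KD sK] := test_fun_csupported t.
rewrite Rintegral_mkcond.
rewrite -[RHS](@integral_partial0 R d K phi i) => //; last first.
- exact: test_fun_continuous (test_fun_partial i t).
- by move=> y; exact: test_fun_derivable t.
- exact: test_fun_continuous t.
apply: eq_Rintegral => x _; rewrite patchE; case: ifPn => //.
by rewrite notin_setE => nx; rewrite (test_fun_out (test_fun_partial i t) nx).
Qed.

(** The derivative of the product [phi * chi] has integral 0. *)
Lemma ipr_partial D phi chi i : measurable D -> test_fun D phi -> test_fun D chi ->
  ipr D phi (partial i chi) = - ipr D (partial i phi) chi.
Proof.
move=> mD tp tc; have [K KD [cK sK]] := test_fun_csupported tp.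
have dM y : is_derive y (e_ i) (fun x => phi x * chi x)
    (phi y * partial i chi y + chi y * partial i phi y).
  have dp : derivable phi y (e_ i) by exact: test_fun_derivable tp.
  have dc : derivable chi y (e_ i) by exact: test_fun_derivable tc.
  by have := is_deriveM (derivableP dp) (derivableP dc).
have pM : partial i (fun x => phi x * chi x) =
    (fun x => phi x * partial i chi x + chi x * partial i phi x).
  by apply/funext => y; have [_] := dM y.
have cphi := test_fun_continuous tp; have cchi := test_fun_continuous tc.
have cdphi := test_fun_continuous (test_fun_partial i tp).
have cdchi := test_fun_continuous (test_fun_partial i tc).
have : \int[mu]_x partial i (fun x => phi x * chi x) x = 0.
  apply: (@integral_partial0 R d K).
  - by move=> x; exact: continuousM (cphi x) (cchi x).
  - by split => // x nKx; rewrite sK// mul0r.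
  - by move=> y; have [] := dM y.
  - rewrite pM => x.
    exact: continuousD (continuousM (cphi x) (cdchi x)) (continuousM (cchi x) (cdphi x)).
have L := fun t => test_fun_L2 mD t.
have [Lp Lc] := (L _ _ tp, L _ _ tc).
have [Ldp Ldc] := (L _ _ (test_fun_partial i tp), L _ _ (test_fun_partial i tc)).
rewrite (_ : \int[mu]_x _ = ipr D phi (partial i chi) + ipr D (partial i phi) chi).
  by move/eqP; rewrite addr_eq0 => /eqP.
rewrite /ipr -RintegralD//; [|exact: L2M|exact: L2M].
rewrite [RHS]Rintegral_mkcond; apply: eq_Rintegral => x _.
rewrite pM patchE; case: ifPn => [_|]; first by rewrite [chi x * _]mulrC.
rewrite notin_setE => nx; rewrite (test_fun_out tp nx) (test_fun_out tc nx).
by rewrite !mul0r addr0.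
Qed.

End test_functions.

Section weak_derivatives.
Context {R : realType} {d : nat}.
Local Notation pt := 'rV[R]_d.
Local Notation mu := (lebesgue_rV R d).
Implicit Types (u w phi : pt -> R) (D : set pt) (i j : 'I_d) (a : 'I_d -> nat).

Lemma is_wderiv_unique D a u w w' : (0 < d)%N -> open D ->
  is_wderiv D a u w -> is_wderiv D a u w' -> w = w' %[ae mu in D].
Proof.
move=> d0 oD [Lw hw] [Lw' hw']; have mD := open_measurable_rV oD.
have : (fun x => w x - w' x) = (fun=> 0) %[ae mu in D].
  apply: fundamental_lemma => //; first exact: L2B.
  move=> phi t; rewrite iprBl//; last exact: test_fun_L2 t.
  have := hw _ t; rewrite hw'// => /mulfI -> //; first by rewrite subrr.
  by rewrite expf_eq0 oppr_eq0 oner_eq0 andbF.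
by apply: filterS => x + Dx => /(_ Dx) /eqP; rewrite subr_eq0 => /eqP.
Qed.

Lemma wderivP D a u w : is_wderiv D a u w -> is_wderiv D a u (wderiv D a u).
Proof. by move=> h; rewrite /wderiv; case: xgetP => // /(_ w). Qed.

Lemma wderiv_ae D a u w : (0 < d)%N -> open D ->
  is_wderiv D a u w -> wderiv D a u = w %[ae mu in D].
Proof. by move=> d0 oD h; apply: is_wderiv_unique (wderivP h) h. Qed.

Lemma is_wderivB D a u u' w w' : open D -> L2 D u -> L2 D u' ->
  is_wderiv D a u w -> is_wderiv D a u' w' ->
  is_wderiv D a (u - u') (fun x => w x - w' x).
Proof.
move=> oD Lu Lu' [Lw hw] [Lw' hw']; have mD := open_measurable_rV oD.
split; first exact: L2B.
move=> phi t; rewrite iprBl//; last exact: test_fun_L2 t.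
rewrite mulrBr -hw// -hw'// -iprBl//.
exact: test_fun_L2 (test_fun_mpartial a t).
Qed.

Lemma is_wderivD D a u u' w w' : open D -> L2 D u -> L2 D u' ->
  is_wderiv D a u w -> is_wderiv D a u' w' ->
  is_wderiv D a (fun x => u x + u' x) (fun x => w x + w' x).
Proof.
move=> oD Lu Lu' [Lw hw] [Lw' hw']; have mD := open_measurable_rV oD.
split; first exact: L2D.
move=> phi t; rewrite [in RHS]iprDl//; last exact: test_fun_L2 t.
rewrite mulrDr -hw// -hw'// -iprDl//.
exact: test_fun_L2 (test_fun_mpartial a t).
Qed.

Lemma is_wderivZ D a (k : R) u w : open D -> L2 D u -> is_wderiv D a u w ->
  is_wderiv D a (fun x => k * u x) (fun x => k * w x).
Proof.
move=> oD Lu [Lw hw]; have mD := open_measurable_rV oD.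
split; first exact: L2Z.
move=> phi t; rewrite iprZl//; last exact: test_fun_L2 (test_fun_mpartial a t).
by rewrite hw// iprZl//; [rewrite mulrCA|exact: test_fun_L2 t].
Qed.

Lemma is_wderivS D D' a u w : open D -> open D' -> D' `<=` D ->
  is_wderiv D a u w -> is_wderiv D' a u w.
Proof.
move=> oD oD' DD' [Lw hw]; split.
  by apply: L2S Lw => //; exact: open_measurable_rV.
move=> phi t; rewrite -(ipr_test_sub _ DD' t).
rewrite -(ipr_test_sub _ DD' (test_fun_mpartial a t)).
by apply: hw; exact: test_funS t.
Qed.

(** Testing the first-order derivative with [partial j phi] produces the second-order test identity;
    the two sign changes cancel. *)
Lemma is_wderiv2 D i j u w w' : is_wderiv D (midx1 i) u w ->
  is_wderiv D (midx2 i j) u w' -> is_wderiv D (midx1 j) w w'.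
Proof.
move=> [Lw hw] [Lw' hw']; split => // phi t.
rewrite (mpartial1 _ t) mlen1 expr1 mulN1r.
have := hw _ (test_fun_partial j t).
rewrite mlen1 expr1 mulN1r (mpartial1 _ (test_fun_partial j t)) => h.
have := hw' _ t; rewrite mlen2 sqrrN expr1n mul1r (mpartial2 _ _ t) => <-.
by rewrite h opprK.
Qed.

Lemma is_wderiv_test D phi i : measurable D -> test_fun D phi ->
  is_wderiv D (midx1 i) phi (partial i phi).
Proof.
move=> mD t; split; first exact: test_fun_L2 (test_fun_partial i t).
by move=> chi tc; rewrite (mpartial1 _ tc) mlen1 expr1 mulN1r ipr_partial.
Qed.

Lemma is_wderiv_cst D (c : R) i : measurable D -> is_wderiv D (midx1 i) (fun=> c) (fun=> 0).
Proof.
move=> mD; split; first exact: L20f.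
move=> chi tc; rewrite (mpartial1 _ tc) ipr0l mulr0 /ipr.
rewrite RintegralZl//; first by rewrite (integral_test_partial i tc) mulr0.
have [K _ sK] := test_fun_csupported (test_fun_partial i tc).
apply: (@integrableS _ _ _ _ setT) => //.
by apply: csupported_integrable sK; exact: test_fun_continuous (test_fun_partial i tc).
Qed.

Lemma is_wderiv0 D u : L2 D u -> is_wderiv D (fun=> 0%N) u u.
Proof. by move=> Lu; split => // phi t; rewrite mpartial0 mlen0 expr0 mul1r. Qed.

End weak_derivatives.

(** * Sobolev spaces and integration by parts in the closure of test functions *)

Section sobolev.
Context {R : realType} {d : nat}.
Local Notation pt := 'rV[R]_d.
Local Notation mu := (lebesgue_rV R d).
Hypothesis d0 : (0 < d)%N.
Variable D : set pt.
Hypothesis oD : open D.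
Let mD : measurable D := open_measurable_rV oD.
Implicit Types (f g u v w phi : pt -> R) (i j : 'I_d) (a : 'I_d -> nat).

Lemma Hk_L2 k u : Hk k D u -> L2 D u. Proof. by case. Qed.

Lemma Hk_le k l u : (l <= k)%N -> Hk k D u -> Hk l D u.
Proof. by move=> lk [Lu h]; split => // a al; apply: h; exact: leq_trans lk. Qed.

Lemma Hk_wderiv k a u : Hk k D u -> (mlen a <= k)%N -> is_wderiv D a u (wderiv D a u).
Proof. by move=> [_ h] /h[w]; exact: wderivP. Qed.

Lemma Hk1_wpartial u i : Hk 1 D u -> is_wderiv D (midx1 i) u (wpartial D i u).
Proof. by move=> /Hk_wderiv; apply; rewrite mlen1. Qed.

Lemma L2_wpartial u i : Hk 1 D u -> L2 D (wpartial D i u).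
Proof. by move=> /(Hk1_wpartial i)[]. Qed.

Lemma wpartialB u u' i : Hk 1 D u -> Hk 1 D u' ->
  wpartial D i (u - u') = (fun x => wpartial D i u x - wpartial D i u' x) %[ae mu in D].
Proof.
move=> hu hu'; apply: wderiv_ae => //; apply: is_wderivB => //.
- exact: Hk_L2 hu.
- exact: Hk_L2 hu'.
- exact: Hk1_wpartial.
- exact: Hk1_wpartial.
Qed.

Lemma Hk_wpartial u i j : Hk 2 D u ->
  is_wderiv D (midx1 j) (wpartial D i u) (wderiv D (midx2 i j) u).
Proof.
move=> hu; apply: (@is_wderiv2 _ _ D i j u).
  by apply: Hk1_wpartial; exact: Hk_le hu.
by apply: Hk_wderiv hu _; rewrite mlen2.
Qed.

Lemma hsemi2_ge0 k u : 0 <= hsemi2 k D u.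
Proof. by apply: sumr_ge0 => a _; exact: ipr_ge0. Qed.

(** A multi-index of length [k] has all entries at most [k], so it occurs among the summands of the
    semi-norm. *)
Lemma hsemi2_ge k a u : mlen a = k ->
  ipr D (wderiv D a u) (wderiv D a u) <= hsemi2 k D u.
Proof.
move=> ak; have ai i : (a i <= k)%N.
  by rewrite -ak /mlen (bigD1 i)//= leq_addr.
pose b : {ffun 'I_d -> 'I_k.+1} := [ffun i => inord (a i)].
have bE : (fun i => b i : nat) = a.
  by apply/funext => i; rewrite ffunE inordK// ltnS.
rewrite /hsemi2 (bigD1 b)/=; last by rewrite bE ak.
by rewrite bE lerDl; apply: sumr_ge0 => c _; exact: ipr_ge0.
Qed.

(** The semi-norm of order 0 is built from the chosen weak derivative of order 0, which is only
    almost everywhere equal to [u]. *)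
Lemma hsemi20_ge u : L2 D u -> ipr D u u <= hsemi2 0 D u.
Proof.
move=> Lu; apply: le_trans (hsemi2_ge u (mlen0 (d := d))).
have w0 := wderivP (is_wderiv0 Lu); have Lw : L2 D (wderiv D (fun=> 0%N) u) by case: w0.
rewrite (@ipr_ae _ _ D mD (wderiv D (fun=> 0%N) u) u (wderiv D (fun=> 0%N) u) u)//;
  by apply: wderiv_ae => //; exact: is_wderiv0.
Qed.

Lemma hsemi21_ge u i : ipr D (wpartial D i u) (wpartial D i u) <= hsemi2 1 D u.
Proof. by apply: hsemi2_ge; exact: mlen1. Qed.

Lemma ipr_CauchySchwarz f g : L2 D f -> L2 D g ->
  (ipr D f g) ^+ 2 <= ipr D f f * ipr D g g.
Proof.
move=> Lf Lg; set A := ipr D f f; set B := ipr D f g; set C := ipr D g g.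
have H t : 0 <= A + 2 * t * B + t ^+ 2 * C.
  have Lt := L2Z mD t Lg.
  have := ipr_ge0 D (fun x => f x + t * g x).
  rewrite iprDl//; last exact: L2D.
  rewrite [ipr D f _]iprC iprDl// [ipr D (fun x => t * g x) (fun x => f x + _)]iprC.
  rewrite [ipr D _ (fun x => t * g x)]iprDl// iprZl//.
  rewrite [ipr D f (fun x => t * g x)]iprC !iprZl//.
  rewrite [ipr D g (fun x => t * g x)]iprC !iprZl// [ipr D g f]iprC.
  by congr (0 <= _); rewrite -/A -/B -/C; ring.
have C0 : 0 <= C by exact: ipr_ge0.
have [C00|Cn0] := eqVneq C 0.
  rewrite C00 mulr0; have [->|Bn0] := eqVneq B 0; first by rewrite expr0n.
  (* When [C] is 0 the quadratic is affine in t, and this choice of t gives it the value -1. *)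
  have := H (- (A + 1) / (2 * B)); rewrite C00 mulr0 addr0.
  rewrite (_ : 2 * _ * B = - (A + 1)); last by field.
  lra.
have Cp : 0 < C by rewrite lt_neqAle eq_sym Cn0.
have := H (- B / C); rewrite (_ : _ + _ = A - B ^+ 2 / C); last by field.
by rewrite subr_ge0 ler_pdivrMr.
Qed.

(** Carries out the density arguments without sequences: an identity for [H10] functions follows
    when its defect is bounded in this way for every approximation accuracy. *)
Lemma eq0_of_small (X M : R) : (forall eps, 0 < eps -> X ^+ 2 <= eps * M) -> X = 0.
Proof.
move=> h; apply/eqP; rewrite -sqrf_eq0 eq_le sqr_ge0 andbT leNgt; apply/negP => X0.
have M0 : 0 < M by have := h 1 ltr01; rewrite mul1r; apply: lt_le_trans.
have M20 : 0 < 2 * M by rewrite mulr_gt0.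
have := h _ (divr_gt0 X0 M20).
rewrite (_ : X ^+ 2 / (2 * M) * M = X ^+ 2 / 2); last by field; rewrite gt_eqF.
lra.
Qed.

Lemma H10_approx u eps : H10 D u -> 0 < eps -> exists2 phi, test_fun D phi &
  ipr D (fun x => u x - phi x) (fun x => u x - phi x) <= eps /\
  forall i, ipr D (fun x => wpartial D i u x - partial i phi x)
     (fun x => wpartial D i u x - partial i phi x) <= eps.
Proof.
move=> [hu h] e0; have [phi t H] := h _ e0; exists phi => //.
have Lu := Hk_L2 hu; have Lphi : L2 D phi by exact: test_fun_L2 t.
have Luphi : L2 D (u - phi) by exact: L2B.
have k0 := hsemi2_ge0 0 (u - phi); have k1 := hsemi2_ge0 1 (u - phi).
split; first by have := hsemi20_ge Luphi; move: H k0 k1; lra.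
move=> i; have := hsemi21_ge (u - phi) i.
have w1 := is_wderivB oD Lu Lphi (Hk1_wpartial i hu) (is_wderiv_test i mD t).
have Lw1 : L2 D (fun x => wpartial D i u x - partial i phi x) by case: w1.
have Lw2 : L2 D (wpartial D i (u - phi)) by case: (wderivP w1).
have ww := wderiv_ae d0 oD w1.
have -> := @ipr_ae _ _ D mD (wpartial D i (u - phi)) _ _ _ Lw2 Lw1 Lw2 Lw1 ww ww.
by move: H k0 k1; lra.
Qed.

Lemma ipr2_small f1 f2 g1 g2 eps : L2 D f1 -> L2 D f2 -> L2 D g1 -> L2 D g2 ->
  ipr D f1 f1 <= eps -> ipr D f2 f2 <= eps ->
  (ipr D f1 g1 + ipr D f2 g2) ^+ 2 <= eps * (2 * (ipr D g1 g1 + ipr D g2 g2)).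
Proof.
move=> Lf1 Lf2 Lg1 Lg2 e1 e2.
have := ipr_CauchySchwarz Lf1 Lg1; have := ipr_CauchySchwarz Lf2 Lg2.
have : ipr D f1 f1 * ipr D g1 g1 <= eps * ipr D g1 g1 by rewrite ler_wpM2r ?ipr_ge0.
have : ipr D f2 f2 * ipr D g2 g2 <= eps * ipr D g2 g2 by rewrite ler_wpM2r ?ipr_ge0.
set x := ipr D f1 g1; set y := ipr D f2 g2.
have := sqr_ge0 (x - y).
nra.
Qed.

(** For a test function in place of [u] this is the definition of the weak derivative of [v].
    Replacing [u] by an approximating [phi] leaves two products whose first factors are small in
    L^2. *)
Lemma H10_ibp u v i : H10 D u -> Hk 1 D v ->
  ipr D (wpartial D i u) v = - ipr D u (wpartial D i v).
Proof.
move=> hu hv; have hu1 : Hk 1 D u by case: hu.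
have [Lu Lv] := (Hk_L2 hu1, Hk_L2 hv).
have [Ldu Ldv] := (L2_wpartial i hu1, L2_wpartial i hv).
apply/eqP; rewrite -addr_eq0; apply/eqP.
apply: (@eq0_of_small _ (2 * (ipr D v v + ipr D (wpartial D i v) (wpartial D i v)))) => eps e0.
have [phi t [h1 h2]] := H10_approx hu e0.
have Lphi : L2 D phi by exact: test_fun_L2 t.
have Ldphi : L2 D (partial i phi) by exact: test_fun_L2 (test_fun_partial i t).
have := (Hk1_wpartial i hv).2 _ t.
rewrite mlen1 expr1 mulN1r (mpartial1 _ t) => hphi.
have -> : ipr D (wpartial D i u) v + ipr D u (wpartial D i v) =
    ipr D (fun x => wpartial D i u x - partial i phi x) v +
    ipr D (fun x => u x - phi x) (wpartial D i v).
  rewrite !iprBl// [ipr D phi _]iprC [ipr D (partial i phi) _]iprC hphi; ring.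
by apply: ipr2_small => //; exact: L2B.
Qed.

(** For a test function in place of [u], both sides are minus the integral of [v] against its mixed
    second derivative, and Schwarz's theorem identifies them. Thus no second derivative of [u] or
    [v] appears; this is the core of Korn's identity. *)
Lemma H10_swap u v i j : H10 D u -> Hk 1 D v ->
  ipr D (wpartial D i u) (wpartial D j v) = ipr D (wpartial D j u) (wpartial D i v).
Proof.
move=> hu hv; have hu1 : Hk 1 D u by case: hu.
have [Lu Lv] := (Hk_L2 hu1, Hk_L2 hv).
have Ldu k := L2_wpartial k hu1; have Ldv k := L2_wpartial k hv.
apply/eqP; rewrite -subr_eq0; apply/eqP.
apply: (@eq0_of_small _ (2 * (ipr D (wpartial D j v) (wpartial D j v) +
  (* The factor -1 puts the difference into the form of a sum of two products, as [ipr2_small]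
     expects. *)
  ipr D (fun x => -1 * wpartial D i v x) (fun x => -1 * wpartial D i v x)))) => eps e0.
have [phi t [h1 h2]] := H10_approx hu e0.
have Ldphi k : L2 D (partial k phi) by exact: test_fun_L2 (test_fun_partial k t).
have hphi k l : ipr D v (partial k (partial l phi)) = - ipr D (wpartial D k v) (partial l phi).
  have := (Hk1_wpartial k hv).2 _ (test_fun_partial l t).
  by rewrite mlen1 expr1 mulN1r (mpartial1 _ (test_fun_partial l t)).
have E : ipr D (partial i phi) (wpartial D j v) = ipr D (partial j phi) (wpartial D i v).
  apply: oppr_inj; rewrite iprC -hphi [in RHS]iprC -hphi.
  by rewrite (test_fun_schwarz _ _ t).
have -> : ipr D (wpartial D i u) (wpartial D j v) - ipr D (wpartial D j u) (wpartial D i v) =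
    ipr D (fun x => wpartial D i u x - partial i phi x) (wpartial D j v) +
    ipr D (fun x => wpartial D j u x - partial j phi x) (fun x => -1 * wpartial D i v x).
  have LN : L2 D (fun x => -1 * wpartial D i v x) by exact: L2Z.
  rewrite !iprBl// ![ipr D _ (fun x => -1 * wpartial D i v x)]iprC !iprZl//.
  rewrite ![ipr D (wpartial D i v) _]iprC E; ring.
by apply: ipr2_small => //; first [exact: L2B|exact: L2Z].
Qed.

End sobolev.

(** * Broken functions on a mesh *)

Section mesh.
Context {R : realType} {d : nat}.
Local Notation pt := 'rV[R]_d.
Local Notation mu := (lebesgue_rV R d).
Variables (Om : set pt) (nel : nat) (E : 'I_nel -> set pt).
Hypothesis oOm : open Om.
Hypothesis meshE : is_mesh Om E.
Let mOm : measurable Om := open_measurable_rV oOm.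
Implicit Types (f g u v w : pt -> R) (e : 'I_nel).

Lemma mesh_open e : open (E e). Proof. by case: meshE => /(_ e)[]. Qed.

Lemma mesh_measurable e : measurable (E e).
Proof. by apply: open_measurable_rV; exact: mesh_open. Qed.

Lemma mesh_sub e : E e `<=` Om.
Proof.
have [_ _ _ ->] := meshE; rewrite -open_subsetE; last exact: mesh_open.
by move=> x Ex; exists e => //; exact: subset_closure.
Qed.

Lemma mesh_disj e e' x : E e x -> E e' x -> e = e'.
Proof.
move=> h h'; have [_ t _ _] := meshE.
by apply: (t e e' I I); exists x.
Qed.

Lemma mesh_cover : {ae mu, forall x, Om x -> exists e, E e x}.
Proof.
have [_ _ neg OmE] := meshE.
have H : mu.-negligible (\big[setU/set0]_e (closure (E e) `\` E e)).
  elim/big_ind : _ => //; first exact: negligible_set0.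
  by move=> A B hA hB; exact: negligibleU.
apply: negligibleS H => x /= /not_implyP[Omx nx].
move: Omx; rewrite OmE => /interior_subset[e _ cx].
rewrite -bigcup_seq; exists e => /=; first by rewrite mem_index_enum.
by split => // Ex; apply: nx; exists e.
Qed.

Lemma ae_mesh (P : pt -> Prop) : (forall e x, E e x -> P x) ->
  {ae mu, forall x, Om x -> P x}.
Proof. by move=> h; apply: filterS mesh_cover => x + Omx => /(_ Omx)[e /h]. Qed.

Lemma ae_mesh_in (P : pt -> Prop) : (forall e, {ae mu, forall x, E e x -> P x}) ->
  {ae mu, forall x, Om x -> P x}.
Proof.
move=> h; have h' : {ae mu, forall x, forall e, E e x -> P x}.
  by apply: filter_forall => e; exact: h.
apply: filterS2 h' mesh_cover => x h1 + Omx => /(_ Omx)[e]; exact: h1.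
Qed.

(** Off the negligible element boundaries, [f] is the sum of its restrictions to the disjoint
    elements. *)
Lemma Rintegral_mesh f : mu.-integrable Om (EFin \o f) ->
  \int[mu]_(x in Om) f x = \sum_e \int[mu]_(x in E e) f x.
Proof.
move=> fi; have fe e : mu.-integrable Om (EFin \o (f \_ (E e))).
  apply/(integrable_mkcond _ mOm).2; rewrite restrict_EFin.
  rewrite (_ : (f \_ (E e)) \_ Om = f \_ (E e)).
    rewrite -restrict_EFin; apply: (integrable_mkcond _ (mesh_measurable e)).1.
    by apply: integrableS fi => //; [exact: mesh_measurable|exact: mesh_sub].
  apply/funext => x; rewrite !patchE; case: ifPn => //.
  rewrite notin_setE => nOm; rewrite memNset// => /mesh_sub; exact: nOm.
have E1 e : \int[mu]_(x in E e) f x = \int[mu]_(x in Om) (f \_ (E e)) x.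
  rewrite Rintegral_mkcond [RHS]Rintegral_mkcond; apply: eq_Rintegral => x _.
  rewrite [RHS]patchE; case: ifPn => //.
  by rewrite notin_setE => nOm; rewrite patchE memNset// => /mesh_sub; exact: nOm.
under eq_bigr do rewrite E1.
have Esum s : mu.-integrable Om (EFin \o (fun x => \sum_(e <- s) (f \_ (E e)) x)) /\
   \int[mu]_(x in Om) (\sum_(e <- s) (f \_ (E e)) x) =
   \sum_(e <- s) \int[mu]_(x in Om) (f \_ (E e)) x.
  elim: s => [|e s [IH1 IH2]].
    split.
      rewrite (_ : _ \o _ = cst 0%E); first exact: integrable0.
      by apply/funext => x /=; rewrite big_nil.
    rewrite big_nil (@eq_Rintegral _ _ _ mu Om (cst 0)); last by move=> x _; rewrite big_nil.
    by rewrite /Rintegral integral0.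
  have EE : (fun x => \sum_(e' <- e :: s) (f \_ (E e')) x) =
      (fun x => (f \_ (E e)) x + \sum_(e' <- s) (f \_ (E e')) x).
    by apply/funext => x; rewrite big_cons.
  rewrite EE; split; first exact: integrableDR.
  by rewrite RintegralD// IH2 big_cons.
have [si <-] := Esum (index_enum 'I_nel).
apply: eq_ae_Rintegral => //.
- by case/integrableP : fi => /measurable_EFinP.
- by case/integrableP : si => /measurable_EFinP.
apply: filterS mesh_cover => x + Omx => /(_ Omx)[e Ex].
rewrite (bigD1 e)//= patchE mem_set// big1 ?addr0// => e' e'e.
rewrite patchE memNset// => /(mesh_disj Ex) ee'; by rewrite ee' eqxx in e'e.
Qed.

Lemma ipr_mesh f g : L2 Om f -> L2 Om g -> ipr Om f g = \sum_e ipr (E e) f g.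
Proof. by move=> Lf Lg; rewrite /ipr Rintegral_mesh//; exact: L2M. Qed.

(** Assembles elementwise functions, here the viscous terms, into a single L^2 function on the
    domain, so that a sum of inner products over elements becomes one inner product. *)
Definition glue (G : 'I_nel -> pt -> R) : pt -> R := fun x => \sum_e (G e \_ (E e)) x.

Lemma glueE G e x : E e x -> glue G x = G e x.
Proof.
move=> Ex; rewrite /glue (bigD1 e)//= patchE mem_set// big1 ?addr0// => e' e'e.
rewrite patchE memNset// => /(mesh_disj Ex) ee'; by rewrite ee' eqxx in e'e.
Qed.

Lemma L2_glue G : (forall e, L2 (E e) (G e)) -> L2 Om (glue G).
Proof.
move=> LG; apply: L2_sum => // e; rewrite /L2 /=.
rewrite (_ : (G e \_ (E e)) \_ Om = G e \_ (E e)); first exact: LG.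
apply/funext => x; rewrite !patchE; case: ifPn => //.
by rewrite notin_setE => nOm; rewrite memNset// => /mesh_sub; exact: nOm.
Qed.

Lemma ipr_glue G g e : ipr (E e) (G e) g = ipr (E e) (glue G) g.
Proof. by apply: eq_Rintegral => x; rewrite inE => Ex; rewrite (glueE _ Ex). Qed.

End mesh.

(** * Inner products of families of functions and Young's inequality *)

Section families.
Context {R : realType} {d : nat}.
Local Notation pt := 'rV[R]_d.
Local Notation mu := (lebesgue_rV R d).
Variable D : set pt.
Hypothesis mD : measurable D.

Lemma Rintegral_sum (I : Type) (s : seq I) (f : I -> pt -> R) :
  (forall i, mu.-integrable D (EFin \o f i)) ->
  \int[mu]_(x in D) (\sum_(i <- s) f i x) = \sum_(i <- s) \int[mu]_(x in D) f i x.
Proof.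
move=> fi.
have [_ //] : mu.-integrable D (EFin \o (fun x => \sum_(i <- s) f i x)) /\
   \int[mu]_(x in D) (\sum_(i <- s) f i x) = \sum_(i <- s) \int[mu]_(x in D) f i x.
elim: s => [|i s [IH1 IH2]].
  split.
    rewrite (_ : _ \o _ = cst 0%E); first exact: integrable0.
    by apply/funext => x /=; rewrite big_nil.
  rewrite big_nil (@eq_Rintegral _ _ _ mu D (cst 0)); last by move=> x _; rewrite big_nil.
  by rewrite /Rintegral integral0.
rewrite (_ : (fun x => \sum_(j <- i :: s) f j x) = (fun x => f i x + \sum_(j <- s) f j x)).
  split; first exact: integrableDR.
  by rewrite RintegralD// IH2 big_cons.
by apply/funext => x; rewrite big_cons.
Qed.

Lemma ipr_suml (I : Type) (s : seq I) (F : I -> pt -> R) (g : pt -> R) :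
  (forall i, L2 D (F i)) -> L2 D g ->
  ipr D (fun x => \sum_(i <- s) F i x) g = \sum_(i <- s) ipr D (F i) g.
Proof.
move=> LF Lg; elim: s => [|i s IH].
  by under eq_fun do rewrite big_nil; rewrite ipr0l big_nil.
under eq_fun do rewrite big_cons.
by rewrite iprDl// ?big_cons ?IH//; exact: L2_sum.
Qed.

Section one_index.
Variable I : finType.
Implicit Types F G H K : I -> pt -> R.

Definition L2f F := forall i, L2 D (F i).
Definition eqf F G := forall i, F i = G i %[ae mu in D].
(** One calculus for vector fields, indexed by ['I_d], and for matrix fields, indexed by
    ['I_d * 'I_d]. *)
Definition ip F G : R := \sum_i ipr D (F i) (G i).

Lemma ipC F G : ip F G = ip G F.
Proof. by apply: eq_bigr => i _; rewrite iprC. Qed.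

Lemma ip_ge0 F : 0 <= ip F F.
Proof. by apply: sumr_ge0 => i _; exact: ipr_ge0. Qed.

Lemma ip_ae F G H K : L2f F -> L2f G -> L2f H -> L2f K -> eqf F G -> eqf H K ->
  ip F H = ip G K.
Proof. by move=> LF LG LH LK FG HK; apply: eq_bigr => i _; exact: ipr_ae. Qed.

Lemma L2fD F G : L2f F -> L2f G -> L2f (fun i x => F i x + G i x).
Proof. by move=> LF LG i; exact: L2D. Qed.

Lemma L2fB F G : L2f F -> L2f G -> L2f (fun i x => F i x - G i x).
Proof. by move=> LF LG i; exact: L2B. Qed.

Lemma ipDl F G H : L2f F -> L2f G -> L2f H ->
  ip (fun i x => F i x + G i x) H = ip F H + ip G H.
Proof.
by move=> LF LG LH; rewrite /ip -big_split; apply: eq_bigr => i _; exact: iprDl.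
Qed.

Lemma ipBl F G H : L2f F -> L2f G -> L2f H ->
  ip (fun i x => F i x - G i x) H = ip F H - ip G H.
Proof.
move=> LF LG LH; rewrite /ip -sumrB; apply: eq_bigr => i _; exact: iprBl.
Qed.

Lemma ipDr F G H : L2f F -> L2f G -> L2f H ->
  ip H (fun i x => F i x + G i x) = ip H F + ip H G.
Proof. by move=> LF LG LH; rewrite ipC ipDl// (ipC F) (ipC G). Qed.

Lemma ipr_young f g (t : R) : 0 < t -> L2 D f -> L2 D g ->
  ipr D f g <= t * ipr D f f + (4 * t)^-1 * ipr D g g.
Proof.
(* The inequality is the expansion of t times the square norm of f - g/(2t). *)
move=> t0 Lf Lg; pose s := (2 * t)^-1.
have Ls := L2Z mD s Lg.
have := ipr_ge0 D (fun x => f x - s * g x).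
rewrite iprBl//; last exact: L2B.
rewrite [ipr D f _]iprC iprBl// [ipr D (fun x => s * g x) (fun x => f x - _)]iprC.
rewrite [ipr D (fun x => f x - s * g x) (fun x => s * g x)]iprBl//.
rewrite [ipr D f (fun x => s * g x)]iprC !iprZl//.
rewrite [ipr D g (fun x => s * g x)]iprC !iprZl// [ipr D g f]iprC.
set A := ipr D f f; set B := ipr D f g; set C := ipr D g g => h.
have : 0 <= t * (A - s * B - (s * B - s * (s * C))) by rewrite mulr_ge0// ltW.
rewrite (_ : t * _ = t * A - B + (4 * t)^-1 * C); last first.
  by rewrite /s; field; rewrite gt_eqF.
by move=> ?; lra.
Qed.

Lemma ip_young F G (t : R) : 0 < t -> L2f F -> L2f G ->
  ip F G <= t * ip F F + (4 * t)^-1 * ip G G.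
Proof.
move=> t0 LF LG; rewrite /ip !mulr_sumr -big_split; apply: ler_sum => i _.
exact: ipr_young.
Qed.

Lemma ip_youngN F G (t : R) : 0 < t -> L2f F -> L2f G ->
  - ip F G <= t * ip F F + (4 * t)^-1 * ip G G.
Proof.
move=> t0 LF LG; rewrite /ip !mulr_sumr -big_split -sumrN; apply: ler_sum => i _ /=.
have LN := L2Z mD (-1) (LF i).
have := ipr_young t0 LN (LG i); rewrite iprZl// mulN1r => /le_trans; apply.
by rewrite iprZl// iprC iprZl// !mulN1r opprK.
Qed.

Lemma ip_D2 F G : L2f F -> L2f G ->
  ip (fun i x => F i x + G i x) (fun i x => F i x + G i x) <= 2 * ip F F + 2 * ip G G.
Proof.
move=> LF LG; have h2 : (0 : R) < 2^-1 by rewrite invr_gt0.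
have := ip_young h2 LF LG; rewrite ipDl//; last exact: L2fD.
rewrite !ipDr// [ip G F]ipC (_ : 4 / 2 = 2 :> R); last by field.
by lra.
Qed.

Lemma ip_B2 F G : L2f F -> L2f G ->
  ip (fun i x => F i x - G i x) (fun i x => F i x - G i x) <= 2 * ip F F + 2 * ip G G.
Proof.
move=> LF LG; have h2 : (0 : R) < 2^-1 by rewrite invr_gt0.
have LGN : L2f (fun i x => - G i x) by move=> i; exact: L2N.
have := ip_D2 LF LGN; rewrite [ip (fun i x => - G i x) _](_ : _ = ip G G)//.
by apply: eq_bigr => i _; apply: eq_Rintegral => x _; rewrite mulrNN.
Qed.

Definition scalef (c : pt -> R) F := fun i x => c x * F i x.

Lemma L2_scalef (c : pt -> R) (M : R) F : measurable_fun D c ->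
  {ae mu, forall x, D x -> `|c x| <= M} -> L2f F -> L2f (scalef c F).
Proof. by move=> mc cM LF i; exact: L2_mul_bounded cM (LF i). Qed.

Lemma ip_scalef (c : pt -> R) (M : R) F : measurable_fun D c ->
  {ae mu, forall x, D x -> `|c x| <= M} -> L2f F ->
  ip (scalef c F) (scalef c F) <= M ^+ 2 * ip F F.
Proof.
move=> mc cM LF; rewrite /ip mulr_sumr; apply: ler_sum => i _.
have Lc := L2_mul_bounded mD mc cM (LF i).
rewrite /ipr -RintegralZl//; last exact: L2M.
rewrite /scalef /Rintegral.
have i1 := L2M mD Lc Lc; have i2 := integrableZR mD (M ^+ 2) (L2M mD (LF i) (LF i)).
apply: fine_le; [exact: integrable_fin_num i1|exact: integrable_fin_num i2|].
apply: ae_ge0_le_integral => //.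
- by move=> x _; rewrite lee_fin -expr2 sqr_ge0.
- by case/integrableP : i1.
- by move=> x _; rewrite lee_fin -expr2 mulr_ge0 ?sqr_ge0.
- by case/integrableP : i2.
apply: filterS cM => x /[apply] h; rewrite lee_fin -!expr2 exprMn.
rewrite ler_wpM2r ?sqr_ge0// -(real_normK (num_real (c x))).
by rewrite lerXn2r// ?nnegrE// (le_trans _ h).
Qed.

End one_index.
End families.

Section more_wderiv.
Context {R : realType} {d : nat}.
Local Notation pt := 'rV[R]_d.
Local Notation mu := (lebesgue_rV R d).
Hypothesis d0 : (0 < d)%N.
Implicit Types (u w q : pt -> R) (D : set pt) (i j : 'I_d) (a : 'I_d -> nat).

Lemma HkD k D u u' : open D -> Hk k D u -> Hk k D u' -> Hk k D (fun x => u x + u' x).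
Proof.
move=> oD [Lu h] [Lu' h']; split; first by apply: L2D => //; exact: open_measurable_rV.
move=> a al; have [w hw] := h _ al; have [w' hw'] := h' _ al.
by eexists; exact: is_wderivD hw hw'.
Qed.

Lemma HkB k D u u' : open D -> Hk k D u -> Hk k D u' -> Hk k D (u - u').
Proof.
move=> oD [Lu h] [Lu' h']; split; first by apply: L2B => //; exact: open_measurable_rV.
move=> a al; have [w hw] := h _ al; have [w' hw'] := h' _ al.
by eexists; exact: is_wderivB hw hw'.
Qed.

Lemma HkS k D D' u : open D -> open D' -> D' `<=` D -> Hk k D u -> Hk k D' u.
Proof.
move=> oD oD' DD' [Lu h]; split; first by apply: L2S Lu => //; exact: open_measurable_rV.
by move=> a /h[w hw]; exists w; exact: is_wderivS hw.
Qed.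

(** The representatives chosen on [D] and on [D'] are unrelated, so a restriction property can hold
    only almost everywhere, through uniqueness. *)
Lemma wderivS D D' a u : open D -> open D' -> D' `<=` D -> (exists w, is_wderiv D a u w) ->
  wderiv D' a u = wderiv D a u %[ae mu in D'].
Proof.
move=> oD oD' DD' [w hw]; apply: wderiv_ae => //.
by apply: is_wderivS (wderivP hw).
Qed.

Lemma wderivB D k a u u' : open D -> Hk k D u -> Hk k D u' -> (mlen a <= k)%N ->
  wderiv D a (u - u') = (fun x => wderiv D a u x - wderiv D a u' x) %[ae mu in D].
Proof.
move=> oD hu hu' ak; apply: wderiv_ae => //; apply: is_wderivB => //.
- exact: Hk_L2 hu.
- exact: Hk_L2 hu'.
- exact: Hk_wderiv hu ak.
- exact: Hk_wderiv hu' ak.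
Qed.

Lemma mlen_le1 a : (mlen a <= 1)%N -> a = (fun=> 0%N) \/ exists i, a = midx1 i.
Proof.
have [/forallP a0 _|] := boolP [forall i, a i == 0%N].
  by left; apply/funext => i; exact/eqP.
rewrite negb_forall => /existsP[i ai] a1; right; exists i.
have ai0 : (0 < a i)%N by rewrite lt0n.
move: a1; rewrite /mlen (bigD1 i)//= => a1.
have [ai1 rest0] : a i = 1%N /\ (\sum_(j | j != i) a j)%N = 0%N.
  move: a1 ai0; case: (a i) => [|n]//; rewrite addSn ltnS leqn0 addn_eq0.
  by move=> /andP[/eqP-> /eqP ->].
apply/funext => j; rewrite /midx1; case: (eqVneq j i) => [->//|ji].
by apply/eqP; move/eqP: rest0; rewrite sum_nat_eq0 => /forallP/(_ j); rewrite ji.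
Qed.

Lemma Hk1_intro D u (w : 'I_d -> pt -> R) : L2 D u ->
  (forall i, is_wderiv D (midx1 i) u (w i)) -> Hk 1 D u.
Proof.
move=> Lu h; split => // a /mlen_le1[->|[i ->]].
  by exists u; exact: is_wderiv0.
by exists (w i).
Qed.

Lemma Hk1_test D phi : open D -> test_fun D phi -> Hk 1 D phi.
Proof.
move=> oD t; have mD := open_measurable_rV oD.
apply: (@Hk1_intro _ _ (fun i => partial i phi)); first exact: test_fun_L2 t.
by move=> i; exact: is_wderiv_test.
Qed.

Lemma H10_test D phi : open D -> test_fun D phi -> H10 D phi.
Proof.
move=> oD t; split; first exact: Hk1_test.
have mD := open_measurable_rV oD.
move=> eps e0; exists phi => //; rewrite subrr.
suff h k : hsemi2 k D (0 : pt -> R) = 0 by rewrite !h addr0.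
rewrite /hsemi2 big1// => a _.
have z : is_wderiv D (fun i => a i : nat) (0 : pt -> R) (fun=> 0).
  by split; [exact: L20f|move=> chi _; rewrite !ipr0l mulr0].
have [Lz _] := z; have [Lw _] := wderivP z; have zz := wderiv_ae d0 oD z.
by rewrite (ipr_ae mD Lw Lz Lw Lz zz zz) ipr0l.
Qed.

Lemma test_fun0 D : test_fun D (fun=> 0 : R).
Proof.
split; first by apply: bump_alg_smooth; exact: bump_cst.
by exists set0 => //; split => //; exact: compact0.
Qed.

Lemma wpartial_test D phi i : open D -> test_fun D phi ->
  wpartial D i phi = partial i phi %[ae mu in D].
Proof.
move=> oD t; apply: wderiv_ae => //; apply: is_wderiv_test => //.
exact: open_measurable_rV.
Qed.

Lemma Hk1_cst D (c : R) : open D -> bounded_set D -> Hk 1 D (fun=> c).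
Proof.
move=> oD bD; have mD := open_measurable_rV oD.
apply: (@Hk1_intro _ _ (fun i => fun=> 0)); last by move=> i; exact: is_wderiv_cst.
apply/L2P => //; split; first exact: measurable_cst.
apply: measurable_bounded_integrable => //; first exact: bounded_finite.
by exists (c ^+ 2); split; [exact: num_real|move=> N cN x _ /=; rewrite ger0_norm ?sqr_ge0 ?ltW].
Qed.

Lemma wpartial_cst D (c : R) i : open D -> wpartial D i (fun=> c) = (fun=> 0) %[ae mu in D].
Proof.
move=> oD; apply: wderiv_ae => //; apply: is_wderiv_cst => //.
exact: open_measurable_rV.
Qed.

Lemma coordfB (v w : pt -> pt) i : coordf (v - w) i = coordf v i - coordf w i.
Proof. by apply/funext => x; rewrite /coordf !fctE !mxE. Qed.

(** The j-th summand of the i-th component of div(2 nu sym grad v) in explicit second derivatives;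
    the 2 cancels the 1/2 of the symmetrized gradient. Unlike [visc_div], it contains no weak
    derivative of a chosen representative, which makes differences and restrictions easy. *)
Definition visc_comp D (nu : R) (v : pt -> pt) i j : pt -> R := fun x =>
  nu * (wderiv D (midx2 j j) (coordf v i) x + wderiv D (midx2 i j) (coordf v j) x).

Lemma is_wderiv_visc D nu (v : pt -> pt) i j : open D -> Hkv 2 D v ->
  is_wderiv D (midx1 j) (fun y => ((2 * nu) *: sgrad D v y) i j) (visc_comp D nu v i j).
Proof.
move=> oD hv; have mD := open_measurable_rV oD.
have hv1 k : Hk 1 D (coordf v k) by exact: Hk_le (hv k).
have L k l := L2_wpartial l (hv1 k).
rewrite (_ : (fun y => _) = (fun y => nu * (wpartial D j (coordf v i) y +
   wpartial D i (coordf v j) y))); last first.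
  by apply/funext => y; rewrite !mxE; field.
apply: is_wderivZ => //; first exact: L2D.
by apply: is_wderivD => //; exact: Hk_wpartial.
Qed.

Lemma visc_divE D nu (v : pt -> pt) i : open D -> Hkv 2 D v ->
  (fun x => visc_div D nu v x 0 i) = (fun x => \sum_j visc_comp D nu v i j x) %[ae mu in D].
Proof.
move=> oD hv.
have h : {ae mu, forall x, forall j, D x ->
   wpartial D j (fun y => ((2 * nu) *: sgrad D v y) i j) x = visc_comp D nu v i j x}.
  by apply: filter_forall => j; apply: wderiv_ae => //; exact: is_wderiv_visc.
apply: filterS h => x h Dx; rewrite mxE; apply: eq_bigr => j _; exact: h.
Qed.

Lemma L2_visc_comp D nu (v : pt -> pt) i j : open D -> Hkv 2 D v ->
  L2 D (visc_comp D nu v i j).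
Proof. by move=> oD hv; case: (is_wderiv_visc nu i j oD hv). Qed.

Lemma L2_visc_div D nu (v : pt -> pt) i : open D -> Hkv 2 D v ->
  L2 D (fun x => visc_div D nu v x 0 i).
Proof.
move=> oD hv; rewrite (_ : (fun x => _) = (fun x =>
   \sum_j wpartial D j (fun y => ((2 * nu) *: sgrad D v y) i j) x)); last first.
  by apply/funext => x; rewrite mxE.
apply: L2_sum => [|j]; first exact: open_measurable_rV.
by case: (wderivP (is_wderiv_visc nu i j oD hv)).
Qed.

Lemma visc_compB D nu (v w : pt -> pt) i j : open D -> Hkv 2 D v -> Hkv 2 D w ->
  visc_comp D nu (v - w) i j =
  (fun x => visc_comp D nu v i j x - visc_comp D nu w i j x) %[ae mu in D].
Proof.
move=> oD hv hw; rewrite /visc_comp !coordfB.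
have h1 := @wderivB D 2 (midx2 j j) _ _ oD (hv i) (hw i) (eq_leq (mlen2 j j)).
have h2 := @wderivB D 2 (midx2 i j) _ _ oD (hv j) (hw j) (eq_leq (mlen2 i j)).
by apply: filterS2 h1 h2 => x + + Dx => /(_ Dx) -> /(_ Dx) ->; ring.
Qed.

Lemma visc_divB D nu (v w : pt -> pt) i : open D -> Hkv 2 D v -> Hkv 2 D w ->
  (fun x => visc_div D nu (v - w) x 0 i) =
  (fun x => visc_div D nu v x 0 i - visc_div D nu w x 0 i) %[ae mu in D].
Proof.
move=> oD hv hw; have hvw : Hkv 2 D (v - w) by move=> k; rewrite coordfB; exact: HkB.
have h1 := visc_divE nu i oD hv; have h2 := visc_divE nu i oD hw.
have h3 := visc_divE nu i oD hvw.
have h4 : {ae mu, forall x, forall j, D x -> visc_comp D nu (v - w) i j x =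
    visc_comp D nu v i j x - visc_comp D nu w i j x}.
  by apply: filter_forall => j; exact: visc_compB.
apply: filterS2 (filterI h1 h2) (filterI h3 h4) => x [e1 e2] [e3 e4] Dx.
refine (etrans (e3 Dx) (esym _)).
refine (etrans (congr2 (fun s t => s - t) (e1 Dx) (e2 Dx)) _).
by rewrite -sumrB; apply: eq_bigr => j _; rewrite e4.
Qed.

Lemma visc_divS D D' nu (v : pt -> pt) i : open D -> open D' -> D' `<=` D -> Hkv 2 D v ->
  (fun x => visc_div D' nu v x 0 i) = (fun x => visc_div D nu v x 0 i) %[ae mu in D'].
Proof.
move=> oD oD' DD' hv; have hv' : Hkv 2 D' v by move=> k; exact: HkS (hv k).
have h1 := visc_divE nu i oD' hv'; have h2 := visc_divE nu i oD hv.
have h3 : {ae mu, forall x, forall j, D' x -> visc_comp D' nu v i j x = visc_comp D nu v i j x}.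
  apply: filter_forall => j.
  have k1 : wderiv D' (midx2 j j) (coordf v i) = wderiv D (midx2 j j) (coordf v i) %[ae mu in D'].
    by apply: wderivS => //; apply: (hv i).2; rewrite mlen2.
  have k2 : wderiv D' (midx2 i j) (coordf v j) = wderiv D (midx2 i j) (coordf v j) %[ae mu in D'].
    by apply: wderivS => //; apply: (hv j).2; rewrite mlen2.
  by apply: filterS2 k1 k2 => x + + Dx; rewrite /visc_comp => /(_ Dx) -> /(_ Dx) ->.
apply: filterS2 (filterI h1 h2) h3 => x [e1 e2] e3 Dx.
refine (etrans (e1 Dx) (etrans _ (esym (e2 (DD' _ Dx))))).
by apply: eq_bigr => j _; exact: e3.
Qed.

End more_wderiv.

(** * Differential operators, Green formulas, consistency *)

Section operators.
Context {R : realType} {d : nat}.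
Local Notation pt := 'rV[R]_d.
Local Notation mu := (lebesgue_rV R d).
Hypothesis d0 : (0 < d)%N.

Lemma iprvE (D : set pt) (v w : pt -> pt) : measurable D -> L2v D v -> L2v D w ->
  iprv D v w = ip D (coordf v) (coordf w).
Proof.
move=> mD Lv Lw; rewrite /iprv /dotv Rintegral_sum// => i.
exact: (L2M mD (Lv i) (Lw i)).
Qed.

Lemma sum_pairE (F : 'I_d * 'I_d -> R) : \sum_i \sum_j F (i, j) = \sum_ij F ij.
Proof. by rewrite pair_bigA; apply: eq_bigr => -[]. Qed.

Lemma iprmE (D : set pt) (A B : pt -> 'M[R]_d) : measurable D ->
  (forall i j, L2 D (fun x => A x i j)) -> (forall i j, L2 D (fun x => B x i j)) ->
  iprm D A B = ip D (fun (ij : 'I_d * 'I_d) x => A x ij.1 ij.2) (fun ij x => B x ij.1 ij.2).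
Proof.
move=> mD LA LB; rewrite /iprm /ddot.
rewrite (@eq_Rintegral _ _ _ mu D
    (fun x => \sum_(ij : 'I_d * 'I_d) A x ij.1 ij.2 * B x ij.1 ij.2)).
  by rewrite Rintegral_sum// => ij; exact: L2M.
by move=> x _; rewrite -sum_pairE.
Qed.

Variables (Om : set pt) (nu : R) (a : pt) (nel : nat) (E : 'I_nel -> set pt).
Hypotheses (oOm : open Om) (meshE : is_mesh Om E).
Let mOm : measurable Om := open_measurable_rV oOm.
Let oE : forall e, open (E e).
Proof. by move=> e; exact: (mesh_open meshE). Qed.
Let mE e : measurable (E e).
Proof. by apply: open_measurable_rV; exact: oE. Qed.
Let EOm e : E e `<=` Om.
Proof. exact: (mesh_sub meshE). Qed.
Implicit Types (v w : pt -> pt) (q r : pt -> R) (e : 'I_nel).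

(** The regularity shared by the discrete velocities and the exact one: enough for the global
    first-order terms and the elementwise viscous term. *)
Definition goodv v := Hkv 1 Om v /\ forall e, Hkv 2 (E e) v.

(** The differential operators are recoded as families of scalar functions so that [ip] applies: in
    turn the gradient, its symmetric part, the advective derivative, the pressure gradient and the
    broken viscous divergence. *)
Definition Dv v (ij : 'I_d * 'I_d) : pt -> R := wpartial Om ij.2 (coordf v ij.1).
Definition Sv v (ij : 'I_d * 'I_d) : pt -> R :=
  fun x => 2^-1 * (Dv v ij x + Dv v (ij.2, ij.1) x).
Definition Av v i : pt -> R := fun x => \sum_j a 0 j * Dv v (i, j) x.
Definition Gq q i : pt -> R := wpartial Om i q.
Definition Vv v i : pt -> R := glue E (fun e x => visc_div (E e) nu v x 0 i).

Lemma goodvB v w : goodv v -> goodv w -> goodv (v - w).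
Proof.
move=> [hv1 hv2] [hw1 hw2]; split => [i|e i]; rewrite coordfB.
  exact: HkB (hv1 i) (hw1 i).
by apply: HkB; [exact: oE|exact: hv2|exact: hw2].
Qed.

Lemma L2_coordf v : Hkv 1 Om v -> L2f Om (coordf v).
Proof. by move=> h i; exact: Hk_L2 (h i). Qed.

Lemma L2_Dv v : Hkv 1 Om v -> L2f Om (Dv v).
Proof. by move=> h ij; exact: L2_wpartial. Qed.

Lemma L2_Sv v : Hkv 1 Om v -> L2f Om (Sv v).
Proof. by move=> gv ij; apply: L2Z => //; apply: L2D => //; exact: L2_Dv. Qed.

Lemma L2_Av v : Hkv 1 Om v -> L2f Om (Av v).
Proof. by move=> gv i; apply: L2_sum => // j; apply: L2Z => //; exact: L2_Dv. Qed.

Lemma L2_Gq q : Hk 1 Om q -> L2f Om (Gq q).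
Proof. by move=> hq i; exact: L2_wpartial. Qed.

Lemma L2_Vv v : goodv v -> L2f Om (Vv v).
Proof. by move=> [_ h] i; apply: (L2_glue oOm meshE) => e; exact: L2_visc_div. Qed.

Lemma DvB v w : Hkv 1 Om v -> Hkv 1 Om w ->
  eqf Om (Dv (v - w)) (fun ij x => Dv v ij x - Dv w ij x).
Proof. by move=> hv hw ij; rewrite /Dv coordfB; exact: wpartialB. Qed.

Lemma SvB v w : Hkv 1 Om v -> Hkv 1 Om w ->
  eqf Om (Sv (v - w)) (fun ij x => Sv v ij x - Sv w ij x).
Proof.
move=> gv gw ij; have h1 := DvB gv gw ij; have h2 := DvB gv gw (ij.2, ij.1).
by apply: filterS2 h1 h2 => x + + Ox; rewrite /Sv => /(_ Ox) -> /(_ Ox) ->; ring.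
Qed.

Lemma AvB v w : Hkv 1 Om v -> Hkv 1 Om w ->
  eqf Om (Av (v - w)) (fun i x => Av v i x - Av w i x).
Proof.
move=> gv gw i.
have h : {ae mu, forall x, forall j, Om x -> Dv (v - w) (i, j) x = Dv v (i, j) x - Dv w (i, j) x}.
  by apply: filter_forall => j; exact: (DvB gv gw (i, j)).
apply: filterS h => x h Ox; rewrite /Av -sumrB; apply: eq_bigr => j _.
by rewrite h// mulrBr.
Qed.

Lemma GqB q r : Hk 1 Om q -> Hk 1 Om r -> eqf Om (Gq (q - r)) (fun i x => Gq q i x - Gq r i x).
Proof. by move=> hq hr i; exact: wpartialB. Qed.

Lemma VvB v w : goodv v -> goodv w ->
  eqf Om (Vv (v - w)) (fun i x => Vv v i x - Vv w i x).
Proof.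
move=> [_ hv] [_ hw] i; apply: (ae_mesh_in meshE) => e.
have h : (fun x => visc_div (E e) nu (v - w) x 0 i) =
    (fun x => visc_div (E e) nu v x 0 i - visc_div (E e) nu w x 0 i) %[ae mu in E e].
  by apply: visc_divB => //; exact: oE.
apply: filterS h => x + Ex => /(_ Ex) h.
refine (etrans (glueE meshE _ Ex) (etrans h (esym _))).
exact (congr2 (fun s t => s - t) (glueE meshE _ Ex) (glueE meshE _ Ex)).
Qed.

Lemma cformE v w : Hkv 1 Om v -> L2v Om w -> cform Om a v w = ip Om (Av v) (coordf w).
Proof.
move=> gv Lw; have AE i : coordf (advect Om a v) i = Av v i.
  by apply/funext => x; rewrite /coordf mxE.
rewrite /cform iprvE//; last by move=> i; rewrite AE; exact: L2_Av.
by apply: eq_bigr => i _; rewrite AE.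
Qed.

Lemma sgradE v x i j : sgrad Om v x i j = Sv v (i, j) x.
Proof. by rewrite mxE. Qed.

Lemma kformE v w : Hkv 1 Om v -> Hkv 1 Om w ->
  kform Om nu v w = 2 * nu * ip Om (Sv v) (Sv w).
Proof.
move=> gv gw; have Lv i j : L2 Om (fun x => sgrad Om v x i j).
  by under eq_fun do rewrite sgradE; exact: L2_Sv.
have Lw i j : L2 Om (fun x => sgrad Om w x i j).
  by under eq_fun do rewrite sgradE; exact: L2_Sv.
rewrite (_ : ip _ _ _ = iprm Om (sgrad Om v) (sgrad Om w)).
  rewrite /kform RintegralZl//.
  rewrite (_ : _ \o _ = EFin \o (fun x =>
    \sum_ij sgrad Om v x ij.1 ij.2 * sgrad Om w x ij.1 ij.2)).
    have : forall s : seq ('I_d * 'I_d), mu.-integrable Om (EFin \o (fun x =>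
       \sum_(ij <- s) sgrad Om v x ij.1 ij.2 * sgrad Om w x ij.1 ij.2)).
      elim=> [|ij s IH].
        rewrite (_ : _ \o _ = cst 0%E); first exact: integrable0.
        by apply/funext => x /=; rewrite big_nil.
      rewrite (_ : _ \o _ = EFin \o (fun x => sgrad Om v x ij.1 ij.2 * sgrad Om w x ij.1 ij.2 +
        \sum_(ij <- s) sgrad Om v x ij.1 ij.2 * sgrad Om w x ij.1 ij.2)).
        by apply: integrableDR => //; exact: L2M.
      by apply/funext => x /=; rewrite big_cons.
    by move=> /(_ (index_enum _)).
  by apply/funext => x /=; rewrite /ddot -sum_pairE.
rewrite iprmE//; apply: eq_bigr => -[i j] _; apply: eq_Rintegral => x _.
by rewrite !sgradE.
Qed.

Variables (tauM : pt -> R) (T : R).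
Hypothesis T0 : 0 <= T.
Hypothesis mtau : measurable_fun Om tauM.
Hypothesis tau0 : forall x, Om x -> 0 < tauM x.
Hypothesis tauT : {ae mu, forall x, Om x -> tauM x <= T}.

Definition Yv v q i : pt -> R := fun x => Av v i x + Gq q i x.

Lemma L2_Yv v q : Hkv 1 Om v -> Hk 1 Om q -> L2f Om (Yv v q).
Proof. by move=> gv hq; apply: L2fD => //; [exact: L2_Av|exact: L2_Gq]. Qed.

Lemma YvB v w q r : Hkv 1 Om v -> Hkv 1 Om w -> Hk 1 Om q -> Hk 1 Om r ->
  eqf Om (Yv (v - w) (q - r)) (fun i x => Yv v q i x - Yv w r i x).
Proof.
move=> gv gw hq hr i; have h1 := AvB gv gw i; have h2 := GqB hq hr i.
by apply: filterS2 h1 h2 => x + + Ox; rewrite /Yv => /(_ Ox) -> /(_ Ox) ->; ring.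
Qed.

Lemma tau_norm : {ae mu, forall x, Om x -> `|tauM x| <= T}.
Proof. by apply: filterS tauT => x h Ox; rewrite gtr0_norm ?tau0// h. Qed.

Lemma L2_tau (F : 'I_d -> pt -> R) : L2f Om F -> L2f Om (scalef tauM F).
Proof. exact: (L2_scalef mOm mtau tau_norm). Qed.

Lemma stab_testE v q i : coordf (stab_test Om a tauM v q) i = scalef tauM (Yv v q) i.
Proof. by apply/funext => x; rewrite /coordf /stab_test /scalef /Yv !mxE. Qed.

(** Splitting the weight evenly turns the inner product of [F] with [tauM] times [G] into an
    unweighted inner product, to which Young's inequality applies. *)
Definition sqtau : pt -> R := fun x => Num.sqrt (tauM x).

Lemma measurable_sqtau : measurable_fun Om sqtau.
Proof. by apply: measurableT_comp => //; apply: continuous_measurable_fun; exact: sqrt_continuous. Qed.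

Lemma sqtau_norm : {ae mu, forall x, Om x -> `|sqtau x| <= Num.sqrt T}.
Proof.
apply: filterS tauT => x h Ox; rewrite ger0_norm ?sqrtr_ge0//.
by rewrite ler_wsqrtr// h.
Qed.

Lemma L2_sqtau (F : 'I_d -> pt -> R) : L2f Om F -> L2f Om (scalef sqtau F).
Proof. exact: (L2_scalef mOm measurable_sqtau sqtau_norm). Qed.

Lemma ip_sqtau (F G : 'I_d -> pt -> R) :
  ip Om F (scalef tauM G) = ip Om (scalef sqtau F) (scalef sqtau G).
Proof.
apply: eq_bigr => i _; apply: eq_Rintegral => x; rewrite inE => Ox.
rewrite /scalef /sqtau -{1}(@sqr_sqrtr _ (tauM x)) ?ltW ?tau0//; ring.
Qed.

Lemma ip_sqtau_le (F : 'I_d -> pt -> R) : L2f Om F ->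
  ip Om (scalef sqtau F) (scalef sqtau F) <= T * ip Om F F.
Proof.
move=> LF; rewrite -[X in X * _](sqr_sqrtr T0).
exact: (ip_scalef mOm measurable_sqtau sqtau_norm).
Qed.

Lemma stabE v q w r : Hkv 1 Om v -> Hk 1 Om q -> goodv w -> Hk 1 Om r ->
  \sum_e iprv (E e)
      (fun x => advect Om a w x - visc_div (E e) nu w x + grad Om r x)
      (stab_test Om a tauM v q) =
  ip Om (fun i x => Av w i x - Vv w i x + Gq r i x) (scalef tauM (Yv v q)).
Proof.
move=> hv hq gw hr; have hw := gw.1; have LF i : L2 Om (fun x => Av w i x - Vv w i x + Gq r i x).
  by apply: L2D => //; [apply: L2B => //; [exact: L2_Av|exact: L2_Vv]|exact: L2_Gq].
have LY := L2_tau (L2_Yv hv hq).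
rewrite /ip; under [RHS]eq_bigr do rewrite (ipr_mesh oOm meshE)//.
rewrite exchange_big; apply: eq_bigr => e _.
have cE i : coordf (fun x => advect Om a w x - visc_div (E e) nu w x + grad Om r x) i =
    (fun x => Av w i x - visc_div (E e) nu w x 0 i + Gq r i x).
  by apply/funext => x; rewrite /coordf !mxE.
have LS (F : pt -> R) : L2 Om F -> L2 (E e) F by apply: L2S.
rewrite iprvE//.
- apply: eq_bigr => i _; rewrite cE stab_testE; apply: eq_Rintegral => x.
  by rewrite inE => Ex; rewrite /Vv (glueE meshE _ Ex).
- move=> i; rewrite cE; apply: L2D => //; last by apply: LS; exact: L2_Gq.
  apply: L2B => //; first by apply: LS; exact: L2_Av.
  by apply: L2_visc_div => //; case: gw.
- by move=> i; rewrite stab_testE; exact: LS.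
Qed.

Lemma tnorm2E v q : Hkv 1 Om v -> Hk 1 Om q ->
  tnorm2 Om a nu tauM v q = 2 * nu * ip Om (Sv v) (Sv v) +
    ip Om (scalef sqtau (Yv v q)) (scalef sqtau (Yv v q)).
Proof.
move=> gv hq; rewrite /tnorm2 kformE//; congr (_ + _); rewrite -ip_sqtau.
have YE i : coordf (advgrad Om a v q) i = Yv v q i.
  by apply/funext => x; rewrite /coordf /advgrad /Yv !mxE.
rewrite iprvE//.
- by apply: eq_bigr => i _; rewrite YE stab_testE.
- by move=> i; rewrite YE; exact: L2_Yv.
- by move=> i; rewrite stab_testE; apply: L2_tau; exact: L2_Yv.
Qed.

End operators.

(** * Green formulas, Korn's identity and the strong form of the Oseen problem *)

Section consistency.
Context {R : realType} {d : nat}.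
Local Notation pt := 'rV[R]_d.
Local Notation mu := (lebesgue_rV R d).
Hypothesis d0 : (0 < d)%N.
Variables (Om : set pt) (nu : R) (a : pt).
Hypotheses (oOm : open Om) (bOm : bounded_set Om).
Let mOm : measurable Om := open_measurable_rV oOm.
Implicit Types (v w : pt -> pt) (q r : pt -> R).

Lemma H10v_Hkv v : H10v Om v -> Hkv 1 Om v.
Proof. by move=> h i; case: (h i). Qed.

Lemma divergenceE v : divergence Om v = (fun x => \sum_i Dv Om v (i, i) x).
Proof. by []. Qed.

Lemma L2_divergence v : Hkv 1 Om v -> L2 Om (divergence Om v).
Proof. by move=> hv; rewrite divergenceE; apply: L2_sum => // i; exact: L2_Dv. Qed.

Lemma bformB v w q : Hkv 1 Om v -> Hkv 1 Om w -> L2 Om q ->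
  bform Om (v - w) q = bform Om v q - bform Om w q.
Proof.
move=> hv hw Lq; have hvw : Hkv 1 Om (v - w) by move=> i; rewrite coordfB; exact: HkB (hv i) (hw i).
have [Lv Lw] := (L2_divergence hv, L2_divergence hw).
rewrite /bform -iprBl//; apply: ipr_ae => //.
- exact: L2_divergence.
- exact: L2B.
- have h : {ae mu, forall x, forall i, Om x ->
     Dv Om (v - w) (i, i) x = Dv Om v (i, i) x - Dv Om w (i, i) x}.
    by apply: filter_forall => i; exact: (DvB d0 oOm hv hw (i, i)).
  apply: filterS h => x h Ox; rewrite !divergenceE -sumrB.
  by apply: eq_bigr => i _; exact: h.
- exact: aeW.
Qed.

Lemma bform_ae0 v q : Hkv 1 Om v -> L2 Om q ->
  divergence Om v = (fun=> 0) %[ae mu in Om] -> bform Om v q = 0.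
Proof.
move=> hv Lq dv; have Ld := L2_divergence hv.
rewrite /bform -(ipr0l Om q); apply: ipr_ae => //; first exact: L20f.
exact: aeW.
Qed.

Lemma bform_ibp v q : H10v Om v -> Hk 1 Om q ->
  bform Om v q = - ip Om (coordf v) (Gq Om q).
Proof.
move=> hv hq; have hv1 := H10v_Hkv hv; have Lq := Hk_L2 hq.
rewrite /bform divergenceE ipr_suml//; last by move=> i; exact: L2_Dv.
by rewrite /ip -sumrN; apply: eq_bigr => i _; exact: H10_ibp.
Qed.

Lemma cform_ibp v w : H10v Om w -> Hkv 1 Om v ->
  ip Om (Av Om a v) (coordf w) = - ip Om (coordf v) (Av Om a w).
Proof.
move=> hw hv; have hw1 := H10v_Hkv hw.
rewrite /ip -sumrN; apply: eq_bigr => i _.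
have Lv : L2 Om (coordf v i) by exact: Hk_L2 (hv i).
have Lw : L2 Om (coordf w i) by exact: Hk_L2 (hw1 i).
have LDv j : L2 Om (fun x => a 0 j * Dv Om v (i, j) x) by apply: L2Z => //; exact: L2_Dv.
have LDw j : L2 Om (fun x => a 0 j * Dv Om w (i, j) x) by apply: L2Z => //; exact: L2_Dv.
rewrite [in RHS]iprC !ipr_suml// -sumrN; apply: eq_bigr => j _.
have [kv kw] := (L2_Dv hv (i, j), L2_Dv hw1 (i, j)).
rewrite !iprZl// -mulrN; congr (_ * _).
by rewrite [RHS](congr1 -%R (H10_ibp d0 oOm j (hw i) (hv i))) opprK iprC.
Qed.

Lemma cform_skew v : H10v Om v -> ip Om (Av Om a v) (coordf v) = 0.
Proof.
move=> hv; have := cform_ibp hv (H10v_Hkv hv).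
rewrite [X in - X]ipC => h; apply/eqP; move: h; set c := ip _ _ _ => h.
by apply/eqP; lra.
Qed.

Lemma ip_swap (F G : 'I_d * 'I_d -> pt -> R) :
  ip Om (fun ij => F (ij.2, ij.1)) (fun ij => G (ij.2, ij.1)) = ip Om F G.
Proof.
rewrite /ip -!(sum_pairE (fun ij => ipr Om (F ij) (G ij))) exchange_big/=.
by rewrite -(sum_pairE (fun ij => ipr Om (F (ij.2, ij.1)) (G (ij.2, ij.1)))).
Qed.

Lemma ipf_Zr (I : finType) (F G : I -> pt -> R) (k : R) : L2f Om F -> L2f Om G ->
  ip Om F (fun i x => k * G i x) = k * ip Om F G.
Proof.
by move=> LF LG; rewrite /ip mulr_sumr; apply: eq_bigr => i _; rewrite iprC iprZl// iprC.
Qed.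

(** A symmetric family does not see the antisymmetric part of the gradient: transposing the index
    pairs shows that both halves of [Sv] contribute equally. *)
Lemma ip_sym_Sv (F : 'I_d * 'I_d -> pt -> R) w : L2f Om F ->
  (forall ij, F (ij.2, ij.1) = F ij) -> Hkv 1 Om w ->
  ip Om F (Sv Om w) = ip Om F (Dv Om w).
Proof.
move=> LF symF hw; have LD := L2_Dv hw.
have LD' : L2f Om (fun ij => Dv Om w (ij.2, ij.1)) by move=> ij; exact: LD.
rewrite ipf_Zr//; last exact: L2fD.
rewrite ipDr// -[ip Om F (fun ij => Dv Om w (ij.2, ij.1))]ip_swap.
rewrite (_ : (fun ij => F (ij.2, ij.1)) = F); last exact/funext.
rewrite (_ : (fun ij => Dv Om w _) = Dv Om w); last by apply/funext => -[].
by field.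
Qed.

Lemma SvC v ij : Sv Om v (ij.2, ij.1) = Sv Om v ij.
Proof. by apply/funext => x; rewrite /Sv /= addrC; case: ij. Qed.

Lemma ip_SvDv v : Hkv 1 Om v ->
  2 * ip Om (Sv Om v) (Sv Om v) =
  ip Om (Dv Om v) (Dv Om v) + ip Om (fun ij => Dv Om v (ij.2, ij.1)) (Dv Om v).
Proof.
move=> hv; have LS := L2_Sv oOm hv; have LD := L2_Dv hv.
have LD' : L2f Om (fun ij => Dv Om v (ij.2, ij.1)) by move=> ij; exact: LD.
rewrite (ip_sym_Sv LS (SvC v) hv) ipC ipf_Zr//; last exact: L2fD.
by rewrite ipC ipDl//; field.
Qed.

Lemma ip_Sv_le v : Hkv 1 Om v ->
  ip Om (Sv Om v) (Sv Om v) <= ip Om (Dv Om v) (Dv Om v).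
Proof.
move=> hv; have LD := L2_Dv hv.
have LD' : L2f Om (fun ij => Dv Om v (ij.2, ij.1)) by move=> ij; exact: LD.
have h2 : (0 : R) < 2^-1 by rewrite invr_gt0.
have := ip_young mOm h2 LD' LD; have := ip_SvDv hv.
rewrite ip_swap (_ : 4 / 2 = 2 :> R); last by field.
by lra.
Qed.

(** By [ip_SvDv], twice the symmetric part is the full gradient norm plus the product of the
    gradient with its transpose. Swapping derivatives identifies that product with the square norm
    of the divergence. *)
Lemma korn v : H10v Om v -> ip Om (Dv Om v) (Dv Om v) <= 2 * ip Om (Sv Om v) (Sv Om v).
Proof.
move=> hv; have hv1 := H10v_Hkv hv; rewrite (ip_SvDv hv1) lerDl.
have Ld := L2_divergence hv1; have LD := L2_Dv hv1.
rewrite (_ : ip _ _ _ = ipr Om (divergence Om v) (divergence Om v)); first exact: ipr_ge0.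
rewrite {1}divergenceE ipr_suml//.
rewrite /ip -(sum_pairE (fun ij => ipr Om (Dv Om v (ij.2, ij.1)) (Dv Om v ij))).
apply: eq_bigr => i _; rewrite [RHS]iprC divergenceE ipr_suml//.
apply: eq_bigr => j _ /=; rewrite [RHS]iprC.
by rewrite [LHS]iprC; exact: H10_swap.
Qed.

(** The continuity equation is tested only with mean-zero functions. The divergence of [u] is one,
    by integration by parts against the constant 1, and testing with it and the zero velocity makes
    its norm vanish. *)
Lemma H10div0_of_oseen f u p : L2v Om f -> oseen_solution Om a nu f u p -> H10div0 Om u.
Proof.
move=> Lf [hu [Lp _] H]; split => //; have hu1 := H10v_Hkv hu.
have Ld := L2_divergence hu1.
have h1 : Hk 1 Om (fun=> 1 : R) by exact: Hk1_cst.
pose z : pt -> pt := fun=> 0.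
have zE i : coordf z i = (fun=> 0) by apply/funext => x; rewrite /coordf mxE.
have hz : H10v Om z by move=> i; rewrite zE; apply: H10_test => //; exact: test_fun0.
have hz1 := H10v_Hkv hz.
have Dz ij : Dv Om z ij = (fun=> 0) %[ae mu in Om] by rewrite /Dv zE; exact: wpartial_cst.
have q0 : L20 Om (divergence Om u).
  split => //; have := bform_ibp hu h1.
  rewrite /bform /ipr (@eq_Rintegral _ _ _ mu Om (divergence Om u)); last first.
    by move=> x _; rewrite mulr1.
  move=> ->; apply/eqP; rewrite oppr_eq0; apply/eqP; apply: big1 => i _.
  have Li := Hk_L2 (hu1 i); have LG := L2_Gq h1 i.
  rewrite -[RHS](ipr0l Om (coordf u i)) [RHS]iprC.
  apply: ipr_ae => //; [exact: L20f|exact: aeW|exact: wpartial_cst].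
have := H z (divergence Om u) hz q0.
rewrite cformE// ?kformE//; last by move=> i; exact: Hk_L2 (hz1 i).
have -> : ip Om (Av Om a u) (coordf z) = 0.
  by apply: big1 => i _; rewrite zE iprC ipr0l.
have -> : ip Om (Sv Om u) (Sv Om z) = 0.
  have LS := L2_Sv oOm hu1; rewrite (ip_sym_Sv LS (SvC u) hz1).
  apply: big1 => ij _; rewrite -[RHS](ipr0l Om (Sv Om u ij)) [RHS]iprC.
  by apply: ipr_ae => //; [exact: L2_Dv|exact: L20f|exact: aeW].
rewrite (bform_ae0 hz1 Lp); last first.
  have h : {ae mu, forall x, forall i, Om x -> Dv Om z (i, i) x = 0}.
    by apply: filter_forall => i; exact: (Dz (i, i)).
  by apply: filterS h => x h Ox; rewrite divergenceE big1// => i _; exact: h.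
rewrite iprvE//; last by move=> i; exact: Hk_L2 (hz1 i).
rewrite (_ : ip Om (coordf f) (coordf z) = 0); last first.
  by apply: big1 => i _; rewrite zE iprC ipr0l.
by rewrite mulr0 oppr0 !add0r /bform => h; exact: L2_ipr0.
Qed.

(** The momentum equation is tested with fields having a single nonzero component, a test function.
    Derivatives are moved back to the viscous stress and the pressure, and the fundamental lemma
    gives the equation for that component. *)
Lemma strong_form f u p : L2v Om f -> oseen_solution Om a nu f u p ->
  Hkv 2 Om u -> Hk 1 Om p ->
  eqf Om (fun i x => Av Om a u i x - visc_div Om nu u x 0 i + Gq Om p i x) (coordf f).
Proof.
move=> Lf [hu [Lp _] H] hu2 hp i; have hu1 := H10v_Hkv hu.
have LA := L2_Av a oOm hu1 i; have LV := L2_visc_div nu i oOm hu2.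
have LG := L2_Gq hp i; have Lfi : L2 Om (coordf f i) := Lf i.
pose F x := Av Om a u i x - visc_div Om nu u x 0 i + Gq Om p i x - coordf f i x.
suff : F = (fun=> 0) %[ae mu in Om].
  by apply: filterS => x + Ox => /(_ Ox) /eqP; rewrite subr_eq0 => /eqP.
have LAV : L2 Om (fun x => Av Om a u i x - visc_div Om nu u x 0 i) by exact: L2B.
have LAVG : L2 Om (fun x => Av Om a u i x - visc_div Om nu u x 0 i + Gq Om p i x) by exact: L2D.
have LF : L2 Om F by exact: L2B.
apply: fundamental_lemma => // phi t.
pose w : pt -> pt := fun x => \row_k (if k == i then phi x else 0).
have wE k : coordf w k = if k == i then phi else (fun=> 0).
  by apply/funext => x; rewrite /coordf mxE; case: ifP.
have hw : H10v Om w.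
  move=> k; rewrite wE; case: ifP => _; apply: H10_test => //; exact: test_fun0.
have hw1 := H10v_Hkv hw.
have Lw : L2v Om w by move=> k; exact: Hk_L2 (hw1 k).
have Lphi : L2 Om phi by exact: test_fun_L2 t.
have Ldphi k : L2 Om (partial k phi) by exact: test_fun_L2 (test_fun_partial k t).
have ipw (G : 'I_d -> pt -> R) : ip Om G (coordf w) = ipr Om (G i) phi.
  rewrite /ip (bigD1 i)//= wE eqxx big1 ?addr0// => k ki.
  by rewrite wE (negbTE ki) iprC ipr0l.
have z0 : L20 Om (fun=> 0 : R).
  split; first exact: L20f.
  by rewrite /Rintegral integral0.
have := H w (fun=> 0) hw z0.
rewrite cformE// kformE// iprvE// !ipw.
rewrite (_ : bform Om u _ = 0); last by rewrite /bform iprC ipr0l.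
rewrite bform_ibp// [ip Om (coordf w) _]ipC ipw addr0 opprK.
have LS := L2_Sv oOm hu1.
rewrite (ip_sym_Sv LS (SvC u) hw1).
have -> : ip Om (Sv Om u) (Dv Om w) = \sum_j ipr Om (Sv Om u (i, j)) (partial j phi).
  rewrite /ip -(sum_pairE (fun ij => ipr Om (Sv Om u ij) (Dv Om w ij))) (bigD1 i)//=.
  rewrite [X in _ + X]big1 ?addr0.
    apply: eq_bigr => j _; apply: ipr_ae => //; first exact: L2_Dv.
      exact: aeW.
    by rewrite /Dv/= wE eqxx; exact: wpartial_test.
  move=> k ki; apply: big1 => j _.
  rewrite -[RHS](ipr0l Om (Sv Om u (k, j))) [RHS]iprC.
  apply: ipr_ae => //; [exact: L2_Dv|exact: L20f|exact: aeW|].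
  by rewrite /Dv/= wE (negbTE ki); exact: wpartial_cst.
have -> : 2 * nu * \sum_j ipr Om (Sv Om u (i, j)) (partial j phi) =
    - ipr Om (fun x => visc_div Om nu u x 0 i) phi.
  have Lw' j : L2 Om (wpartial Om j (fun y => ((2 * nu) *: sgrad Om u y) i j)).
    by case: (wderivP (is_wderiv_visc nu i j oOm hu2)).
  rewrite (_ : (fun x => visc_div _ _ _ _ _ _) = (fun x =>
    \sum_j wpartial Om j (fun y => ((2 * nu) *: sgrad Om u y) i j) x)); last first.
    by apply/funext => x; rewrite mxE.
  rewrite ipr_suml// -sumrN mulr_sumr; apply: eq_bigr => j _.
  rewrite -iprZl//.
  have := (wderivP (is_wderiv_visc nu i j oOm hu2)).2 _ t.
  rewrite mlen1 expr1 mulN1r (mpartial1 _ t) => <-.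
  by apply: eq_Rintegral => x _; rewrite mxE sgradE.
rewrite /F iprBl// iprDl// iprBl//.
set A := ipr _ _ _; set B := ipr _ _ _; set C := ipr _ _ _; set G := ipr _ _ _; lra.
Qed.

End consistency.

(** * Interpolation, inverse and energy estimates *)

Section estimates.
Context {R : realType} {d : nat}.
Local Notation pt := 'rV[R]_d.
Local Notation mu := (lebesgue_rV R d).
Hypothesis d0 : (0 < d)%N.
Variables (Om : set pt) (nu : R) (a : pt) (nel : nat) (E : 'I_nel -> set pt).
Hypotheses (oOm : open Om) (meshE : is_mesh Om E).
Let mOm : measurable Om := open_measurable_rV oOm.
Let oE : forall e, open (E e). Proof. by move=> e; exact: (mesh_open meshE). Qed.
Let mE e : measurable (E e). Proof. by apply: open_measurable_rV; exact: oE. Qed.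
Let EOm e : E e `<=` Om. Proof. exact: (mesh_sub meshE). Qed.
Implicit Types (v w : pt -> pt) (q r : pt -> R) (e : 'I_nel).

Lemma sum_addij (A B : 'I_d -> R) :
  \sum_i \sum_j (A i + B j) = d%:R * \sum_i A i + d%:R * \sum_j B j.
Proof.
rewrite (eq_bigr (fun i => d%:R * A i + \sum_j B j)).
  by rewrite big_split/= -mulr_sumr sumr_const card_ord -[(\sum_j B j) *+ d]mulr_natl.
by move=> i _; rewrite big_split/= sumr_const card_ord mulr_natl.
Qed.

(** Young's inequality with weight 1/2 is applied to each pair of summands. *)
Lemma ipr_sum_le (D : set pt) (F : 'I_d -> pt -> R) : measurable D -> L2f D F ->
  ipr D (fun x => \sum_j F j x) (fun x => \sum_j F j x) <= d%:R * \sum_j ipr D (F j) (F j).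
Proof.
move=> mD LF; have LS : L2 D (fun x => \sum_j F j x) by exact: L2_sum.
rewrite (ipr_suml mD _ LF LS).
have h2 : (0 : R) < 2^-1 by rewrite invr_gt0.
have h i : ipr D (F i) (fun x => \sum_j F j x) <=
    \sum_j (2^-1 * ipr D (F i) (F i) + 2^-1 * ipr D (F j) (F j)).
  rewrite iprC (ipr_suml mD _ LF (LF i)); apply: ler_sum => j _.
  have := ipr_young mD h2 (LF i) (LF j); rewrite [ipr D (F j) (F i)]iprC.
  by rewrite (_ : (4 / 2)^-1 = 2^-1 :> R)//; field.
apply: (le_trans (ler_sum _ (fun i _ => h i))).
rewrite (sum_addij (fun i => 2^-1 * ipr D (F i) (F i)) (fun j => 2^-1 * ipr D (F j) (F j))).
rewrite -mulr_sumr; set S := \sum_j ipr D (F j) (F j).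
by rewrite le_eqVlt; apply/orP; left; apply/eqP; field.
Qed.

Lemma ip_mesh (I : finType) (F G : I -> pt -> R) : L2f Om F -> L2f Om G ->
  ip Om F G = \sum_e ip (E e) F G.
Proof.
move=> LF LG; rewrite /ip exchange_big; apply: eq_bigr => i _.
exact: (ipr_mesh oOm meshE).
Qed.

Lemma L2_sub e q : L2 Om q -> L2 (E e) q.
Proof. exact: (L2S mOm (mE e) (@EOm e)). Qed.

Lemma wpartial_elem e q i : Hk 1 Om q -> ipr (E e) (wpartial Om i q) (wpartial Om i q) =
  ipr (E e) (wpartial (E e) i q) (wpartial (E e) i q).
Proof.
move=> hq; have hqe : Hk 1 (E e) q by apply: HkS hq; [exact: oOm|exact: oE|exact: EOm].
have L1 : L2 (E e) (wpartial Om i q) by apply: L2_sub; exact: L2_wpartial.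
have L2' := L2_wpartial i hqe.
have h : wpartial Om i q = wpartial (E e) i q %[ae mu in E e].
  apply: ae_eq_sym; rewrite /wpartial.
  apply: wderivS => //.
  by exists (wpartial Om i q); exact: Hk1_wpartial.
exact: ipr_ae.
Qed.

Lemma ip_coordf_le v : Hkv 1 Om v ->
  ip Om (coordf v) (coordf v) <= \sum_e hsemi2v 0 (E e) v.
Proof.
move=> hv; have Lv : L2f Om (coordf v) by exact: L2_coordf.
rewrite ip_mesh//; apply: ler_sum => e _; apply: ler_sum => i _.
by apply: hsemi20_ge => //; exact: L2_sub.
Qed.

(** Each of the d partial derivatives is bounded by the whole first-order semi-norm, hence the
    factor d. *)
Lemma ip_Gq_le q : Hk 1 Om q -> ip Om (Gq Om q) (Gq Om q) <= d%:R * \sum_e hsemi2 1 (E e) q.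
Proof.
move=> hq; have LG := L2_Gq hq; rewrite ip_mesh// mulr_sumr; apply: ler_sum => e _.
have -> : d%:R * hsemi2 1 (E e) q = \sum_(i < d) hsemi2 1 (E e) q.
  by rewrite sumr_const card_ord mulr_natl.
apply: ler_sum => i _; rewrite /Gq wpartial_elem//.
exact: hsemi21_ge.
Qed.

Lemma ip_Dv_le v : Hkv 1 Om v ->
  ip Om (Dv Om v) (Dv Om v) <= d%:R * \sum_e hsemi2v 1 (E e) v.
Proof.
move=> hv; rewrite (_ : ip _ _ _ = \sum_i ip Om (Gq Om (coordf v i)) (Gq Om (coordf v i))).
  rewrite /hsemi2v [X in _ <= _ * X]exchange_big mulr_sumr; apply: ler_sum => i _.
  exact: ip_Gq_le.
by rewrite /ip -(sum_pairE (fun ij => ipr Om (Dv Om v ij) (Dv Om v ij))).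
Qed.

Lemma ip_Av_le v : Hkv 1 Om v ->
  ip Om (Av Om a v) (Av Om a v) <= d%:R * enorm a ^+ 2 * ip Om (Dv Om v) (Dv Om v).
Proof.
move=> hv; have LD := L2_Dv hv.
rewrite /ip -(sum_pairE (fun ij => ipr Om (Dv Om v ij) (Dv Om v ij))) mulr_sumr.
apply: ler_sum => i _.
have LF : L2f Om (fun j x => a 0 j * Dv Om v (i, j) x) by move=> j; exact: L2Z.
apply: (le_trans (ipr_sum_le mOm LF)); rewrite -mulrA ler_wpM2l// mulr_sumr.
apply: ler_sum => j _; rewrite iprZl// iprC iprZl// mulrA -expr2.
rewrite ler_wpM2r ?ipr_ge0// /enorm sqr_sqrtr ?sumr_ge0// => [|k _]; last exact: sqr_ge0.
by rewrite (bigD1 j)//= lerDl sumr_ge0// => k _; exact: sqr_ge0.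
Qed.

Lemma visc_comp_le e v i j : Hkv 2 (E e) v ->
  ipr (E e) (visc_comp (E e) nu v i j) (visc_comp (E e) nu v i j) <=
  nu ^+ 2 * (2 * hsemi2 2 (E e) (coordf v i) + 2 * hsemi2 2 (E e) (coordf v j)).
Proof.
move=> hv; set p := wderiv (E e) (midx2 j j) (coordf v i).
set q := wderiv (E e) (midx2 i j) (coordf v j).
have Lp : L2 (E e) p by case: (Hk_wderiv (hv i) (eq_leq (mlen2 j j))).
have Lq : L2 (E e) q by case: (Hk_wderiv (hv j) (eq_leq (mlen2 i j))).
have Lpq : L2 (E e) (fun x => p x + q x) by exact: L2D.
have -> : ipr (E e) (visc_comp (E e) nu v i j) (visc_comp (E e) nu v i j) =
    nu ^+ 2 * ipr (E e) (fun x => p x + q x) (fun x => p x + q x).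
  have Ln := L2Z (mE e) nu Lpq.
  by rewrite -/(visc_comp _ _ _ _ _) (iprZl (mE e) nu Lpq Ln) iprC (iprZl (mE e) nu Lpq Lpq) mulrA.
rewrite ler_wpM2l ?sqr_ge0//.
have hp := hsemi2_ge (E e) (coordf v i) (mlen2 j j).
have hq := hsemi2_ge (E e) (coordf v j) (mlen2 i j).
have h2 : (0 : R) < 2^-1 by rewrite invr_gt0.
have := ipr_young (mE e) h2 Lp Lq; rewrite (_ : (4 / 2)^-1 = 2^-1 :> R); last by field.
rewrite (iprDl (mE e) Lp Lq Lpq) (iprC (E e) p (fun x => p x + q x)) (iprDl (mE e) Lp Lq Lp).
rewrite (iprC (E e) q (fun x => p x + q x)) (iprDl (mE e) Lp Lq Lq).
rewrite [ipr _ q p]iprC; move: hp hq; rewrite -/p -/q.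
move: (ipr (E e) p p) (ipr (E e) q q) (ipr (E e) p q).
move: (hsemi2 2 (E e) (coordf v i)) (hsemi2 2 (E e) (coordf v j)) => s t x y z.
lra.
Qed.

(** One factor d comes from summing over j in each component, by [ipr_sum_le]. The double sum of
    [2 h_i + 2 h_j], with h_i the second-order semi-norm of the i-th component, gives the remaining
    4d. *)
Lemma ip_Vv_le v : goodv Om E v ->
  ip Om (Vv nu E v) (Vv nu E v) <=
  4 * d%:R ^+ 2 * nu ^+ 2 * \sum_e hsemi2v 2 (E e) v.
Proof.
move=> gv; have LV := L2_Vv nu oOm meshE gv.
rewrite ip_mesh// mulr_sumr; apply: ler_sum => e _.
have hv : Hkv 2 (E e) v by case: gv.
have oe : open (E e) by exact: oE.
have LC i j := L2_visc_comp nu i j oe hv.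
have h i : ipr (E e) (Vv nu E v i) (Vv nu E v i) <=
    d%:R * \sum_j ipr (E e) (visc_comp (E e) nu v i j) (visc_comp (E e) nu v i j).
  pose G e x := visc_div (E e) nu v x 0 i.
  rewrite /Vv -(ipr_glue meshE G) iprC -(ipr_glue meshE G) /G.
  have Lv := L2_visc_div nu i oe hv.
  have ae := visc_divE d0 nu i oe hv.
  have LS : L2 (E e) (fun x => \sum_j visc_comp (E e) nu v i j x) by exact: L2_sum.
  by rewrite (ipr_ae (mE e) Lv LS Lv LS ae ae); exact: ipr_sum_le.
apply: (@le_trans _ _ (\sum_i d%:R * \sum_j (nu ^+ 2 * (2 * hsemi2 2 (E e) (coordf v i) +
    2 * hsemi2 2 (E e) (coordf v j))))).
  apply: ler_sum => i _; apply: (le_trans (h i)); rewrite ler_wpM2l//.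
  by apply: ler_sum => j _; exact: visc_comp_le.
rewrite /hsemi2v; set S := \sum_i _ (coordf v i).
rewrite -mulr_sumr; under eq_bigr do rewrite -mulr_sumr.
rewrite -mulr_sumr (sum_addij (fun i => 2 * hsemi2 2 (E e) (coordf v i))
  (fun j => 2 * hsemi2 2 (E e) (coordf v j))) -mulr_sumr -/S.
by rewrite le_eqVlt; apply/orP; left; apply/eqP; ring.
Qed.

End estimates.

(** * Inverse estimate and energy estimate for the stabilized form *)

Section stabilization.
Context {R : realType} {d : nat}.
Local Notation pt := 'rV[R]_d.
Local Notation mu := (lebesgue_rV R d).
Hypothesis d0 : (0 < d)%N.
Variables (Om : set pt) (nu : R) (a : pt) (nel : nat) (E : 'I_nel -> set pt).
Hypotheses (oOm : open Om) (meshE : is_mesh Om E) (nu0 : 0 < nu).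
Variable tauM : pt -> R.
Hypothesis mtau : measurable_fun Om tauM.
Hypothesis tau0 : forall x, Om x -> 0 < tauM x.
Variable T : R.
Hypotheses (T0 : 0 <= T) (tauT : {ae mu, forall x, Om x -> tauM x <= T}).
Let mOm : measurable Om := open_measurable_rV oOm.
Let oE : forall e, open (E e). Proof. by move=> e; exact: (mesh_open meshE). Qed.
Let mE e : measurable (E e). Proof. by apply: open_measurable_rV; exact: oE. Qed.
Let EOm e : E e `<=` Om. Proof. exact: (mesh_sub meshE). Qed.
Implicit Types (v w : pt -> pt) (q r : pt -> R) (e : 'I_nel).

Lemma diam_ge0 (A : set pt) : 0 <= diam A.
Proof.
rewrite /diam; set S := [set _ | _ in _].
(* A set without supremum has the default supremum 0. *)
have [hs|hs] := pselect (has_sup S); last by rewrite sup_out.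
have [[y Sy] ub] := hs; apply: (@le_trans _ _ y).
  by case: Sy => xy _ <-; exact: sqrtr_ge0.
by apply: sup_upper_bound.
Qed.

Lemma enorm_gt0 (x : pt) : x != 0 -> 0 < enorm x.
Proof.
move=> x0; rewrite sqrtr_gt0.
have [i xi] : exists i, x 0 i != 0.
  apply/existsP; apply: contraNT x0; rewrite negb_exists => /forallP h.
  by apply/eqP/rowP => i; rewrite mxE; apply/eqP; have := h i; rewrite negbK.
rewrite (bigD1 i)//= ltr_pwDl// ?exprn_even_gt0// sumr_ge0// => j _.
exact: sqr_ge0.
Qed.

Section inverse_estimate.
Variables (Cinv : R) (hC : 0 < Cinv).
Hypothesis tau_le : forall e x, E e x -> tauM x <= diam (E e) ^+ 2 / (Cinv * nu).

(** Read off from assumption (ii): a zero diameter would force the positive parameter to be at most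
    0 on a nonempty element. *)
Lemma diam_gt0 e : 0 < diam (E e).
Proof.
have [[x Ex]] : E e !=set0 by have [/(_ e)[]] := meshE.
have Cn : 0 < Cinv * nu by rewrite mulr_gt0.
have := lt_le_trans (tau0 (EOm Ex)) (tau_le Ex).
rewrite pmulr_lgt0 ?invr_gt0// => h; rewrite lt_neqAle diam_ge0 andbT eq_sym.
by apply: contraTneq h => ->; rewrite expr0n ltxx.
Qed.

(** On each element the bound h_e^2 / (Cinv nu) of tau cancels the factor Cinv / h_e^2 of the
    inverse inequality, leaving 1/nu times the norm of nu times the symmetric gradient. The result
    is half of k(v, v), small enough for coercivity. *)
Lemma inverse_bound v : goodv Om E v ->
  (forall e, iprv (E e) (visc_div (E e) nu v) (visc_div (E e) nu v) <=
     Cinv / diam (E e) ^+ 2 *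
     iprm (E e) (fun x => nu *: sgrad (E e) v x) (fun x => nu *: sgrad (E e) v x)) ->
  ip Om (scalef (sqtau tauM) (Vv nu E v)) (scalef (sqtau tauM) (Vv nu E v)) <=
  nu * ip Om (Sv Om v) (Sv Om v).
Proof.
move=> gv inv; have hv := gv.1.
have LV := L2_Vv nu oOm meshE gv; have LS := L2_Sv oOm hv.
have ms := measurable_sqtau mtau.
pose Te e := diam (E e) ^+ 2 / (Cinv * nu).
have Te0 e : 0 < Te e by rewrite divr_gt0 ?mulr_gt0 ?exprn_gt0 ?diam_gt0.
have se e : {ae mu, forall x, E e x -> `|sqtau tauM x| <= Num.sqrt (Te e)}.
  apply: aeW => x Ex; rewrite ger0_norm ?sqrtr_ge0// ler_wsqrtr//.
  exact: tau_le.
have mse e : measurable_fun (E e) (sqtau tauM) by apply: measurable_funS ms.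
have LVe e : L2f (E e) (Vv nu E v) by move=> i; exact: (L2_sub oOm meshE).
have LSe e : L2f (E e) (Sv Om v) by move=> i; exact: (L2_sub oOm meshE).
have LsV : L2f Om (scalef (sqtau tauM) (Vv nu E v)).
  exact: (L2_sqtau oOm mtau tauT).
rewrite (ip_mesh oOm meshE)// (ip_mesh oOm meshE)// mulr_sumr; apply: ler_sum => e _.
apply: (le_trans (ip_scalef (mE e) (mse e) (se e) (LVe e))).
rewrite sqr_sqrtr; last exact: ltW.
have hve : Hkv 2 (E e) v by case: gv.
have -> : ip (E e) (Vv nu E v) (Vv nu E v) =
    iprv (E e) (visc_div (E e) nu v) (visc_div (E e) nu v).
  rewrite iprvE//; try by move=> i; exact: L2_visc_div.
  apply: eq_bigr => i _; pose G e x := visc_div (E e) nu v x 0 i.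
  by rewrite /Vv -(ipr_glue meshE G) iprC -(ipr_glue meshE G).
have -> : ip (E e) (Sv Om v) (Sv Om v) = nu ^- 2 *
    iprm (E e) (fun x => nu *: sgrad (E e) v x) (fun x => nu *: sgrad (E e) v x).
  have hv1 k : Hk 1 (E e) (coordf v k) by exact: Hk_le (hve k).
  have LSg i j : L2 (E e) (fun x => (nu *: sgrad (E e) v x) i j).
    rewrite (_ : (fun x => _) = (fun x => nu * (2^-1 * (wpartial (E e) j (coordf v i) x +
      wpartial (E e) i (coordf v j) x)))); last by apply/funext => x; rewrite !mxE.
    by do 2 apply: L2Z => //; apply: L2D => //; exact: L2_wpartial.
  have LSg' (ij : 'I_d * 'I_d) := LSg ij.1 ij.2.
  rewrite iprmE// /ip mulr_sumr; apply: eq_bigr => -[i j] _ /=.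
  have aeS : (fun x => nu * Sv Om v (i, j) x) =
      (fun x => (nu *: sgrad (E e) v x) i j) %[ae mu in E e].
    have k1 : wpartial (E e) j (coordf v i) = wpartial Om j (coordf v i) %[ae mu in E e].
      by apply: wderivS => //; exists (wpartial Om j (coordf v i)); exact: Hk1_wpartial.
    have k2 : wpartial (E e) i (coordf v j) = wpartial Om i (coordf v j) %[ae mu in E e].
      by apply: wderivS => //; exists (wpartial Om i (coordf v j)); exact: Hk1_wpartial.
    by apply: filterS2 k1 k2 => x + + Ex; rewrite /Sv /Dv /= !mxE => /(_ Ex) -> /(_ Ex) ->.
  have Lns : L2 (E e) (fun x => nu * Sv Om v (i, j) x).
    exact: (L2Z (mE e) nu (LSe e (i, j))).
  have := ipr_ae (mE e) Lns (LSg i j) Lns (LSg i j) aeS aeS.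
  rewrite (iprZl (mE e) nu (LSe e (i, j)) Lns) iprC (iprZl (mE e) nu (LSe e (i, j)) (LSe e (i, j))).
  by move=> <-; field; rewrite gt_eqF.
apply: (@le_trans _ _ (Te e * (Cinv / diam (E e) ^+ 2 *
     iprm (E e) (fun x => nu *: sgrad (E e) v x) (fun x => nu *: sgrad (E e) v x)))).
  by rewrite ler_wpM2l// ltW.
set J := iprm _ _ _.
rewrite le_eqVlt; apply/orP; left; apply/eqP; rewrite /Te.
have hd := diam_gt0 e.
by field; rewrite !gt_eqF.
Qed.

End inverse_estimate.

(** [kZ] and [Y] are the viscous and the tau-weighted part of the norm of (xi, xip); [kN], [Nn],
    [VN] are quantities of (eta, etap), and [s1] to [s4] are cross terms. The left side keeps at
    least 3/4 [kZ] + 1/2 [Y], the right side takes 1/4 [kZ] + 1/4 [Y], and what remains is at least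
    a quarter of [kZ + Y]. *)
Lemma energy_arith (kN kZ Y Nn VN VX C0 C1 s1 s2 s3 s4 : R) :
  kZ + (Y - s1) = C0 + s2 + (s3 - s4) ->
  s1 <= 2^-1 * Y + 2^-1 * VX -> VX <= kZ / 2 ->
  s2 <= 2 * kN + 8^-1 * kZ -> s3 <= 4 * Nn + 16^-1 * Y ->
  - s4 <= 4 * VN + 16^-1 * Y -> C0 <= kZ / 8 + Y / 8 + C1 ->
  0 <= kZ -> 0 <= Y ->
  kZ + Y <= 4 * (C1 + 2 * kN + 4 * Nn + 4 * VN).
Proof. by move=> *; lra. Qed.

Lemma scale_arith (n X A B : R) : 0 <= n -> X <= 2 * A + 2 * B ->
  n * X <= 2 * (n * A) + 2 * (n * B).
Proof.
move=> n0 h; rewrite (_ : _ + _ = n * (2 * A + 2 * B)); last by ring.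
exact: ler_wpM2l.
Qed.

(** The triangle inequality doubles everything, so the coefficients are 18 = 2 + 8*2, 34 = 2 + 8*4,
    8 and 32 = 8*4. *)
Lemma total_arith (X Y k1 k2 n1 n2 c1 v1 : R) : X <= 2 * k1 + 2 * k2 ->
  Y <= 2 * n1 + 2 * n2 -> k2 + n2 <= 4 * (c1 + 2 * k1 + 4 * n1 + 4 * v1) ->
  X + Y <= 18 * k1 + 34 * n1 + 8 * c1 + 32 * v1.
Proof. by move=> *; lra. Qed.

(** The bound on the advective term of eta against xi enters as a hypothesis with an unspecified
    remainder [C1], so that the diffusive and the convective regime share this estimate. *)
Lemma energy_estimate eta xi etap xip (C1 : R) :
  goodv Om E eta -> goodv Om E xi -> Hk 1 Om etap -> Hk 1 Om xip ->
  let s := sqtau tauM in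
  let S2 v := 2 * nu * ip Om (Sv Om v) (Sv Om v) in
  let N2 (F : 'I_d -> pt -> R) := ip Om (scalef s F) (scalef s F) in
  ip Om (Av Om a eta) (coordf xi) + 2 * nu * ip Om (Sv Om eta) (Sv Om xi) +
    ip Om (fun i x => Av Om a eta i x - Vv nu E eta i x + Gq Om etap i x)
      (scalef tauM (Yv Om a xi xip)) =
  ip Om (Av Om a xi) (coordf xi) + 2 * nu * ip Om (Sv Om xi) (Sv Om xi) +
    ip Om (fun i x => Av Om a xi i x - Vv nu E xi i x + Gq Om xip i x)
      (scalef tauM (Yv Om a xi xip)) ->
  ip Om (Av Om a xi) (coordf xi) = 0 ->
  N2 (Vv nu E xi) <= nu * ip Om (Sv Om xi) (Sv Om xi) ->
  ip Om (Av Om a eta) (coordf xi) <= S2 xi / 8 + N2 (Yv Om a xi xip) / 8 + C1 ->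
  tnorm2 Om a nu tauM (eta - xi) (etap - xip) <=
    18 * S2 eta + 34 * N2 (Yv Om a eta etap) + 8 * C1 + 32 * N2 (Vv nu E eta).
Proof.
move=> ge gx he hx s S2 N2 hB hskew hinv hC0.
have [he1 hx1] := (ge.1, gx.1).
have L2s (F : 'I_d -> pt -> R) : L2f Om F -> L2f Om (scalef s F).
  exact: (L2_sqtau oOm mtau tauT).
have Ly : L2f Om (Yv Om a xi xip) by exact: L2_Yv.
have Ln : L2f Om (Yv Om a eta etap) by exact: L2_Yv.
have [LVx LVe] := (L2_Vv nu oOm meshE gx, L2_Vv nu oOm meshE ge).
have Lty : L2f Om (scalef tauM (Yv Om a xi xip)) by exact: (L2_tau oOm mtau tau0 tauT).
have [LSe LSx] := (L2_Sv oOm he1, L2_Sv oOm hx1).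
have e16 : (4 * 4)^-1 = 16^-1 :> R by field.
have e2 : (4 / 2)^-1 = 2^-1 :> R by field.
(* The residual is the quantity [Yv] measured by the norm minus the viscous term; only the latter
   spoils coercivity. *)
have split_res v q : goodv Om E v -> Hk 1 Om q ->
    ip Om (fun i x => Av Om a v i x - Vv nu E v i x + Gq Om q i x)
      (scalef tauM (Yv Om a xi xip)) =
    ip Om (scalef s (Yv Om a v q)) (scalef s (Yv Om a xi xip)) -
    ip Om (scalef s (Vv nu E v)) (scalef s (Yv Om a xi xip)).
  move=> gv hq; have LA := L2_Av a oOm gv.1; have LV := L2_Vv nu oOm meshE gv.
  have LG := L2_Gq hq.
  have LAV : L2f Om (fun i x => Av Om a v i x - Vv nu E v i x) by exact: L2fB.
  rewrite (ipDl mOm LAV LG Lty) (ipBl mOm LA LV Lty).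
  by rewrite -!(ip_sqtau tau0) (ipDl mOm LA LG Lty) addrAC.
have n0 : 0 < 2 * nu by rewrite mulr_gt0.
have hS : 0 <= S2 xi := mulr_ge0 (ltW n0) (ip_ge0 Om (Sv Om xi)).
have hY := ip_ge0 Om (scalef s (Yv Om a xi xip)).
rewrite (split_res _ _ ge he) (split_res _ _ gx hx) hskew add0r in hB.
have key : S2 xi + N2 (Yv Om a xi xip) <= 4 * (C1 + 2 * S2 eta +
    4 * N2 (Yv Om a eta etap) + 4 * N2 (Vv nu E eta)).
  apply: (@energy_arith (S2 eta) (S2 xi) (N2 (Yv Om a xi xip)) (N2 (Yv Om a eta etap))
    (N2 (Vv nu E eta)) (N2 (Vv nu E xi)) (ip Om (Av Om a eta) (coordf xi)) C1
    (ip Om (scalef s (Vv nu E xi)) (scalef s (Yv Om a xi xip)))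
    (2 * nu * ip Om (Sv Om eta) (Sv Om xi))
    (ip Om (scalef s (Yv Om a eta etap)) (scalef s (Yv Om a xi xip)))
    (ip Om (scalef s (Vv nu E eta)) (scalef s (Yv Om a xi xip))) (esym hB) _ _ _ _ _ hC0 hS hY).
  - have h : (0 : R) < 2^-1 by rewrite invr_gt0.
    have := ip_young mOm h (L2s _ LVx) (L2s _ Ly).
    by rewrite e2 addrC; apply.
  - apply: le_trans hinv _; rewrite /S2; move: (ip Om (Sv Om xi) _) => z.
    by rewrite le_eqVlt; apply/orP; left; apply/eqP; field.
  - have h : (0 : R) < 2 by [].
    have := ip_young mOm h LSe LSx; rewrite -(ler_pM2l n0) /S2 => h'.
    apply: le_trans h' _; rewrite le_eqVlt; apply/orP; left; apply/eqP.
    by move: (ip Om (Sv Om xi) _) (ip Om (Sv Om eta) _) => z z'; field.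
  - have h : (0 : R) < 4 by [].
    have := ip_young mOm h (L2s _ Ln) (L2s _ Ly).
    by rewrite e16; apply.
  - have h : (0 : R) < 4 by [].
    have := ip_youngN mOm h (L2s _ LVe) (L2s _ Ly).
    by rewrite e16; apply.
rewrite (tnorm2E nu a oOm mtau tau0 tauT); last first.
- exact: HkB.
- by have [] := goodvB oOm meshE ge gx.
have E1 : ip Om (Sv Om (eta - xi)) (Sv Om (eta - xi)) <=
    2 * ip Om (Sv Om eta) (Sv Om eta) + 2 * ip Om (Sv Om xi) (Sv Om xi).
  have gex := goodvB oOm meshE ge gx.
  have LD := L2_Sv oOm gex.1; have LB := L2fB mOm LSe LSx.
  have ae := SvB d0 oOm he1 hx1.
  rewrite (ip_ae mOm LD LB LD LB ae ae).
  exact: (ip_B2 mOm LSe LSx).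
have E2 : ip Om (scalef s (Yv Om a (eta - xi) (etap - xip)))
      (scalef s (Yv Om a (eta - xi) (etap - xip))) <=
    2 * N2 (Yv Om a eta etap) + 2 * N2 (Yv Om a xi xip).
  have gex := goodvB oOm meshE ge gx.
  have hex : Hk 1 Om (etap - xip) by exact: HkB.
  have LD := L2s _ (L2_Yv a oOm gex.1 hex).
  have LB := L2fB mOm (L2s _ Ln) (L2s _ Ly).
  have ae : eqf Om (scalef s (Yv Om a (eta - xi) (etap - xip)))
     (fun i x => scalef s (Yv Om a eta etap) i x - scalef s (Yv Om a xi xip) i x).
    move=> i; have h := YvB d0 a oOm he1 hx1 he hx i.
    by apply: filterS h => x + Ox => /(_ Ox) h; rewrite /scalef h mulrBr.
  rewrite (ip_ae mOm LD LB LD LB ae ae).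
  exact: (ip_B2 mOm (L2s _ Ln) (L2s _ Ly)).
have E1' : 2 * nu * ip Om (Sv Om (eta - xi)) (Sv Om (eta - xi)) <= 2 * S2 eta + 2 * S2 xi.
  exact: (scale_arith (ltW n0) E1).
exact: (total_arith E1' E2 key).
Qed.

End stabilization.

(** * The advective term in the two regimes and Galerkin orthogonality *)

Section galerkin.
Context {R : realType} {d : nat}.
Local Notation pt := 'rV[R]_d.
Local Notation mu := (lebesgue_rV R d).
Hypothesis d0 : (0 < d)%N.
Variables (Om : set pt) (nu : R) (a : pt) (nel : nat) (E : 'I_nel -> set pt).
Hypotheses (oOm : open Om) (bOm : bounded_set Om) (meshE : is_mesh Om E) (nu0 : 0 < nu).
Variable tauM : pt -> R.
Hypothesis mtau : measurable_fun Om tauM.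
Hypothesis tau0 : forall x, Om x -> 0 < tauM x.
Variable T : R.
Hypotheses (T0 : 0 <= T) (tauT : {ae mu, forall x, Om x -> tauM x <= T}).
Let mOm : measurable Om := open_measurable_rV oOm.
Implicit Types (v w : pt -> pt) (q r : pt -> R) (e : 'I_nel).

Lemma young_inv4 (k : R) : 0 < k -> (4 * (2 * k))^-1 = 8^-1 / k.
Proof. by move=> k0; field; rewrite gt_eqF. Qed.

Lemma diffusive_arith (C A S k : R) : 0 < k -> C <= 2 * k * A + (4 * (2 * k))^-1 * S ->
  forall s, S <= k * s -> C <= s / 8 + 2 * k * A.
Proof.
move=> k0 h s hs; apply: (le_trans h); rewrite addrC lerD2r young_inv4//.
have -> : s / 8 = 8^-1 / k * (k * s) by field; rewrite gt_eqF.
by rewrite ler_wpM2l// divr_ge0// ltW.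
Qed.

(** The Young weight 2 d |a|^2 / nu is chosen so that the term in a . grad xi, bounded through
    Korn's inequality, becomes exactly one eighth of k(xi, xi). *)
Lemma advection_diffusive eta xi : a != 0 -> Hkv 1 Om eta -> H10v Om xi ->
  ip Om (Av Om a eta) (coordf xi) <= 2 * nu * ip Om (Sv Om xi) (Sv Om xi) / 8 +
    2 * (d%:R * enorm a ^+ 2 / nu) * ip Om (coordf eta) (coordf eta).
Proof.
move=> a0 he hx; have hx1 := H10v_Hkv hx.
rewrite (cform_ibp d0 a oOm hx he).
have k0 : 0 < d%:R * enorm a ^+ 2 / nu.
  by rewrite divr_gt0// mulr_gt0 ?ltr0n// exprn_gt0// enorm_gt0.
have t0 : 0 < 2 * (d%:R * enorm a ^+ 2 / nu) by rewrite mulr_gt0.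
have h := ip_youngN mOm t0 (L2_coordf he) (L2_Av a oOm hx1).
apply: (diffusive_arith k0 h).
apply: (le_trans (ip_Av_le a oOm hx1)).
have hk := ler_wpM2l (ltW k0) (korn d0 oOm hx).
have -> : d%:R * enorm a ^+ 2 / nu * (2 * nu * ip Om (Sv Om xi) (Sv Om xi)) =
  nu * (d%:R * enorm a ^+ 2 / nu * (2 * ip Om (Sv Om xi) (Sv Om xi))).
  by move: (ip Om _ _) => z; ring.
have -> : d%:R * enorm a ^+ 2 * ip Om (Dv Om xi) (Dv Om xi) =
  nu * (d%:R * enorm a ^+ 2 / nu * ip Om (Dv Om xi) (Dv Om xi)).
  by move: (ip Om _ _) => z; field; rewrite gt_eqF.
exact: (ler_wpM2l (ltW nu0) hk).
Qed.

Lemma convective_arith (C A Y M B : R) : C <= 2 * A + (4 * 2)^-1 * Y -> A <= M * B ->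
  C <= Y / 8 + 2 * M * B.
Proof.
move=> h1 h2; apply: (le_trans h1).
have -> : Y / 8 + 2 * M * B = 2 * (M * B) + (4 * 2)^-1 * Y by field.
by rewrite lerD2r ler_pM2l.
Qed.

(** Inserting the square root of tau and its inverse after integration by parts makes the factor of
    xi the weighted term of the norm; the price on eta is the bound [M] of 1/tau. *)
Lemma advection_convective eta xi xip (M : R) : 0 <= M ->
  {ae mu, forall x, Om x -> (tauM x)^-1 <= M} ->
  Hkv 1 Om eta -> H10v Om xi -> Hk 1 Om xip -> ip Om (coordf eta) (Gq Om xip) = 0 ->
  ip Om (Av Om a eta) (coordf xi) <=
    ip Om (scalef (sqtau tauM) (Yv Om a xi xip)) (scalef (sqtau tauM) (Yv Om a xi xip)) / 8 +
    2 * M * ip Om (coordf eta) (coordf eta).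
Proof.
move=> M0 tM he hx hxp orth; have hx1 := H10v_Hkv hx.
rewrite (cform_ibp d0 a oOm hx he).
have [Lc LA] := (L2_coordf he, L2_Av a oOm hx1).
have LG := L2_Gq hxp; have LY := L2_Yv a oOm hx1 hxp.
have hY : ip Om (coordf eta) (Av Om a xi) = ip Om (coordf eta) (Yv Om a xi xip).
  by rewrite /Yv (ipDr mOm LA LG Lc) orth addr0.
pose si x := (sqtau tauM x)^-1.
have msi : measurable_fun Om si.
  (* Measurability of the reciprocal is read off from the real power with exponent -1. *)
  rewrite (_ : si = (fun x => sqtau tauM x `^ (-1))).
    by apply: (measurableT_comp (measurable_powR _)); exact: measurable_sqtau.
  by apply/funext => x; rewrite powR_inv1// sqrtr_ge0.
have siM : {ae mu, forall x, Om x -> `|si x| <= Num.sqrt M}.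
  apply: filterS tM => x h Ox; rewrite /si /sqtau -sqrtrV; last by rewrite ltW// tau0.
  by rewrite ger0_norm ?sqrtr_ge0// ler_wsqrtr// h.
have Lsi := L2_scalef mOm msi siM Lc.
have LsY := L2_sqtau oOm mtau tauT LY.
have -> : ip Om (coordf eta) (Av Om a xi) =
    ip Om (scalef si (coordf eta)) (scalef (sqtau tauM) (Yv Om a xi xip)).
  rewrite hY; apply: eq_bigr => i _; apply: eq_Rintegral => x; rewrite inE => Ox.
  have s0 : sqtau tauM x != 0 by rewrite gt_eqF// sqrtr_gt0 tau0.
  by rewrite /scalef /si mulrACA mulVf// mul1r.
have t0 : (0 : R) < 2 by [].
have h1 := ip_youngN mOm t0 Lsi LsY.
have h2 := ip_scalef mOm msi siM Lc.
rewrite sqr_sqrtr// in h2.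
exact: (convective_arith h1 h2).
Qed.

Section residual.
Variables (xi : pt -> pt) (xip : pt -> R).
Hypotheses (hxi : H10v Om xi) (gxi : goodv Om E xi) (hxip : Hk 1 Om xip).

(* The form B((v, q), (xi, xip)), without grad-div and pressure terms since div xi = 0. *)
Definition resB v q : R := ip Om (Av Om a v) (coordf xi) +
  2 * nu * ip Om (Sv Om v) (Sv Om xi) +
  ip Om (fun i x => Av Om a v i x - Vv nu E v i x + Gq Om q i x)
     (scalef tauM (Yv Om a xi xip)).

Let Lc : L2f Om (coordf xi) := L2_coordf gxi.1.
Let LS : L2f Om (Sv Om xi) := L2_Sv oOm gxi.1.
Let LY : L2f Om (scalef tauM (Yv Om a xi xip)) :=
  L2_tau oOm mtau tau0 tauT (L2_Yv a oOm gxi.1 hxip).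

Lemma L2_res v q : goodv Om E v -> Hk 1 Om q ->
  L2f Om (fun i x => Av Om a v i x - Vv nu E v i x + Gq Om q i x).
Proof.
move=> gv hq; apply: L2fD => //; last exact: L2_Gq.
by apply: L2fB => //; [exact: L2_Av gv.1|exact: L2_Vv].
Qed.

Lemma resB_sub_arith (A B C A' B' C' k : R) :
  (A - A') + k * (B - B') + (C - C') = (A + k * B + C) - (A' + k * B' + C').
Proof. by ring. Qed.

Lemma res_sub_arith (A V G A1 V1 G1 A2 V2 G2 : R) :
  A = A1 - A2 -> V = V1 - V2 -> G = G1 - G2 ->
  A - V + G = (A1 - V1 + G1) - (A2 - V2 + G2).
Proof. by move=> -> -> ->; ring. Qed.

Lemma resB_sub v w q r : goodv Om E v -> goodv Om E w -> Hk 1 Om q -> Hk 1 Om r ->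
  resB (v - w) (q - r) = resB v q - resB w r.
Proof.
move=> gv gw hq hr; have gvw := goodvB oOm meshE gv gw.
have hqr : Hk 1 Om (q - r) by exact: HkB.
have [[Av1 Aw1] Avw] := (L2_Av a oOm gv.1, L2_Av a oOm gw.1, L2_Av a oOm gvw.1).
have [[Sv1 Sw1] Svw] := (L2_Sv oOm gv.1, L2_Sv oOm gw.1, L2_Sv oOm gvw.1).
have [[R1 R2] R3] := (L2_res gv hq, L2_res gw hr, L2_res gvw hqr).
have aeA := AvB d0 a oOm gv.1 gw.1.
have aeS := SvB d0 oOm gv.1 gw.1.
have aeV := VvB d0 nu meshE gv gw.
have aeG := GqB d0 oOm hq hr.
have aeR : eqf Om (fun i x => Av Om a (v - w) i x - Vv nu E (v - w) i x + Gq Om (q - r) i x)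
   (fun i x => (Av Om a v i x - Vv nu E v i x + Gq Om q i x) -
       (Av Om a w i x - Vv nu E w i x + Gq Om r i x)).
  move=> i; apply: filterS2 (filterI (aeA i) (aeV i)) (aeG i) => x [hA hV] hG Ox.
  exact: (res_sub_arith (hA Ox) (hV Ox) (hG Ox)).
have refl (I : finType) (F : I -> pt -> R) : eqf Om F F by move=> i; exact: aeW.
rewrite /resB.
rewrite (ip_ae mOm Avw (L2fB mOm Av1 Aw1) Lc Lc aeA (refl _ _)) (ipBl mOm Av1 Aw1 Lc).
rewrite (ip_ae mOm Svw (L2fB mOm Sv1 Sw1) LS LS aeS (refl _ _)) (ipBl mOm Sv1 Sw1 LS).
rewrite (ip_ae mOm R3 (L2fB mOm R1 R2) LY LY aeR (refl _ _)) (ipBl mOm R1 R2 LY).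
exact: resB_sub_arith.
Qed.

(** For a field that is H^2 on the whole domain, such as the exact velocity, the broken viscous term
    is the global one; this links the discrete residual to the strong form. *)
Lemma Vv_Om v : Hkv 2 Om v -> eqf Om (Vv nu E v) (fun i x => visc_div Om nu v x 0 i).
Proof.
move=> hv i; apply: (ae_mesh_in meshE) => e.
have oe : open (E e) by exact: (mesh_open meshE).
have sub : E e `<=` Om by exact: (mesh_sub meshE).
have h := visc_divS d0 nu i oOm oe sub hv.
apply: filterS h => x + Ex => /(_ Ex) h.
exact: (etrans (glueE meshE _ Ex) h).
Qed.

(** The Galerkin part is the exact problem tested with (xi, 0). The stabilization part is the strong
    equation integrated against the stabilized test function. *)
Lemma resB_exact f u p : L2v Om f -> oseen_solution Om a nu f u p -> Hkv 2 Om u ->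
  goodv Om E u -> Hk 1 Om p -> divergence Om xi = (fun=> 0) %[ae mu in Om] ->
  resB u p = iprv Om f xi + iprv Om f (stab_test Om a tauM xi xip).
Proof.
move=> Lf osol hu2 gu hp dxi; have [hu [Lp _] H] := osol.
have z0 : L20 Om (fun=> 0 : R).
  by split; [exact: L20f|rewrite /Rintegral integral0].
have := H xi (fun=> 0) hxi z0.
rewrite (cformE a oOm gu.1 Lc) (kformE nu oOm gu.1 gxi.1).
rewrite (bform_ae0 oOm gxi.1 Lp dxi) subr0.
rewrite (_ : bform Om u _ = 0); last by rewrite /bform iprC ipr0l.
rewrite addr0 /resB => ->; congr (_ + _).
rewrite iprvE//; last by move=> i; rewrite stab_testE; exact: LY.
have -> : coordf (stab_test Om a tauM xi xip) = scalef tauM (Yv Om a xi xip).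
  by apply/funext => i; exact: stab_testE.
have ae : eqf Om (fun i x => Av Om a u i x - Vv nu E u i x + Gq Om p i x) (coordf f).
  move=> i; have h1 := strong_form d0 oOm Lf osol hu2 hp i.
  apply: filterS2 h1 (Vv_Om hu2 i) => x h1 h2 Ox.
  exact: (etrans (congr1 (fun t => Av Om a u i x - t + Gq Om p i x) (h2 Ox)) (h1 Ox)).
have ae' : eqf Om (scalef tauM (Yv Om a xi xip)) (scalef tauM (Yv Om a xi xip)).
  by move=> i; exact: aeW.
exact: (ip_ae mOm (L2_res gu hp) Lf LY LY ae ae').
Qed.

Lemma resB_discrete Vh Qh Q' tauC f uh ph :
  measurable_fun Om tauC -> goodv Om E uh -> Hk 1 Om ph ->
  divergence Om xi = (fun=> 0) %[ae mu in Om] ->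
  Vh0 Om Vh Qh xi -> Qtilde Qh Q' xip ->
  reduced_solution Om a nu f E tauC tauM Vh Qh Q' uh ph ->
  resB uh ph = iprv Om f xi + iprv Om f (stab_test Om a tauM xi xip).
Proof.
move=> mC guh hph dxi Vxi Qxi [_ _ H]; rewrite -(H _ _ Vxi Qxi) /A_red.
rewrite (cformE a oOm guh.1 Lc) (kformE nu oOm guh.1 gxi.1).
rewrite (stabE nu a oOm meshE mtau tau0 tauT gxi.1 hxip guh hph).
(* The grad-div integrand vanishes almost everywhere with the divergence of xi. *)
rewrite (_ : ipr Om (fun x => tauC x * divergence Om uh x) _ = 0) ?addr0//.
rewrite /ipr -[RHS](_ : \int[mu]_(x in Om) (cst 0 x) = 0); last first.
  by rewrite /Rintegral integral0.
have md w : Hkv 1 Om w -> measurable_fun Om (divergence Om w).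
  by move=> hw; apply: L2_measurable => //; exact: L2_divergence.
apply: (eq_ae_Rintegral mOm).
- by apply: measurable_funM; [apply: measurable_funM => //; exact: md guh.1|exact: md gxi.1].
- exact: measurable_cst.
- by apply: filterS dxi => x h Ox; rewrite (h Ox) mulr0.
Qed.

End residual.
End galerkin.

(** * Discrete spaces and exactly divergence-free discrete fields *)

Section discrete_facts.
Context {R : realType} {d : nat}.
Local Notation pt := 'rV[R]_d.
Local Notation mu := (lebesgue_rV R d).
Hypothesis d0 : (0 < d)%N.
Variables (Om : set pt) (nel : nat) (E : 'I_nel -> set pt).
Hypothesis oOm : open Om.
Variables (Vh : set (pt -> pt)) (Qh Q' : set (pt -> R)).
Hypothesis disc : discrete_spaces Om E Vh Qh Q'.
Implicit Types (v w : pt -> pt) (q r : pt -> R).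

Lemma Vh_H10v v : Vh v -> H10v Om v.
Proof. by case: disc => _ [h _ _ _] _ _ _; exact: h. Qed.

Lemma Vh_good v : Vh v -> goodv Om E v.
Proof.
move=> Vv; split; first exact/H10v_Hkv/Vh_H10v.
by case: disc => _ _ _ _ h e; exact: h.
Qed.

Lemma Vh0_sub v w : Vh0 Om Vh Qh v -> Vh0 Om Vh Qh w -> Vh0 Om Vh Qh (v - w).
Proof.
move=> [Vv bv] [Vw bw]; split; last first.
  move=> q Qq; have [_ [_ /(_ q Qq)[_ [Lq _]] _ _] _ _ _] := disc.
  by rewrite (bformB d0 oOm (Vh_good Vv).1 (Vh_good Vw).1 Lq) bv// bw// subrr.
have [[[_ hD hZ _] _ _] _ _ _ _] := disc.
have := hD _ _ Vv (hZ (-1) _ Vw).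
by congr Vh; apply/funext => x; rewrite scaleN1r.
Qed.

Lemma Qtilde_H1 q : Qtilde Qh Q' q -> Hk 1 Om q.
Proof.
move=> [q1 [q2 [h1 h2 ->]]]; have [_ [_ hQ hQ' _] _ _ _] := disc.
by apply: HkD => //; [exact: (hQ _ h1).2|exact: hQ'].
Qed.

Lemma Qtilde_sub q r : Qtilde Qh Q' q -> Qtilde Qh Q' r -> Qtilde Qh Q' (q - r).
Proof.
move=> [q1 [q2 [h1 h2 ->]]] [r1 [r2 [k1 k2 ->]]].
have [[_ [_ hD hZ _] [_ hD' hZ' _]] _ _ _ _] := disc.
exists (fun x => q1 x + (-1 : R) * r1 x), (fun x => q2 x + (-1 : R) * r2 x); split.
- exact: hD h1 (hZ (-1) _ k1).
- exact: hD' h2 (hZ' (-1) _ k2).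
- by apply/funext => x; rewrite !fctE; ring.
Qed.

(** The divergence agrees almost everywhere with some [q] in [Qh]; testing the discrete constraint
    with this [q] gives the square norm of the divergence. *)
Lemma Vh0_div0 v :
  (forall v, Vh v -> exists2 q, Qh q & divergence Om v = q %[ae mu in Om]) ->
  Vh0 Om Vh Qh v -> divergence Om v = (fun=> 0) %[ae mu in Om].
Proof.
move=> H [Vv bv]; have [q Qq hq] := H _ Vv.
have [_ [_ /(_ q Qq)[_ [Lq _]] _ _] _ _ _] := disc.
have mOm := open_measurable_rV oOm.
have Ld := L2_divergence oOm (Vh_good Vv).1.
apply: (L2_ipr0 mOm Ld); rewrite -[RHS](bv _ Qq) /bform.
by apply: (ipr_ae mOm Ld Ld Ld Lq _ hq); exact: aeW.
Qed.

End discrete_facts.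

(** * Scaling of the individual error contributions in h, the velocity and the viscosity *)

Section numerics.
Context {R : realType}.
Implicit Types (phi : R -> R).

Lemma phi_nondecreasing phi (Cinv : R) : 0 < Cinv -> (forall g, 0 < g -> 0 < phi g) ->
  {in Num.pos &, {homo phi : x y / x <= y}} \/
    {in Num.pos &, {homo phi : x y /~ x <= y}} ->
  (forall g, 0 < g -> phi g <= Num.min 1 (4 * g / Cinv)) ->
  {in Num.pos &, {homo phi : x y / x <= y}}.
Proof.
move=> C0 phi0 [//|anti] phile; exfalso.
have p1 := phi0 1 ltr01.
(* At this [g] the linear bound on [phi] is at most half of [phi 1], while antitonicity and [g <= 1]
   would give at least [phi 1]. *)
pose g := Num.min 1 (phi 1 * Cinv / 8).
have g0 : 0 < g by rewrite lt_min ltr01 divr_gt0// mulr_gt0.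
have h1 : phi 1 <= phi g by apply: anti; rewrite ?posrE// ge_min lexx.
have := phile _ g0; rewrite le_min => /andP[_ h2].
have h3 : 4 * g / Cinv <= phi 1 / 2.
  rewrite ler_pdivrMr//; have : g <= phi 1 * Cinv / 8 by rewrite ge_min lexx orbT.
  by lra.
by move: (le_trans h1 (le_trans h2 h3)) p1; lra.
Qed.

Lemma min_size_le d nel (E : 'I_nel -> set 'rV[R]_d) e : min_size E <= diam (E e).
Proof. exact: bigmin_le. Qed.

Lemma mesh_size_ge d nel (E : 'I_nel -> set 'rV[R]_d) e : diam (E e) <= mesh_size E.
Proof. exact: le_bigmax. Qed.

Lemma mesh_size_quasi d nel (E : 'I_nel -> set 'rV[R]_d) (C : R) e :
  (forall e, 0 < diam (E e)) -> mesh_size E / min_size E <= C ->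
  mesh_size E <= C * diam (E e).
Proof.
move=> dE hC; have h0 : 0 < mesh_size E := lt_le_trans (dE e) (mesh_size_ge E e).
(* The default value of the minimum is [mesh_size E], which is positive too. *)
have m0 : 0 < min_size E by apply/bigmin_gtP; split => // e' _.
have C0 : 0 <= C by apply: le_trans hC; rewrite divr_ge0// ltW.
move: hC; rewrite ler_pdivrMr// => /le_trans; apply.
by rewrite ler_wpM2l// min_size_le.
Qed.

Variables (D Cint Cinv A nu h M Ku : R).
Hypotheses (D0 : 0 <= D) (Cint0 : 0 < Cint) (Cinv0 : 0 < Cinv) (A0 : 0 < A) (nu0 : 0 < nu)
  (h0 : 0 < h) (Ku0 : 0 <= Ku) (MA : A * h <= M) (Mnu : nu <= M).

(** In these bounds [D] is the dimension, [A] the length of [a], [M] the maximum of |a| h and nu,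
    and [Ku] is h^(2 kv) times the squared semi-norm of u. *)
Lemma num_S2 S Dn : S <= Dn -> Dn <= D * (Cint * Ku) ->
  2 * nu * S <= 2 * D * Cint * (M * Ku).
Proof.
move=> h1 h2; apply: (@le_trans _ _ (2 * nu * (D * (Cint * Ku)))).
  by rewrite ler_wpM2l ?mulr_ge0 ?(ltW nu0)// (le_trans h1).
have -> : 2 * nu * (D * (Cint * Ku)) = 2 * D * Cint * (nu * Ku) by ring.
by rewrite ler_wpM2l ?mulr_ge0 ?(ltW Cint0)// ler_wpM2r.
Qed.

(** One of the two factors |a| is paid by tau <= h / (2|a|), which leaves |a| h <= M. *)
Lemma num_NA N T Av Dn : 0 <= T -> T <= h / (2 * A) -> N <= T * Av ->
  Av <= D * A ^+ 2 * Dn -> Dn <= D * (Cint * Ku) -> N <= D ^+ 2 * Cint / 2 * (M * Ku).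
Proof.
move=> T0 TA h1 h2 h3; apply: (le_trans h1).
have DA : 0 <= D * A ^+ 2 by rewrite mulr_ge0// exprn_ge0// ltW.
have h4 : Av <= D * A ^+ 2 * (D * (Cint * Ku)) by rewrite (le_trans h2)// ler_wpM2l.
have Y0 : 0 <= D * A ^+ 2 * (D * (Cint * Ku)).
  by rewrite mulr_ge0// !mulr_ge0// ltW.
apply: (@le_trans _ _ (h / (2 * A) * (D * A ^+ 2 * (D * (Cint * Ku))))).
  by apply: (@le_trans _ _ (T * (D * A ^+ 2 * (D * (Cint * Ku)))));
    [rewrite ler_wpM2l|rewrite ler_wpM2r].
have -> : h / (2 * A) * (D * A ^+ 2 * (D * (Cint * Ku))) = D ^+ 2 * Cint / 2 * (A * h * Ku).
  by field; rewrite gt_eqF.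
by rewrite ler_wpM2l ?ler_wpM2r// divr_ge0// mulr_ge0 ?exprn_ge0// ltW.
Qed.

(** In both regimes tau is at most a constant times h^2 / M: by (ii) if M = nu, and by tau <= h /
    (2|a|) if M = |a| h. The constant [Cinv^-1 + 1] covers both cases. *)
Lemma num_NG N T G Kq : 0 <= Kq -> 0 <= T -> T <= h ^+ 2 / (Cinv * nu) -> T <= h / (2 * A) ->
  M = Num.max (A * h) nu ->
  N <= T * G -> G <= D * (Cint * Kq) ->
  N <= (Cinv^-1 + 1) * D * Cint * (M^-1 * (Kq * h ^+ 2)).
Proof.
move=> Kq0 T0 T1 T2 ME h1 h2; have M0 : 0 < M := lt_le_trans nu0 Mnu.
have TM : T <= (Cinv^-1 + 1) * (h ^+ 2 / M).
  rewrite mulrDl mul1r; have [le|lt] := leP (A * h) nu.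
    have -> : M = nu by rewrite ME; apply/max_idPr.
    apply: (le_trans T1); rewrite invfM mulrA [_ / Cinv]mulrC -mulrA lerDl.
    by rewrite divr_ge0 ?exprn_ge0// ltW.
  have -> : M = A * h by rewrite ME; apply/max_idPl/ltW.
  apply: (le_trans T2); apply: (@le_trans _ _ (h ^+ 2 / (A * h))).
    rewrite (_ : h ^+ 2 / (A * h) = 2 * (h / (2 * A))); last first.
      by field; rewrite !gt_eqF.
    have : 0 <= h / (2 * A) by rewrite divr_ge0 ?mulr_ge0 ?ltW.
    by move: (h / (2 * A)) => z; lra.
  by rewrite lerDr mulr_ge0 ?invr_ge0 ?(ltW Cinv0)// divr_ge0 ?exprn_ge0 ?mulr_ge0 ?ltW.
apply: (le_trans h1); have Y0 : 0 <= D * (Cint * Kq) by rewrite !mulr_ge0// ltW.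
apply: (@le_trans _ _ ((Cinv^-1 + 1) * (h ^+ 2 / M) * (D * (Cint * Kq)))).
  by apply: (@le_trans _ _ (T * (D * (Cint * Kq)))); [rewrite ler_wpM2l|rewrite ler_wpM2r].
by rewrite le_eqVlt; apply/orP; left; apply/eqP; ring.
Qed.

(** [Kv] is h^(2 kv - 2) times the squared semi-norm of u. The factor h^2 lost in the H^2
    interpolation error is regained from tau <= h^2 / (Cinv nu), which also removes one factor
    nu. *)
Lemma num_NV N T V Kv : 0 <= Kv -> Kv * h ^+ 2 = Ku -> T <= h ^+ 2 / (Cinv * nu) ->
  0 <= T -> N <= T * V ->
  V <= 4 * D ^+ 2 * nu ^+ 2 * (Cint * Kv) -> N <= 4 * D ^+ 2 * Cint / Cinv * (M * Ku).
Proof.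
move=> Kv0 KvE T1 T0 h1 h2; apply: (le_trans h1).
have Y0 : 0 <= 4 * D ^+ 2 * nu ^+ 2 * (Cint * Kv).
  by rewrite !mulr_ge0 ?exprn_ge0// ltW.
apply: (@le_trans _ _ (h ^+ 2 / (Cinv * nu) * (4 * D ^+ 2 * nu ^+ 2 * (Cint * Kv)))).
  by apply: (@le_trans _ _ (T * (4 * D ^+ 2 * nu ^+ 2 * (Cint * Kv))));
    [rewrite ler_wpM2l|rewrite ler_wpM2r].
have -> : h ^+ 2 / (Cinv * nu) * (4 * D ^+ 2 * nu ^+ 2 * (Cint * Kv)) =
    4 * D ^+ 2 * Cint / Cinv * (nu * (Kv * h ^+ 2)).
  by field; rewrite !gt_eqF.
by rewrite KvE ler_wpM2l ?ler_wpM2r// divr_ge0 ?mulr_ge0 ?exprn_ge0// ltW.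
Qed.

(** Here (|a| h)^2 <= M nu, because |a| h is bounded by both M and nu. *)
Lemma num_diffusive B : A * h <= nu -> B <= Cint * (Ku * h ^+ 2) ->
  2 * (D * A ^+ 2 / nu) * B <= 2 * D * Cint * (M * Ku).
Proof.
move=> le h1; have k0 : 0 <= 2 * (D * A ^+ 2 / nu).
  by rewrite mulr_ge0// divr_ge0 ?mulr_ge0 ?exprn_ge0// ltW.
apply: (le_trans (ler_wpM2l k0 h1)).
have -> : 2 * (D * A ^+ 2 / nu) * (Cint * (Ku * h ^+ 2)) =
    2 * D * Cint * ((A * h) ^+ 2 / nu * Ku) by field; rewrite gt_eqF.
rewrite ler_wpM2l ?mulr_ge0 ?(ltW Cint0)// ler_wpM2r//.
have Ah0 : 0 <= A * h by rewrite mulr_ge0// ltW.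
by rewrite ler_pdivrMr// expr2 ler_pM// (le_trans le).
Qed.

(** The coefficient is the Young weight 2 times the bound on 1/tau of the convective regime, where
    [p] is the value of [phi] at 1/(2 Cqu). *)
Lemma num_convective B (Cqu p : R) : 0 < Cqu -> 0 < p -> B <= Cint * (Ku * h ^+ 2) ->
  2 * (2 * A * Cqu / (h * p)) * B <= 4 * Cqu / p * Cint * (M * Ku).
Proof.
move=> C0 p0 h1; have k0 : 0 <= 2 * (2 * A * Cqu / (h * p)).
  by rewrite mulr_ge0// divr_ge0 ?mulr_ge0// ltW.
apply: (le_trans (ler_wpM2l k0 h1)).
have -> : 2 * (2 * A * Cqu / (h * p)) * (Cint * (Ku * h ^+ 2)) =
    4 * Cqu / p * Cint * (A * h * Ku) by field; rewrite !gt_eqF.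
by rewrite ler_wpM2l ?ler_wpM2r// !mulr_ge0 ?invr_ge0// ltW.
Qed.

End numerics.

(** * Bounds on the stabilization parameter *)

Section parameter.
Context {R : realType} {d : nat}.
Local Notation pt := 'rV[R]_d.
Local Notation mu := (lebesgue_rV R d).
Variables (Om : set pt) (nel : nat) (E : 'I_nel -> set pt).
Hypothesis meshE : is_mesh Om E.
Variables (phi : R -> R) (Cqu Cinv A nu : R) (tauM : pt -> R).
Hypotheses (Cqu0 : 0 < Cqu) (Cinv0 : 0 < Cinv) (A0 : 0 < A) (nu0 : 0 < nu).
Hypotheses (phi_gt0 : forall g, 0 < g -> 0 < phi g)
  (phi_mono : {in Num.pos &, {homo phi : x y / x <= y}})
  (phi_le : forall g, 0 < g -> phi g <= Num.min 1 (4 * g / Cinv)).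
Hypothesis dE : forall e, 0 < diam (E e).
Let h := mesh_size E.
Hypothesis hq : forall e, h <= Cqu * diam (E e).
Hypothesis tau_ii : forall e x, E e x -> tauM x <= diam (E e) ^+ 2 / (Cinv * nu).
Hypothesis tau_v : forall e x, E e x ->
  tauM x = diam (E e) / (2 * A) * phi (A * diam (E e) / (2 * nu)).

Let h0 (e : 'I_nel) : 0 < h := lt_le_trans (dE e) (mesh_size_ge E e).

(** The first bound is (ii) with h_e <= h, the second is (v) with phi <= 1. *)
Lemma tau_le_sup : {ae mu, forall x, Om x ->
  tauM x <= Num.min (h ^+ 2 / (Cinv * nu)) (h / (2 * A))}.
Proof.
apply: (ae_mesh meshE) => e x Ex; rewrite le_min; apply/andP; split.
  apply: (le_trans (tau_ii Ex)); rewrite ler_wpM2r//.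
    by rewrite invr_ge0 mulr_ge0// ltW.
  by rewrite lerXn2r ?nnegrE ?(ltW (dE e)) ?(ltW (h0 e)) ?mesh_size_ge.
have ge0 : 0 < A * diam (E e) / (2 * nu) by rewrite divr_gt0 ?mulr_gt0.
have phi1 : phi (A * diam (E e) / (2 * nu)) <= 1.
  by have := phi_le ge0; rewrite le_min => /andP[].
rewrite (tau_v Ex); apply: (@le_trans _ _ (diam (E e) / (2 * A))).
  by apply: ler_piMr => //; rewrite divr_ge0 ?mulr_ge0 ?(ltW A0) ?(ltW (dE e)).
by rewrite ler_wpM2r ?mesh_size_ge// invr_ge0 mulr_ge0// ltW.
Qed.

(* In the convective regime the element Peclet numbers are bounded below, and so
   is phi, being nondecreasing. *)
Lemma tau_inv_le : nu < A * h -> {ae mu, forall x, Om x ->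
  (tauM x)^-1 <= 2 * A * Cqu / (h * phi (2 * Cqu)^-1)}.
Proof.
move=> lt; apply: (ae_mesh meshE) => e x Ex.
have h_gt0 := h0 e; have dEe := dE e.
have g0 : 0 < (2 * Cqu)^-1 by rewrite invr_gt0 mulr_gt0.
have p0 := phi_gt0 g0.
have ge0 : 0 < A * diam (E e) / (2 * nu) by rewrite divr_gt0 ?mulr_gt0.
have gg : (2 * Cqu)^-1 <= A * diam (E e) / (2 * nu).
  rewrite ler_pdivlMr ?mulr_gt0// invfM mulrACA mulVf// mul1r ler_pdivrMl//.
  apply: (le_trans (ltW lt)); rewrite mulrCA ler_pM2l//; exact: hq.
have pp := phi_mono g0 ge0 gg.
rewrite -[_ / (h * _)]invrK lef_pV2 ?posrE; last first.
- by rewrite invr_gt0 divr_gt0 ?mulr_gt0.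
- by rewrite (tau_v Ex) mulr_gt0 ?divr_gt0 ?mulr_gt0 ?phi_gt0.
rewrite (tau_v Ex).
apply: (@le_trans _ _ (diam (E e) / (2 * A) * phi (2 * Cqu)^-1)); last first.
  by apply: ler_wpM2l => //; rewrite divr_ge0 ?mulr_ge0 ?(ltW A0) ?(ltW dEe).
have -> : (2 * A * Cqu / (h * phi (2 * Cqu)^-1))^-1 =
    h / Cqu / (2 * A) * phi (2 * Cqu)^-1.
  by field; rewrite !gt_eqF.
apply: ler_wpM2r; first exact: ltW.
apply: ler_wpM2r; first by rewrite invr_ge0 mulr_ge0// ltW.
by rewrite ler_pdivrMr// mulrC.
Qed.

End parameter.

(** * Assembly of the error bound *)

Section assembly.
Context {R : realType} {d : nat}.
Local Notation pt := 'rV[R]_d.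
Local Notation mu := (lebesgue_rV R d).
Hypothesis d0 : (0 < d)%N.
Variables (Om : set pt) (nu : R) (a : pt) (nel : nat) (E : 'I_nel -> set pt).
Hypotheses (oOm : open Om) (meshE : is_mesh Om E) (nu0 : 0 < nu) (a0 : a != 0).
Variables (tauM : pt -> R) (T : R).
Hypotheses (mtau : measurable_fun Om tauM) (tau0 : forall x, Om x -> 0 < tauM x)
  (T0 : 0 <= T) (tauT : {ae mu, forall x, Om x -> tauM x <= T}).
Let mOm : measurable Om := open_measurable_rV oOm.
Let s := sqtau tauM.

Lemma ip_sqtau_Yv v q : Hkv 1 Om v -> Hk 1 Om q ->
  ip Om (scalef s (Yv Om a v q)) (scalef s (Yv Om a v q)) <=
  2 * ip Om (scalef s (Av Om a v)) (scalef s (Av Om a v)) +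
  2 * ip Om (scalef s (Gq Om q)) (scalef s (Gq Om q)).
Proof.
move=> hv hq.
have LA := L2_sqtau oOm mtau tauT (L2_Av a oOm hv).
have LG := L2_sqtau oOm mtau tauT (L2_Gq hq).
have -> : scalef s (Yv Om a v q) =
    fun i x => scalef s (Av Om a v) i x + scalef s (Gq Om q) i x.
  by apply/funext => i; apply/funext => x; exact: mulrDr.
exact: (ip_D2 mOm LA LG).
Qed.

Lemma ortho_div0 v w q : Hkv 1 Om v -> H10v Om v -> H10v Om w -> Hk 1 Om q ->
  divergence Om v = (fun=> 0) %[ae mu in Om] -> divergence Om w = (fun=> 0) %[ae mu in Om] ->
  ip Om (coordf (v - w)) (Gq Om q) = 0.
Proof.
move=> hv1 hv hw hq dv dw; have hw1 := H10v_Hkv hw.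
have Lq : L2 Om q := Hk_L2 hq.
have ev := bform_ibp d0 oOm hv hq; have ew := bform_ibp d0 oOm hw hq.
rewrite (bform_ae0 oOm hv1 Lq dv) in ev; rewrite (bform_ae0 oOm hw1 Lq dw) in ew.
have -> : coordf (v - w) = fun i x => coordf v i x - coordf w i x.
  by apply/funext => i; exact: coordfB.
rewrite (ipBl mOm (L2_coordf hv1) (L2_coordf hw1) (L2_Gq hq)).
have z (t : R) : 0 = - t -> t = 0 by move/esym/eqP; rewrite oppr_eq0 => /eqP.
exact: (etrans (congr2 (fun s t => s - t) (z _ ev) (z _ ew)) (subrr 0)).
Qed.

(** The bound of one regime is padded with the nonnegative terms of the other, so that both regimes
    yield the same remainder with coefficient [k1 + k2]. *)
Lemma case_diffusive (C S B Y k1 k2 X : R) : C <= S / 8 + B -> B <= k1 * X -> 0 <= Y ->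
  0 <= k2 * X -> C <= S / 8 + Y / 8 + (k1 + k2) * X.
Proof. by rewrite mulrDl; move: (k1 * X) (k2 * X) => *; lra. Qed.

Lemma case_convective (C S B Y k1 k2 X : R) : C <= Y / 8 + B -> B <= k2 * X -> 0 <= S ->
  0 <= k1 * X -> C <= S / 8 + Y / 8 + (k1 + k2) * X.
Proof. by rewrite mulrDl; move: (k1 * X) (k2 * X) => *; lra. Qed.

Lemma combine_arith (t S N C V NA NG X Z cS cA cC cV cG : R) :
  t <= 18 * S + 34 * N + 8 * C + 32 * V -> N <= 2 * NA + 2 * NG ->
  S <= cS * X -> NA <= cA * X -> NG <= cG * Z -> C = cC * X -> V <= cV * X ->
  t <= (18 * cS + 34 * (2 * cA) + 8 * cC + 32 * cV) * X + 34 * (2 * cG) * Z.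
Proof.
move=> h1 h2 h3 h4 h5 h6 h7; apply: (le_trans h1); rewrite h6.
have -> : (18 * cS + 34 * (2 * cA) + 8 * cC + 32 * cV) * X + 34 * (2 * cG) * Z =
  18 * (cS * X) + 34 * (2 * (cA * X) + 2 * (cG * Z)) + 8 * (cC * X) + 32 * (cV * X) by ring.
apply: lerD; last by rewrite ler_pM2l.
rewrite lerD2r; apply: lerD; first by rewrite ler_pM2l.
by rewrite ler_pM2l//; apply: (le_trans h2); apply: lerD; rewrite ler_pM2l.
Qed.

Lemma resB_err xi xip u uh w p ph r : goodv Om E xi -> Hk 1 Om xip ->
  goodv Om E u -> goodv Om E uh -> goodv Om E w -> Hk 1 Om p -> Hk 1 Om ph -> Hk 1 Om r ->
  resB Om nu a E tauM xi xip u p = resB Om nu a E tauM xi xip uh ph ->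
  resB Om nu a E tauM xi xip (u - w) (p - r) = resB Om nu a E tauM xi xip (uh - w) (ph - r).
Proof.
move=> gxi hxip gu guh gw hp hph hr e.
have rB v q := @resB_sub _ _ d0 Om nu a nel E oOm meshE tauM mtau tau0 T tauT xi xip
  gxi hxip v w q r.
have r1 := rB _ _ gu gw hp hr; have r2 := rB _ _ guh gw hph hr.
exact: (etrans r1 (etrans (congr1 (fun t => t - resB Om nu a E tauM xi xip w r) e) (esym r2))).
Qed.

Variables (Cint Cinv Cqu p h Ku Kv Kq : R).
Hypotheses (Cint0 : 0 < Cint) (Cinv0 : 0 < Cinv) (Cqu0 : 0 < Cqu) (p0 : 0 < p) (h0 : 0 < h)
  (Ku0 : 0 <= Ku) (Kv0 : 0 <= Kv) (Kq0 : 0 <= Kq) (KvE : Kv * h ^+ 2 = Ku)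
  (T1 : T <= h ^+ 2 / (Cinv * nu)) (T2 : T <= h / (2 * enorm a))
  (tauV : nu < enorm a * h -> {ae mu, forall x, Om x ->
     (tauM x)^-1 <= 2 * enorm a * Cqu / (h * p)}).

(** Here [p] is the lower bound of [phi] in the convective regime, not the pressure; [Ku], [Kv] and
    [Kq] stand for the powers of h times the squared semi-norms left by interpolation. The numerical
    coefficients are those of [total_arith] times the constants of the scaling bounds. *)
Lemma error_bound eta xi etap xip :
  goodv Om E eta -> goodv Om E xi -> Hk 1 Om etap -> Hk 1 Om xip -> H10v Om xi ->
  resB Om nu a E tauM xi xip eta etap = resB Om nu a E tauM xi xip xi xip ->
  ip Om (coordf eta) (Gq Om xip) = 0 ->
  ip Om (scalef s (Vv nu E xi)) (scalef s (Vv nu E xi)) <= nu * ip Om (Sv Om xi) (Sv Om xi) ->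
  ip Om (coordf eta) (coordf eta) <= Cint * (Ku * h ^+ 2) ->
  ip Om (Dv Om eta) (Dv Om eta) <= d%:R * (Cint * Ku) ->
  ip Om (Vv nu E eta) (Vv nu E eta) <= 4 * d%:R ^+ 2 * nu ^+ 2 * (Cint * Kv) ->
  ip Om (Gq Om etap) (Gq Om etap) <= d%:R * (Cint * Kq) ->
  tnorm2 Om a nu tauM (eta - xi) (etap - xip) <=
  (18 * (2 * d%:R * Cint) + 34 * (2 * (d%:R ^+ 2 * Cint / 2)) +
   8 * (2 * d%:R * Cint + 4 * Cqu / p * Cint) + 32 * (4 * d%:R ^+ 2 * Cint / Cinv)) *
    (Num.max (enorm a * h) nu * Ku) +
  34 * (2 * ((Cinv^-1 + 1) * d%:R * Cint)) *
    ((Num.max (enorm a * h) nu)^-1 * (Kq * h ^+ 2)).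
Proof.
have A0 := enorm_gt0 a0; have D0 : 0 <= d%:R :> R by rewrite ler0n.
have MA : enorm a * h <= Num.max (enorm a * h) nu by rewrite le_max lexx.
have Mnu : nu <= Num.max (enorm a * h) nu by rewrite le_max lexx orbT.
have X0 : 0 <= Num.max (enorm a * h) nu * Ku by rewrite mulr_ge0// (le_trans _ Mnu)// ltW.
have M0 : 0 <= 2 * enorm a * Cqu / (h * p).
  by rewrite divr_ge0 ?mulr_ge0 ?(ltW A0) ?(ltW Cqu0) ?(ltW h0) ?(ltW p0).
have kD : 0 <= 2 * d%:R * Cint * (Num.max (enorm a * h) nu * Ku).
  by rewrite mulr_ge0// !mulr_ge0// ltW.
have kC : 0 <= 4 * Cqu / p * Cint * (Num.max (enorm a * h) nu * Ku).
  by rewrite mulr_ge0// !mulr_ge0 ?invr_ge0// ltW.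
move=> geta gxi hetap hxip hxi hB orth hinv b0 b1 b2 b3.
have hskew := cform_skew d0 a oOm hxi.
have he1 := geta.1.
have hC0 : ip Om (Av Om a eta) (coordf xi) <=
    2 * nu * ip Om (Sv Om xi) (Sv Om xi) / 8 +
    ip Om (scalef s (Yv Om a xi xip)) (scalef s (Yv Om a xi xip)) / 8 +
    (2 * d%:R * Cint + 4 * Cqu / p * Cint) * (Num.max (enorm a * h) nu * Ku).
  have y0 := ip_ge0 Om (scalef s (Yv Om a xi xip)).
  have s0 := mulr_ge0 (mulr_ge0 (ler0n R 2) (ltW nu0)) (ip_ge0 Om (Sv Om xi)).
  have [le|] := boolP (enorm a * h <= nu); last rewrite -ltNge => lt.
    have h1 := advection_diffusive d0 oOm nu0 a0 he1 hxi.
    have h2 := num_diffusive D0 Cint0 A0 nu0 h0 Ku0 MA le b0.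
    exact: (case_diffusive h1 h2 y0 kC).
  have h1 := advection_convective d0 a oOm mtau tau0 tauT M0 (tauV lt) he1 hxi hxip orth.
  have h2 := num_convective Cint0 A0 h0 Ku0 MA Cqu0 p0 b0.
  exact: (case_convective h1 h2 s0 kD).
have key := energy_estimate d0 oOm meshE nu0 mtau tau0 tauT geta gxi hetap hxip hB hskew
  hinv hC0.
have LA := L2_Av a oOm he1; have LG := L2_Gq hetap.
have LV := L2_Vv nu oOm meshE geta.
apply: (combine_arith key (ip_sqtau_Yv he1 hetap) _ _ _ erefl _).
- exact: (num_S2 D0 Cint0 nu0 Ku0 Mnu (ip_Sv_le oOm he1) b1).
- exact: (num_NA D0 Cint0 A0 Ku0 MA T0 T2 (ip_sqtau_le oOm T0 mtau tauT LA)
    (ip_Av_le a oOm he1) b1).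
- exact: (num_NG D0 Cint0 Cinv0 A0 nu0 h0 Mnu Kq0 T0 T1 T2 erefl
    (ip_sqtau_le oOm T0 mtau tauT LG) b3).
- exact: (num_NV D0 Cint0 Cinv0 nu0 Ku0 Mnu Kv0 KvE T1 T0
    (ip_sqtau_le oOm T0 mtau tauT LV) b2).
Qed.

End assembly.

Lemma sum_coef_le (R : realDomainType) (x z X Z : R) : 0 <= x -> 0 <= z -> 0 <= X -> 0 <= Z ->
  x * X + z * Z <= (x + z) * (X + Z).
Proof.
move=> x0 z0 X0 Z0; have -> : (x + z) * (X + Z) = x * X + z * Z + (x * Z + z * X) by ring.
by rewrite lerDl addr_ge0// mulr_ge0.
Qed.

Lemma interp_exp0 (R : comNzRingType) (C h U : R) k :
  C * h ^+ (2 * (k.+1 - 0)) * U = C * (h ^+ (2 * k) * U * h ^+ 2).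
Proof. by rewrite subn0 mulnS exprD; ring. Qed.

Lemma interp_exp1 (R : comNzRingType) (C h U : R) k :
  C * h ^+ (2 * (k.+1 - 1)) * U = C * (h ^+ (2 * k) * U).
Proof. by rewrite subSS subn0 mulrA. Qed.

(** The condition [1 <= k] keeps the natural subtraction [k.+1 - 2] from being truncated, which
    would break the exponent count. *)
Lemma interp_exp2 (R : comNzRingType) (h U : R) k : (1 <= k)%N ->
  h ^+ (2 * (k.+1 - 2)) * U * h ^+ 2 = h ^+ (2 * k) * U.
Proof. by case: k => // k _; rewrite !subSS subn0 mulnS exprD; ring. Qed.

Lemma interp_exp3 (R : comNzRingType) (h P : R) k :
  h ^+ (2 * k) * P * h ^+ 2 = h ^+ (2 * k + 2) * P.
Proof. by rewrite exprD mulrAC. Qed.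

Lemma hsemi2v_ge0 (R : realType) d k (D : set 'rV[R]_d) v : 0 <= hsemi2v k D v.
Proof. by apply: sumr_ge0 => i _; exact: hsemi2_ge0. Qed.

Theorem theorem2 (R : realType) (d kv kq : nat) (Cqu Cinv Cinterp : R)
    (phi : R -> R) :
  d = 2%N \/ d = 3%N -> (1 <= kv)%N ->
  0 < Cqu -> 0 < Cinv -> 0 < Cinterp ->
  (forall g, 0 < g -> 0 < phi g) ->
  {in Num.pos &, {homo phi : x y / x <= y}} \/
    {in Num.pos &, {homo phi : x y /~ x <= y}} ->
  (forall g, 0 < g -> phi g <= Num.min 1 (4 * g / Cinv)) ->
  exists Cbound : R,
  forall (Om : set 'rV[R]_d) (f : 'rV[R]_d -> 'rV[R]_d) (a : 'rV[R]_d) (nu : R)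
    (nel : nat) (E : 'I_nel -> set 'rV[R]_d)
    (Vh : set ('rV[R]_d -> 'rV[R]_d)) (Qh Q' : set ('rV[R]_d -> R))
    (tauC tauM : 'rV[R]_d -> R),
  is_domain Om -> L2v Om f -> a != 0 -> 0 < nu ->
  is_mesh Om E -> discrete_spaces Om E Vh Qh Q' ->
  measurable_fun Om tauC -> measurable_fun Om tauM ->
  (forall x, Om x -> 0 <= tauC x /\ 0 < tauM x) ->
  let h := mesh_size E in
  h / min_size E <= Cqu ->
  (* (i) *)
  (forall e v, Vh v ->
     iprv (E e) (visc_div (E e) nu v) (visc_div (E e) nu v) <=
     Cinv / diam (E e) ^+ 2 *
     iprm (E e) (fun x => nu *: sgrad (E e) v x)
                (fun x => nu *: sgrad (E e) v x)) ->
  (* (ii) *)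
  (forall e x, E e x -> tauM x <= diam (E e) ^+ 2 / (Cinv * nu)) ->
  (* (iii) *)
  (forall v, Vh v -> exists2 q, Qh q & divergence Om v = q %[ae lebesgue_rV R d in Om]) ->
  (* (iv) *)
  (exists Iv : ('rV[R]_d -> 'rV[R]_d) -> ('rV[R]_d -> 'rV[R]_d),
     (forall v, H10div0 Om v -> Vh0 Om Vh Qh (Iv v)) /\
     forall v l, H10div0 Om v -> Hkv kv.+1 Om v -> (l <= kv.+1)%N ->
       (forall e, Hkv l (E e) (v - Iv v)) /\
       \sum_e hsemi2v l (E e) (v - Iv v) <=
         Cinterp * h ^+ (2 * (kv.+1 - l)) * hsemi2v kv.+1 Om v) ->
  (exists Iq : ('rV[R]_d -> R) -> ('rV[R]_d -> R),
     (forall q, L20 Om q -> Qtilde Qh Q' (Iq q)) /\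
     forall q l, L20 Om q -> Hk kq.+1 Om q -> (l <= kq.+1)%N ->
       (forall e, Hk l (E e) (q - Iq q)) /\
       \sum_e hsemi2 l (E e) (q - Iq q) <=
         Cinterp * h ^+ (2 * (kq.+1 - l)) * hsemi2 kq.+1 Om q) ->
  (* (v) *)
  (forall e x, E e x ->
     tauM x = diam (E e) / (2 * enorm a) *
              phi (enorm a * diam (E e) / (2 * nu))) ->
  forall (u uh : 'rV[R]_d -> 'rV[R]_d) (p ph : 'rV[R]_d -> R),
  oseen_solution Om a nu f u p ->
  Hkv kv.+1 Om u -> Hk kq.+1 Om p ->
  reduced_solution Om a nu f E tauC tauM Vh Qh Q' uh ph ->
  tnorm2 Om a nu tauM (u - uh) (p - ph) <=
  Cbound * (Num.max (enorm a * h) nu * h ^+ (2 * kv) * hsemi2v kv.+1 Om u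
          + (Num.max (enorm a * h) nu)^-1 * h ^+ (2 * kq + 2)
            * hsemi2 kq.+1 Om p).
Proof.
move=> d23 kv1 Cqu0 Cinv0 Cint0 phi_gt0 phi_mon phi_le.
have d0 : (0 < d)%N by case: d23 => ->.
have phi_mono := phi_nondecreasing Cinv0 phi_gt0 phi_mon phi_le.
(* A lower bound for all element Peclet numbers in the convective regime; [phi g0] is how the final
   constant depends on [phi]. *)
pose g0 : R := (2 * Cqu)^-1.
have g0_gt0 : 0 < g0 by rewrite invr_gt0 mulr_gt0.
have p0 := phi_gt0 _ g0_gt0.
pose D : R := d%:R.
have D0 : 0 <= D by rewrite ler0n.
(* [cX] and [cZ] are the coefficients of the velocity and the pressure term in [error_bound]; their
   sum dominates both. *)
pose cX := 18 * (2 * D * Cinterp) + 34 * (2 * (D ^+ 2 * Cinterp / 2)) +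
  8 * (2 * D * Cinterp + 4 * Cqu / phi g0 * Cinterp) + 32 * (4 * D ^+ 2 * Cinterp / Cinv).
pose cZ := 34 * (2 * ((Cinv^-1 + 1) * D * Cinterp)).
have cX0 : 0 <= cX.
  by rewrite !addr_ge0 ?mulr_ge0 ?invr_ge0 ?addr_ge0 ?mulr_ge0 ?invr_ge0 ?exprn_ge0// ltW.
have cZ0 : 0 <= cZ by rewrite !mulr_ge0 ?addr_ge0 ?invr_ge0// ltW.
exists (cX + cZ) => Om f a nu nel E Vh Qh Q' tauC tauM dom Lf a0 nu0 meshE disc mC mtau
  tauCM h quasi inv tau_ii divV [Iv [IvV Iv_err]] [Iq [IqQ Iq_err]] tau_v u uh p ph osol
  hu hp rsol.
have [oOm _ [x0 Ox0] bOm] := dom.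
have oE e : open (E e) by exact: (mesh_open meshE).
have EOm e : E e `<=` Om by exact: (mesh_sub meshE).
have tau0 x : Om x -> 0 < tauM x by move=> /tauCM[].
have A0 := enorm_gt0 a0; set A := enorm a in tau_v A0 *.
have dE e : 0 < diam (E e) by exact: (diam_gt0 meshE nu0 tau0 Cinv0 tau_ii e).
(* The domain is nonempty, so an element exists; on an empty mesh [mesh_size] would have its default
   value 0. *)
have [e0 _] : exists e : 'I_nel, True.
  move: Ox0; have [_ _ _ ->] := meshE.
  by move=> /interior_subset[e _ _]; exists e.
have h0 : 0 < h := lt_le_trans (dE e0) (mesh_size_ge E e0).
have hq e : h <= Cqu * diam (E e) := mesh_size_quasi e dE quasi.
have hn n : 0 <= h ^+ n := exprn_ge0 n (ltW h0).
have M0 : 0 <= Num.max (A * h) nu by rewrite le_max (ltW nu0) orbT.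
have Mi : 0 <= (Num.max (A * h) nu)^-1 by rewrite invr_ge0.
have k4 : 0 <= 4 * d%:R ^+ 2 * nu ^+ 2 :> R by rewrite !mulr_ge0 ?exprn_ge0// ltW.
have tauV := tau_inv_le meshE Cqu0 A0 nu0 phi_gt0 phi_mono dE hq tau_v.
pose T := Num.min (h ^+ 2 / (Cinv * nu)) (h / (2 * A)).
have T1 : T <= h ^+ 2 / (Cinv * nu) by rewrite ge_min lexx.
have T2 : T <= h / (2 * A) by rewrite ge_min lexx orbT.
have T0 : 0 <= T.
  by rewrite le_min !divr_ge0 ?mulr_ge0 ?exprn_ge0// ltW.
have tauT : {ae lebesgue_rV R d, forall x, Om x -> tauM x <= T}.
  exact: (tau_le_sup meshE Cinv0 A0 nu0 phi_le dE tau_ii tau_v).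
have hdu : H10div0 Om u := H10div0_of_oseen d0 oOm bOm Lf osol.
have hu2 : Hkv 2 Om u by move=> i; exact: Hk_le (hu i).
have hu1 : Hkv 1 Om u by move=> i; exact: Hk_le (hu i).
have hp1 : Hk 1 Om p by exact: Hk_le hp.
have gu : goodv Om E u.
  split=> // e i; exact: HkS (hu2 i).
have [Vuh Quh _] := rsol.
have p20 : L20 Om p by case: osol.
have VIu := IvV u hdu; have QIp := IqQ p p20.
have [guh gIu] := (Vh_good disc Vuh.1, Vh_good disc VIu.1).
have [hph hIp] := (Qtilde_H1 oOm disc Quh, Qtilde_H1 oOm disc QIp).
pose eta := u - Iv u; pose xi := uh - Iv u.
pose etap := p - Iq p; pose xip := ph - Iq p.
have geta : goodv Om E eta by exact: goodvB.
have gxi : goodv Om E xi by exact: goodvB.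
have hetap : Hk 1 Om etap by exact: HkB.
have hxip : Hk 1 Om xip by exact: HkB.
have Vxi : Vh0 Om Vh Qh xi by exact: (Vh0_sub d0 oOm disc Vuh VIu).
have Qxi : Qtilde Qh Q' xip by exact: (Qtilde_sub disc Quh QIp).
have hxi : H10v Om xi := Vh_H10v disc Vxi.1.
have dxi := Vh0_div0 oOm disc divV Vxi.
have dIu := Vh0_div0 oOm disc divV VIu.
have err_u : u - uh = eta - xi by rewrite /eta /xi opprB addrA subrK.
have err_p : p - ph = etap - xip by rewrite /etap /xip opprB addrA subrK.
have hB : resB Om nu a E tauM xi xip eta etap = resB Om nu a E tauM xi xip xi xip.
  (* Both solutions give the same value of the form against (xi, xip); subtracting the interpolants
     from both keeps the equality. *)
  have e1 := resB_exact d0 oOm meshE mtau tau0 tauT hxi gxi hxip Lf osol hu2 gu hp1 dxi.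
  have e2 := resB_discrete oOm meshE mtau tau0 tauT gxi hxip mC guh hph dxi Vxi Qxi rsol.
  have e3 := etrans e1 (esym e2).
  exact: (resB_err d0 oOm meshE mtau tau0 tauT gxi hxip gu guh gIu hp1 hph hIp e3).
have hinv := inverse_bound d0 oOm meshE nu0 mtau tau0 tauT Cinv0 tau_ii gxi
  (fun e => inv e xi Vxi.1).
have orth := ortho_div0 d0 oOm hu1 hdu.1 (Vh_H10v disc VIu.1) hxip hdu.2 dIu.
have k2 : (2 <= kv.+1)%N by [].
have [_ i0] := Iv_err u 0 hdu hu (leq0n _).
have [_ i1] := Iv_err u 1 hdu hu (ltn0Sn _).
have [_ i2] := Iv_err u 2 hdu hu k2.
have [_ i3] := Iq_err p 1 p20 hp (ltn0Sn _).
rewrite interp_exp0 in i0; rewrite interp_exp1 in i1; rewrite -mulrA in i2.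
rewrite interp_exp1 in i3.
have Ku0 : 0 <= h ^+ (2 * kv) * hsemi2v kv.+1 Om u := mulr_ge0 (hn _) (hsemi2v_ge0 _ _ _).
have Kv0 : 0 <= h ^+ (2 * (kv.+1 - 2)) * hsemi2v kv.+1 Om u :=
  mulr_ge0 (hn _) (hsemi2v_ge0 _ _ _).
have Kq0 : 0 <= h ^+ (2 * kq) * hsemi2 kq.+1 Om p := mulr_ge0 (hn _) (hsemi2_ge0 _ _ _).
have KvE := interp_exp2 h (hsemi2v kv.+1 Om u) kv1.
have b0 := le_trans (ip_coordf_le d0 oOm meshE geta.1) i0.
have b1 := le_trans (ip_Dv_le d0 oOm meshE geta.1) (ler_wpM2l D0 i1).
have b2 := le_trans (ip_Vv_le d0 nu oOm meshE geta) (ler_wpM2l k4 i2).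
have b3 := le_trans (ip_Gq_le d0 oOm meshE hetap) (ler_wpM2l D0 i3).
have eb := error_bound d0 oOm meshE nu0 a0 mtau tau0 T0 tauT Cint0 Cinv0 Cqu0 p0 h0 Ku0 Kv0
  Kq0 KvE T1 T2 tauV geta gxi hetap hxip hxi hB orth hinv b0 b1 b2 b3.
rewrite err_u err_p; apply: (le_trans eb); rewrite interp_exp3.
rewrite -[_ * h ^+ (2 * kv) * _]mulrA -[_^-1 * _ * _]mulrA.
have X0 := mulr_ge0 M0 Ku0.
have Z0 := mulr_ge0 Mi (mulr_ge0 (hn (2 * kq + 2)%N) (hsemi2_ge0 Om kq.+1 p)).
exact: (sum_coef_le cX0 cZ0 X0 Z0).
Qed.
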